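(* Let $n\ge1$, let $Q,B\in M_n(\mathbb{R})$ with $Q$ symmetric positive semi-definite, and assume $$\mathrm{Rank}[Q^{1/2},BQ^{1/2},\dots,B^{n-1}Q^{1/2}]=n,\qquad \sigma(B)\subset\{z\in\mathbb{C}:\mathrm{Re}\,z<0\}.$$ Let $\mathscr{P}=\frac12\mathrm{Tr}(Q\nabla_x^2)-\langle Bx,\nabla_x\rangle-\mathrm{Tr}(B)$, $x\in\mathbb{R}^n$, be the associated Fokker-Planck operator. Set $$\tau_0=\inf_{\lambda\in\sigma(B)}\mathrm{Re}(-\lambda)=-\sup_{\lambda\in\sigma(B)}\mathrm{Re}\,\lambda>0.$$ Then for all $0\le\tau<\tau_0$ there exists a positive constant $C>0$ such that for all $t\ge0$ and all $f\in L^2_{1/\rho}$ with $\int_{\mathbb{R}^n}f(x)\,dx=1$, $$\mathfrak{e}_2(e^{t\mathscr{P}}f|\rho)=\int_{\mathbb{R}^n}\Big|\frac{(e^{t\mathscr{P}}f)(x)}{\rho(x)}-1\Big|^2\rho(x)\,dx\le Ce^{-2\tau t}\int_{\mathbb{R}^n}\frac{|f(x)|^2}{\rho(x)}\,dx .$$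
   Context: Notation: $\mathrm{Tr}(Q\nabla_x^2)=\sum_{i,j}q_{i,j}\partial^2_{x_i,x_j}$ and $\langle Bx,\nabla_x\rangle=\sum_{i,j}b_{i,j}x_j\partial_{x_i}$. $[Q^{1/2},BQ^{1/2},\dots,B^{n-1}Q^{1/2}]$ is the $n\times n^2$ matrix obtained by juxtaposing these blocks. $\rho(x)=\frac{1}{(2\pi)^{n/2}\sqrt{\det Q_\infty}}e^{-\frac12\langle Q_\infty^{-1}x,x\rangle}$ with $Q_\infty=\int_0^{+\infty}e^{sB}Qe^{sB^T}ds$ (symmetric positive definite under the assumptions), and $L^2_{1/\rho}=L^2(\mathbb{R}^n,\rho(x)^{-1}dx)$ (complex valued functions). $(e^{t\mathscr{P}})_{t\ge0}$ denotes the semigroup on $L^2_{1/\rho}$ generated by $\mathscr{P}$ with domain $D(\mathscr{P})=\{f\in L^2_{1/\rho}:\mathscr{P}f\in L^2_{1/\rho}\}$. The quadratic relative entropy is $\mathfrak{e}_2(f|\rho)=\int_{\mathbb{R}^n}\big|\frac{f(x)}{\rho(x)}-1\big|^2\rho(x)\,dx$. *)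

(* Defs.v *)
From HB Require Import structures.
From mathcomp Require Import all_boot all_order all_algebra complex.
From mathcomp Require Import all_classical all_reals all_analysis.

Set Implicit Arguments.
Unset Strict Implicit.
Unset Printing Implicit Defensive.
Import Order.TTheory GRing.Theory Num.Theory.
Import numFieldNormedType.Exports.
Local Open Scope classical_set_scope.
Local Open Scope ring_scope.

(* Points of R^n are row vectors 'rV[R]_n; x_i is x 0 i. *)

Definition rV_display : measure_display. Proof. exact: default_measure_display. Qed.

Definition rV_coord (R : realType) (n : nat) (i : 'I_n) (x : 'rV[R]_n) : R :=
  x 0 i.

(* The Borel sigma-algebra of R^n, generated by the coordinates. *)
HB.instance Definition _ (R : realType) (n : nat) :=
  @isMeasurable.Build rV_display 'rV[R]_n
    (g_sigma_preimage (@rV_coord R n))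
    (@sigma_algebra0 _ _ _) (fun A => @sigma_algebraC _ _ A)
    (@sigma_algebra_bigcup _ setT _).

Lemma measurable_rV_coord (R : realType) (n : nat) (i : 'I_n) :
  measurable_fun [set: 'rV[R]_n] (@rV_coord R n i).
Proof.
move=> _ Y mY; rewrite setTI; apply: sub_sigma_algebra => /=.
rewrite -bigcup_seq/=; exists i => /=; first by rewrite mem_index_enum.
by exists Y => //; rewrite setTI.
Qed.

Lemma measurable_fun_rVP d (T : measurableType d) (R : realType) (n : nat)
    (f : T -> 'rV[R]_n) :
  measurable_fun [set: T] f <->
  forall i, measurable_fun [set: T] (@rV_coord R n i \o f).
Proof.
apply: (@iff_trans _ (g_sigma_preimage
    (fun i => @rV_coord R n i \o f) `<=` measurable)).
  rewrite g_sigma_preimage_comp; split=> [mf A [/= C preC <-]|prefS].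
    exact: mf.
  by move=> _ A mA; apply: prefS; exists A.
split=> [coordS i|mf].
- move=> _ A mA.
  apply: coordS; apply: sub_sigma_algebra.
  rewrite -bigcup_seq/=; exists i => /=; first by rewrite mem_index_enum.
  by exists A => //; rewrite setTI.
- apply: smallest_sub; first exact: sigma_algebra_measurable.
  rewrite -bigcup_seq => A [i /= _ [B mB <-]].
  exact: mf.
Qed.

Definition rV_cons (R : realType) (n : nat) (p : R * 'rV[R]_n) : 'rV[R]_n.+1 :=
  row_mx p.1%:M p.2 : 'rV[R]_(1 + n).

Definition rV_uncons (R : realType) (n : nat) (x : 'rV[R]_n.+1) :
  R * 'rV[R]_n := (x 0 0, \row_i x 0 (lift 0 i)).

Lemma rV_cons0 (R : realType) (n : nat) (p : R * 'rV[R]_n) :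
  rV_cons p 0 0 = p.1.
Proof.
have -> : (0 : 'I_n.+1) = lshift n (0 : 'I_1) by exact: val_inj.
by rewrite [LHS]row_mxEl mxE eqxx mulr1n.
Qed.

Lemma rV_consS (R : realType) (n : nat) (p : R * 'rV[R]_n) (i : 'I_n) :
  rV_cons p 0 (lift 0 i) = p.2 0 i.
Proof.
have -> : lift (0 : 'I_n.+1) i = rshift 1 i by exact: val_inj.
by rewrite [LHS]row_mxEr.
Qed.

Lemma rV_unconsK (R : realType) (n : nat) :
  cancel (@rV_uncons R n) (@rV_cons R n).
Proof.
move=> x; apply/rowP => i.
by have [j ->|->] := unliftP 0 i; rewrite ?rV_consS ?rV_cons0 ?mxE.
Qed.

Lemma rV_consK (R : realType) (n : nat) :
  cancel (@rV_cons R n) (@rV_uncons R n).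
Proof.
move=> p; rewrite /rV_uncons rV_cons0 [RHS]surjective_pairing; congr pair.
by apply/rowP => i; rewrite mxE rV_consS.
Qed.

Lemma measurable_rV_cons (R : realType) (n : nat) :
  measurable_fun [set: R * 'rV[R]_n] (@rV_cons R n).
Proof.
apply/measurable_fun_rVP => i; have [j ->|->] := unliftP 0 i.
- rewrite (_ : _ \o _ = @rV_coord R n j \o snd); last first.
    by apply/funext => p; rewrite /rV_coord /= rV_consS.
  apply: measurableT_comp => //; exact: measurable_rV_coord.
- rewrite (_ : _ \o _ = fst) //.
  by apply/funext => p; rewrite /rV_coord /= rV_cons0.
Qed.

Lemma measurable_rV_uncons (R : realType) (n : nat) :
  measurable_fun [set: 'rV[R]_n.+1] (@rV_uncons R n).
Proof.
apply: measurable_fun_pair; first exact: (measurable_rV_coord (0 : 'I_n.+1)).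
apply/measurable_fun_rVP => i.
rewrite (_ : _ \o _ = @rV_coord R n.+1 (lift 0 i)).
  exact: measurable_rV_coord.
by apply/funext => x; rewrite /rV_coord /= mxE.
Qed.

Section lebesgue_cons.
Local Open Scope ereal_scope.
Context (R : realType) (n : nat).
Context (mu : {sigma_finite_measure set 'rV[R]_n -> \bar R}).

Definition lebesgue_cons : set 'rV[R]_n.+1 -> \bar R :=
  pushforward (@lebesgue_measure R \x mu) (@rV_cons R n).

Let pushforward_cons : {measure set 'rV[R]_n.+1 -> \bar R} :=
  measure_function_pushforward__canonical__measure_function_Measure
    (@lebesgue_measure R \x mu) (@measurable_rV_cons R n).

HB.instance Definition _ := isMeasure.Build _ _ _ lebesgue_cons
  (measure0 pushforward_cons) (measure_ge0 pushforward_cons)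
  (@measure_semi_sigma_additive _ _ _ pushforward_cons).

Let lebesgue_cons_sigma_finite : sigma_finite setT lebesgue_cons.
Proof.
have /sigma_finiteP[F [FT ndF Foo]] := sigma_finiteT (@lebesgue_measure R).
have /sigma_finiteP[G [GT ndG Goo]] := sigma_finiteT mu.
exists (fun k => @rV_uncons R n @^-1` (F k `*` G k)).
  rewrite -preimage_bigcup (_ : \bigcup_k _ = setT) ?preimage_setT//.
  apply/seteqP; split => // -[x y] _.
  have [i _ Fx] : (\bigcup_k F k) x by rewrite -FT.
  have [j _ Gy] : (\bigcup_k G k) y by rewrite -GT.
  exists (maxn i j) => //; split => /=.
    by move: x Fx; exact/subsetPset/ndF/leq_maxl.
  by move: y Gy; exact/subsetPset/ndG/leq_maxr.
move=> k; have [mF Fk] := Foo k; have [mG Gk] := Goo k; split.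
  rewrite -[X in measurable X]setTI; apply: measurable_rV_uncons => //.
  exact: measurableX.
rewrite /lebesgue_cons /pushforward -comp_preimage (_ : _ \o _ = id); last first.
  by apply/funext => p /=; rewrite rV_consK.
by rewrite preimage_id product_measure1E// lte_mul_pinfty// ge0_fin_numE.
Qed.

HB.instance Definition _ := Measure_isSigmaFinite.Build _ _ _ lebesgue_cons
  lebesgue_cons_sigma_finite.

End lebesgue_cons.

(* Lebesgue measure on R^n: the n-fold product of Lebesgue measure on R. *)
Fixpoint lebesgue_rV (R : realType) (n : nat) :
    {sigma_finite_measure set 'rV[R]_n -> \bar R} :=
  match n with
  | 0 => \d_(0 : 'rV[R]_0)
  | m.+1 => lebesgue_cons (lebesgue_rV R m)
  end.

Lemma lebesgue_rV_box (R : realType) (n : nat) (A : 'I_n -> set R) :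
  (forall i, measurable (A i)) ->
  lebesgue_rV R n [set x | forall i, A i (x 0 i)] =
  (\prod_(i < n) lebesgue_measure (A i))%E.
Proof.
elim: n A => [|n IH] A mA.
  rewrite big_ord0 /= diracE mem_set// => -[].
  by [].
have mB : measurable [set x : 'rV[R]_n | forall i, A (lift ord0 i) (x 0 i)].
  rewrite (_ : mkset _ =
    \bigcap_(i in [set: 'I_n]) (@rV_coord R n i @^-1` (A (lift ord0 i)))).
    apply: fin_bigcap_measurable => // i _.
    by rewrite -[X in measurable X]setTI; exact: measurable_rV_coord.
  by apply/seteqP; split => [x Ax i _|x Ax i]; [exact: Ax|exact: (Ax i)].
rewrite big_ord_recl -IH; last by move=> i; exact: mA.
rewrite -product_measure1E//; last exact: (mA ord0).
rewrite /= /lebesgue_cons /pushforward; congr product_measure1.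
apply/seteqP; split => [p /= Ap|p /= [A0 AS] i].
  split; first by rewrite -(rV_cons0 p); exact: Ap.
  by move=> i; rewrite -(rV_consS p); exact: Ap.
by have [j ->|->] := unliftP 0 i; rewrite ?rV_consS ?rV_cons0; [exact: AS|].
Qed.

Section fokker_planck.
Context (R : realType) (n : nat).
Implicit Types (Q B S A : 'M[R]_n) (x : 'rV[R]_n) (f g : 'rV[R]_n -> R[i]).
Implicit Types (w : 'rV[R]_n -> R) (phi : 'rV[R]_n -> R).

Definition psdmx S : Prop :=
  S^T = S /\ forall x, 0 <= (x *m S *m x^T) 0 0.

(* S = Q^(1/2): such an S exists and is unique when Q is symmetric positive
   semi-definite. *)
Definition is_sqrtmx S Q : Prop := psdmx S /\ S *m S = Q.

Definition kalman_mx S B : 'M[R]_(n, \sum_(k < n) n) :=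
  \mxrow_(k < n) (B ^+ k *m S).

Definition spectrum A : set R[i] :=
  [set z | eigenvalue (map_mx (real_complex R) A) z].

Definition expmx A : 'M[R]_n :=
  lim (series (fun k => (k`!%:R)^-1 *: A ^+ k) @ \oo).

Definition Qinf Q B : 'M[R]_n :=
  \matrix_(i, j) \int[@lebesgue_measure R]_(s in `[0, +oo[)
    (expmx (s *: B) *m Q *m expmx (s *: B^T)) i j.

Definition rho Q B x : R :=
  ((2 * pi) `^ (n%:R / 2) * Num.sqrt (\det (Qinf Q B)))^-1 *
  expR (- 2^-1 * (x *m invmx (Qinf Q B) *m x^T) 0 0).

Definition cint f : R[i] :=
  Complex (\int[lebesgue_rV R n]_x complex.Re (f x))
          (\int[lebesgue_rV R n]_x complex.Im (f x)).

Definition cmeasurable f : Prop :=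
  measurable_fun setT (fun x => complex.Re (f x)) /\
  measurable_fun setT (fun x => complex.Im (f x)).

Definition ae_eqC f g : Prop := {ae lebesgue_rV R n, forall x, f x = g x}.

(* int |f|^2 / w dx, the squared norm of L^2_{1/w}. *)
Definition sqnormL2 w f : \bar R :=
  (\int[lebesgue_rV R n]_x ((Normc.normc (f x)) ^+ 2 / w x)%:E)%E.

(* Elements of L^2_{1/w} are handled through Borel representatives. *)
Definition inL2 w f : Prop := cmeasurable f /\ (sqnormL2 w f < +oo)%E.

Definition entropy2 w f : \bar R :=
  (\int[lebesgue_rV R n]_x
     ((Normc.normc (f x / (w x)%:C%C - 1)) ^+ 2 * w x)%:E)%E.

Definition partial (i : 'I_n) phi : 'rV[R]_n -> R :=
  fun x => 'D_(delta_mx 0 i) phi x.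

Definition test_function phi : Prop :=
  (forall (s : seq 'I_n) x, differentiable (foldr partial phi s) x) /\
  compact (closure [set x | phi x != 0]).

(* The formal transpose of the Fokker-Planck operator
     P = 1/2 Tr(Q D^2) - <Bx, D> - Tr(B),
   each term b_ij x_j d_i being transposed into phi |-> - d_i (b_ij x_j phi). *)
Definition FP_transpose Q B phi : 'rV[R]_n -> R := fun x =>
  2^-1 * (\sum_i \sum_j Q i j * partial i (partial j phi) x)
  + \sum_i \sum_j B i j * partial i (fun y => y 0 j * phi y) x
  - \tr B * phi x.

(* P f = g in D'(R^n); by linearity, testing on real-valued functions suffices. *)
Definition FP_weak Q B f g : Prop :=
  forall phi, test_function phi ->
    cint (fun x => f x * (FP_transpose Q B phi x)%:C%C) =
    cint (fun x => g x * (phi x)%:C%C).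

(* The graph of P with domain {f in L^2_{1/rho} : P f in L^2_{1/rho}}. *)
Definition FP_graph Q B f g : Prop :=
  [/\ inL2 (rho Q B) f, inL2 (rho Q B) g & FP_weak Q B f g].

(* Strongly continuous one-parameter semigroups of bounded linear operators on
   L^2_{1/w}, acting on representatives; only T t with t >= 0 matters. *)
Record C0_semigroup w (T : R -> ('rV[R]_n -> R[i]) -> ('rV[R]_n -> R[i])) :
    Prop := {
  C0_stable : forall t f, 0 <= t -> inL2 w f -> inL2 w (T t f) ;
  C0_ae : forall t f g, 0 <= t -> inL2 w f -> inL2 w g ->
    ae_eqC f g -> ae_eqC (T t f) (T t g) ;
  C0_linear : forall t (a : R[i]) f g, 0 <= t -> inL2 w f -> inL2 w g ->
    ae_eqC (T t (fun x => a * f x + g x)) (fun x => a * T t f x + T t g x) ;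
  C0_bounded : forall t, 0 <= t -> exists M : R, forall f, inL2 w f ->
    (sqnormL2 w (T t f) <= M%:E * sqnormL2 w f)%E ;
  C0_0 : forall f, inL2 w f -> ae_eqC (T 0 f) f ;
  C0_D : forall s t f, 0 <= s -> 0 <= t -> inL2 w f ->
    ae_eqC (T (s + t) f) (T s (T t f)) ;
  C0_cvg : forall f, inL2 w f ->
    sqnormL2 w (fun x => T t f x - f x) @[t --> (0 : R)^'+] --> 0%E
}.

Definition generator_graph w
    (T : R -> ('rV[R]_n -> R[i]) -> ('rV[R]_n -> R[i])) f g : Prop :=
  [/\ inL2 w f, inL2 w g &
    sqnormL2 w (fun x => (h^-1)%:C%C * (T h f x - f x) - g x)
      @[h --> (0 : R)^'+] --> 0%E].

(* T t = e^{tP}, up to a.e. equality: a C0 semigroup is determined by its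
   generator. *)
Definition is_FP_semigroup Q B
    (T : R -> ('rV[R]_n -> R[i]) -> ('rV[R]_n -> R[i])) : Prop :=
  C0_semigroup (rho Q B) T /\
  forall f g, generator_graph (rho Q B) T f g <-> FP_graph Q B f g.

End fokker_planck.

(* Main.v *)
(* For b in R^n let q(b) = <Q_oo b, b> and phi_b = e^{q(b)/2} rho(x) e^{i <b, x>}.
   These waves lie in the domain of P, and the Lyapunov equation
   B Q_oo + Q_oo B^T = -Q shows that t |-> phi_{b(t)}, b(t) = Q_oo^{-1} e^{tB} Q_oo b,
   is differentiable in L^2_{1/rho} with derivative P phi_{b(t)}; uniqueness for the
   Cauchy problem gives e^{tP} phi_b = phi_{b(t)}.  Moreover phi_0 = rho, the integral
   of phi_b is 1, and <phi_b, phi_c> = e^{<Q_oo b, c>}.  For f = sum_j c_j phi_{b_j},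
   with G and G_t the Gram matrices of the b_j and of the b_j(t) for Q_oo,
     |e^{tP} f - (int f) rho|^2 = sum_jk c_j conj(c_k) (e^{G_t} - 1)_jk
   (entrywise exponentials).  As 0 <= G_t <= G and G_t <= C e^{-2 tau t} G, the Schur
   product theorem bounds this by C e^{-2 tau t} sum_jk c_j conj(c_k) (e^G - 1)_jk
   <= C e^{-2 tau t} |f|^2.  The span of the phi_b is dense in L^2_{1/rho}. *)

Require Import Defs.
From HB Require Import structures.
From mathcomp Require Import all_boot all_order all_algebra complex.
From mathcomp Require Import all_classical all_reals all_analysis.
From mathcomp Require Import measurable_realfun ring lra.

Set Implicit Arguments.
Unset Strict Implicit.
Unset Printing Implicit Defensive.
Import Order.TTheory GRing.Theory Num.Theory.
Import numFieldNormedType.Exports.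
Local Open Scope classical_set_scope.
Local Open Scope ring_scope.

(** * Semigroups on a seminormed space *)

(** [C0_semigroup] bounds each [T t] separately, and [T] is known only through its generator.
    Uniqueness for the Cauchy problem needs a bound uniform on compact time intervals, and
    completeness of the weighted L2 space is proved for that purpose. Functions are representatives,
    so the abstract argument runs on a seminorm, and equality means seminorm 0 of the difference.

    In the expansion of e^G - 1 the entrywise power p+1 of G_t is compared with that of G by
    spending C e^{-2 tau t} on one factor and G_t <= G on the p others, so C is never raised to a
    power. The second inequality is dissipation along the flow; the first is decay of e^{tB}, where
    tau < tau0 leaves room for the polynomial factors of Jordan blocks, and the exponent doubles
    since Gram matrices are quadratic in b.

    Density uses no Fourier inversion: a product of two waves divided by rho is a multiple of a
    wave, so the bounded measurable G with rho G in the closed span form an algebra, which is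
    carried from cosines to rays, Borel sets and simple functions. *)

Lemma right_dini_le (R : realType) (F : R -> R) (t : R) : 0 <= t ->
  (forall s e : R, 0 < s <= t -> 0 < e -> exists2 d : R, 0 < d &
     forall h : R, 0 < h < d -> h <= s -> F s <= F (s - h) + e) ->
  (forall s e : R, 0 <= s < t -> 0 < e -> exists2 d : R, 0 < d &
     forall h : R, 0 < h < d -> s + h <= t -> F (s + h) <= F s + e * h) ->
  F t <= F 0.
Proof.
move=> t0 Fl Fr.
suff Ht (e : R) : 0 < e -> F t <= F 0 + e * t.
  apply/ler_addgt0Pr => e e0.
  have te0 : 0 < e / (t + 1) by rewrite divr_gt0// ltr_wpDl.
  apply: (le_trans (Ht _ te0)); rewrite lerD2l mulrAC.
  by rewrite ler_pdivrMr ?ltr_wpDl// ler_pM2l// lerDl.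
move=> e0.
(* Continuation argument on the times up to which the bound with slack [e * r] holds. The left
   hypothesis puts the supremum into [S]; the right one then moves past it unless it is [t]. *)
pose S : set R := [set s | 0 <= s <= t /\ forall r, 0 <= r <= s -> F r <= F 0 + e * r].
have S0 : S 0.
  split; first by rewrite lexx.
  move=> r /andP[r0 r1]; have -> : r = 0 by apply/eqP; rewrite eq_le r0 r1.
  by rewrite mulr0 addr0.
have Sub : ubound S t by move=> s [/andP[_]].
have hS : has_sup S by split; [exists 0|exists t].
pose c := sup S.
have c0 : 0 <= c by apply: ub_le_sup; [exact: hS.2|exact: S0].
have ct : c <= t by apply: ge_sup => //; exists 0.
have good_lt r : 0 <= r < c -> F r <= F 0 + e * r.
  move=> /andP[r0 rc].
  have [s [sS /ltW rs]] : exists s, S s /\ r < s.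
    by have [s Ss rs] := sup_gt hS.1 rc; exists s.
  by apply: sS.2; rewrite r0.
have good_c : F c <= F 0 + e * c.
  have [->|cn0] := eqVneq c 0; first by rewrite mulr0 addr0.
  have cgt0 : 0 < c by rewrite lt_neqAle eq_sym cn0.
  apply/ler_addgt0Pr => k k0.
  have [|d d0 Hd] := Fl c k _ k0; first by rewrite cgt0.
  pose h := Num.min (d / 2) c.
  have h0 : 0 < h by rewrite lt_min divr_gt0.
  have hd : h < d by rewrite gt_min ltr_pdivrMr// mulr_natr mulr2n ltrDl d0.
  have hc : h <= c by rewrite ge_min lexx orbT.
  apply: le_trans (Hd h _ hc) _; first by rewrite h0.
  rewrite lerD2r; apply: le_trans (good_lt (c - h) _) _.
    by rewrite subr_ge0 hc ltrBlDr ltrDl.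
  by rewrite lerD2l ler_pM2l// lerBlDr lerDl ltW.
have Sc : S c.
  split; first by rewrite c0.
  move=> r /andP[r0]; rewrite le_eqVlt => /predU1P[->//|rc].
  by apply: good_lt; rewrite r0.
have [ctE|ctn] := eqVneq c t; first by rewrite -ctE.
have clt : c < t by rewrite lt_neqAle ctn.
have [|d d0 Hd] := Fr c e _ e0; first by rewrite c0.
pose h := Num.min (d / 2) (t - c).
have h0 : 0 < h by rewrite lt_min divr_gt0//= subr_gt0.
have hd : h < d by rewrite gt_min ltr_pdivrMr// mulr_natr mulr2n ltrDl d0.
have hc : h <= t - c by rewrite ge_min lexx orbT.
have : S (c + h).
  split; first by rewrite addr_ge0 ?(ltW h0)//= addrC -lerBrDr.
  move=> r /andP[r0 rch]; have [rc|cr] := leP r c.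
    by apply: Sc.2; rewrite r0.
  have k0 : 0 < r - c by rewrite subr_gt0.
  rewrite -(subrK c r) addrC; apply: le_trans (Hd (r - c) _ _) _.
  - by rewrite k0 /=; apply: le_lt_trans hd; rewrite lerBlDl.
  - by rewrite addrC subrK (le_trans rch)// -lerBrDl.
  - by rewrite [in leRHS]mulrDr addrA lerD2r.
move=> /(ub_le_sup hS.2); rewrite -/c => /(lt_le_trans _).
by move=> /(_ c); rewrite ltrDl h0 ltxx => /(_ isT).
Qed.

Section seminormed_semigroup.
Context (R : realType) (V : lmodType R[i]) (P : set V) (N : V -> R).
Hypothesis PD : forall f g, P f -> P g -> P (f + g).
Hypothesis PZ : forall a f, P f -> P (a *: f).
Hypothesis Pn0 : exists f, P f.
Hypothesis N_ge0 : forall f, 0 <= N f.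
Hypothesis ND : forall f g, P f -> P g -> N (f + g) <= N f + N g.
Hypothesis NZ : forall a f, P f -> N (a *: f) = Normc.normc a * N f.
(** Completeness is only asked for series of geometric rate 1/3, which is what the gliding hump
    uses; [3 / 2 * 3^-1 ^+ n] is the sum of the geometric tail from [n]. *)
Hypothesis N_complete : forall f : nat -> V, (forall k, P (f k)) ->
  (forall k, N (f k) <= 3^-1 ^+ k) ->
  exists2 g, P g & forall n, N (g - \sum_(k < n) f k) <= 3 / 2 * 3^-1 ^+ n.

Lemma snP0 : P 0.
Proof. by have [f Pf] := Pn0; rewrite -(scale0r f); exact: PZ. Qed.

Lemma snPB f g : P f -> P g -> P (f - g).
Proof. by move=> Pf Pg; rewrite -scaleN1r; apply: PD => //; exact: PZ. Qed.

Lemma snN f : P f -> N (- f) = N f.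
Proof.
move=> Pf; rewrite -scaleN1r NZ//.
by rewrite /Normc.normc /= oppr0 expr0n /= addr0 sqrrN expr1n sqrtr1 mul1r.
Qed.

Lemma sn0 : N 0 = 0.
Proof.
rewrite -(scale0r 0) NZ; last exact: snP0.
by rewrite /Normc.normc /= expr0n /= addr0 sqrtr0 mul0r.
Qed.

Lemma snC f g : P f -> P g -> N (f - g) = N (g - f).
Proof. by move=> Pf Pg; rewrite -opprB snN//; exact: snPB. Qed.

Lemma snB_le f g h : P f -> P g -> P h -> N (f - h) <= N (f - g) + N (g - h).
Proof.
move=> Pf Pg Ph; have -> : f - h = (f - g) + (g - h) by rewrite addrA subrK.
by apply: ND; exact: snPB.
Qed.

Lemma sn_le f g : P f -> P g -> N f <= N g + N (f - g).
Proof.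
move=> Pf Pg; rewrite -{1}(subrK g f) addrC.
by rewrite addrC [leRHS]addrC; apply: ND => //; exact: snPB.
Qed.

Lemma sn_eq f g : P f -> P g -> N (f - g) = 0 -> N f = N g.
Proof.
move=> Pf Pg fg0; apply/eqP; rewrite eq_le.
have := sn_le Pf Pg; rewrite fg0 addr0 => ->.
by have := sn_le Pg Pf; rewrite snC// fg0 addr0 => ->.
Qed.

Lemma snZR (r : R) f : P f -> N (r%:C%C *: f) = `|r| * N f.
Proof.
move=> Pf; rewrite NZ//; congr (_ * _).
by rewrite /Normc.normc /= expr0n addr0 sqrtr_sqr.
Qed.

Context (T : R -> V -> V).
Hypothesis T_stable : forall t f, 0 <= t -> P f -> P (T t f).
Hypothesis T_lin : forall t a f g, 0 <= t -> P f -> P g ->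
  N (T t (a *: f + g) - (a *: T t f + T t g)) = 0.
Hypothesis T_bounded : forall t, 0 <= t ->
  exists M, forall f, P f -> N (T t f) <= M * N f.
Hypothesis T_0 : forall f, P f -> N (T 0 f - f) = 0.
Hypothesis T_D : forall s t f, 0 <= s -> 0 <= t -> P f ->
  N (T (s + t) f - T s (T t f)) = 0.
Hypothesis T_cvg : forall f, P f -> forall e : R, 0 < e ->
  exists2 d : R, 0 < d & forall h, 0 < h < d -> N (T h f - f) <= e.

Lemma sgZD t a f g : 0 <= t -> P f -> P g ->
  N (T t (a *: f + g)) = N (a *: T t f + T t g).
Proof.
move=> t0 Pf Pg; apply: sn_eq; last exact: T_lin.
  by apply/T_stable/PD => //; exact: PZ.
by apply: PD; [apply: PZ|]; exact: T_stable.
Qed.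

Lemma sgB t f g : 0 <= t -> P f -> P g -> N (T t f - T t g) = N (T t (f - g)).
Proof.
move=> t0 Pf Pg; have -> : f - g = -1 *: g + f by rewrite scaleN1r addrC.
by rewrite sgZD// scaleN1r addrC.
Qed.

Lemma sgZ t a f : 0 <= t -> P f -> N (T t (a *: f)) = Normc.normc a * N (T t f).
Proof.
move=> t0 Pf; have P0 := snP0.
have T00 : N (T t 0) = 0.
  have [M HM] := T_bounded t0.
  by apply/eqP; rewrite eq_le N_ge0 andbT (le_trans (HM _ P0))// sn0 mulr0.
rewrite -[a *: f]addr0 sgZD// -NZ; last exact: T_stable.
apply: sn_eq; first by apply: PD; [apply: PZ|]; exact: T_stable.
  by apply: PZ; exact: T_stable.
by rewrite addrAC subrr add0r.
Qed.

(* Gliding hump (Sokal's proof of the uniform boundedness principle), so that no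
   Baire argument is needed. *)
Lemma sg_bounded0 : exists2 d : R, 0 < d & exists M : R,
  forall s f, 0 <= s < d -> P f -> N (T s f) <= M * N f.
Proof.
apply: contrapT => Hn.
(* Without a bound near 0 there are times below [1 / (k + 1)] at which the operator norm exceeds
   [4 ^+ k]. The triple records such a time, a bound for the norm there, and a vector of the unit
   ball that attains more than three quarters of it. *)
have key k : exists z : R * R * V, [/\ 0 < z.1.1 < k.+1%:R^-1, 4 ^+ k < z.1.2,
    (forall f, P f -> N (T z.1.1 f) <= z.1.2 * N f), P z.2 /\ N z.2 <= 1 &
    3 / 4 * z.1.2 < N (T z.1.1 z.2)].
  have [s [f [sd Pf Tf]]] : exists s f, [/\ 0 <= s < k.+1%:R^-1, P f &
      4 ^+ k * N f < N (T s f)].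
    apply: contrapT => H; apply: Hn; exists k.+1%:R^-1; first by rewrite invr_gt0.
    exists (4 ^+ k) => s f sd Pf; rewrite leNgt; apply/negP => Tf.
    by apply: H; exists s, f.
  have /andP[s0 sk] := sd.
  have k1 : 1 <= 4 ^+ k :> R by rewrite exprn_ege1// ler1n.
  have [M0 HM0] := T_bounded s0.
  have Nf : 0 < N f.
    rewrite lt_neqAle N_ge0 andbT eq_sym; apply/eqP => f0.
    by have := HM0 _ Pf; rewrite leNgt f0 mulr0; move: Tf; rewrite f0 mulr0 => ->.
  have sgt0 : 0 < s.
    rewrite lt_neqAle s0 andbT; apply/eqP => s00.
    have E : N (T s f) = N f.
      by apply: sn_eq => //; [exact: T_stable|rewrite -s00; exact: T_0].
    by move: Tf; rewrite E ltNge ler_peMl ?N_ge0.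
  (* The supremum of [A] is the operator norm of [T s], finite by [T_bounded]. *)
  pose A := [set x | exists2 g, P g /\ N g <= 1 & x = N (T s g)].
  have A0 : A 0.
    exists 0; first by split; [exact: snP0|rewrite sn0].
    apply/esym/eqP; rewrite eq_le N_ge0 andbT (le_trans (HM0 _ snP0))// sn0.
    by rewrite mulr0.
  have Aub : ubound A `|M0|.
    move=> _ [g [Pg Ng] ->]; apply: le_trans (HM0 _ Pg) _.
    apply: (@le_trans _ _ (`|M0| * N g)); first by rewrite ler_wpM2r// ler_norm.
    by rewrite ler_piMr.
  have hA : has_sup A by split; [exists 0|exists `|M0|].
  pose B := sup A.
  have BT g : P g -> N (T s g) <= B * N g.
    move=> Pg; have [g0|gn0] := eqVneq (N g) 0.
      by rewrite g0 mulr0 (le_trans (HM0 _ Pg))// g0 mulr0.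
    have gg : 0 < N g by rewrite lt_neqAle eq_sym gn0 N_ge0.
    have : A (N (T s g) / N g).
      exists ((N g)^-1%:C%C *: g).
        split; first exact: PZ.
        by rewrite snZR// ger0_norm ?invr_ge0// mulVf.
      rewrite sgZ// mulrC; congr (_ * _).
      rewrite /Normc.normc /= expr0n addr0 sqrtr_sqr ger0_norm//.
      by rewrite invr_ge0.
    by move=> /(ub_le_sup hA.2); rewrite ler_pdivrMr.
  have kB : 4 ^+ k < B.
    by rewrite -(ltr_pM2r Nf); exact: lt_le_trans Tf (BT _ Pf).
  have B0 : 0 < B by apply: lt_trans kB; exact: lt_le_trans k1.
  have [_ [g [Pg Ng] ->] Hg] : exists2 x, A x & 3 / 4 * B < x.
    have B34 : 3 / 4 * B < B by lra.
    exact: sup_gt hA.1 B34.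
  by exists ((s, B), g); split => //=; rewrite sgt0.
have [z Hz] := choice key.
(* The sign of the k-th hump is chosen so that, after it is added to [g], the image at the k-th time
   is at least as large as that of the hump alone. One of the two signs works, since twice the hump
   is the difference of the two candidates. *)
pose st k g := if `[< 3^-1 ^+ k * N (T (z k).1.1 (z k).2) <=
     N (T (z k).1.1 (g + (3^-1 ^+ k)%:C%C *: (z k).2)) >]
  then (3^-1 ^+ k)%:C%C *: (z k).2 else - ((3^-1 ^+ k)%:C%C *: (z k).2).
pose G := fix G k := if k is k'.+1 then G k' + st k' (G k') else 0.
have c0 k : 0 <= 3^-1 ^+ k :> R by rewrite exprn_ge0// invr_ge0.
have Pz k : P (z k).2 by have [_ _ _ []] := Hz k.
have Pcz k : P ((3^-1 ^+ k)%:C%C *: (z k).2) by exact: PZ.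
have Pst k g : P (st k g).
  by rewrite /st; case: ifP => // _; rewrite -scaleN1r; exact: PZ.
have Nst k g : N (st k g) <= 3^-1 ^+ k.
  have : N ((3^-1 ^+ k)%:C%C *: (z k).2) <= 3^-1 ^+ k.
    have [_ _ _ [_ Nz] _] := Hz k.
    by rewrite snZR// ger0_norm// ler_piMr.
  by rewrite /st; case: ifP => // _; rewrite snN.
have PG k : P (G k) by elim: k => [|k IH] /=; [exact: snP0|exact: PD].
have GE n : \sum_(k < n) st k (G k) = G n.
  by elim: n => [|n IH]; rewrite ?big_ord0// big_ord_recr /= IH.
have [g Pg Hg] := @N_complete (fun k => st k (G k)) (fun k => Pst k _)
  (fun k => Nst k _).
have TG k : 3^-1 ^+ k * N (T (z k).1.1 (z k).2) <= N (T (z k).1.1 (G k.+1)).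
  have [/andP[/ltW z0 _] _ _ _ _] := Hz k.
  rewrite /= /st; case: asboolP => // /negP; rewrite -ltNge.
  set c := 3^-1 ^+ k; set x := c%:C%C *: _; set s := (z k).1.1 => Hlt.
  have Px : P x by exact: Pcz.
  have : N (T s (2%:C%C *: x)) <= N (T s (G k + x)) + N (T s (G k - x)).
    have -> : 2%:C%C *: x = (G k + x) - (G k - x).
      rewrite opprB addrA addrAC -[G k + x]addrC addrK -mulr2n.
      by rewrite -[RHS]scaler_nat; congr (_ *: _); exact: (rmorph_nat (real_complex R) 2).
    have Pa : P (G k + x) by exact: PD.
    have Pb : P (G k - x) by exact: snPB.
    rewrite -sgB//.
    rewrite -[X in _ <= _ + X]snN; last exact: T_stable.
    apply: ND; first exact: T_stable.
    by rewrite -scaleN1r; apply/PZ; exact: T_stable.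
  rewrite !sgZ//.
  rewrite /Normc.normc /= !expr0n !addr0 !sqrtr_sqr !ger0_norm//; last exact: c0.
  by move: Hlt; rewrite -/c -/s; lra.
(* At the k-th time the partial sum including the hump contributes at least [3^-k * (3/4) B], and
   the tail at most [B * (3/2) 3^-(k+1) = B 3^-k / 2]. This leaves [3^-k B / 4], with
   [B > 4 ^+ k]. *)
have lb k : 1 / 4 * (4 / 3) ^+ k <= N (T (z k).1.1 g).
  have [/andP[/ltW z0 _] zk zB _ zT] := Hz k.
  have := Hg k.+1; rewrite GE => Hk.
  have := sgB z0 (PG k.+1) Pg; have := TG k; have := zB _ (snPB Pg (PG k.+1)).
  have := sn_le (T_stable z0 (PG k.+1)) (T_stable z0 Pg).
  rewrite -sgB// snC; [|exact: T_stable..].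
  move: Hk; rewrite exprS expr_div_n exprVn; set B := (z k).1.2 in zk zB zT *.
  set X := N (T _ g); set Y := N (T _ (z k).2) in zT *; set Z := N (T _ (G _)).
  set U := N (g - _); set W := N (T _ g - _); move=> Hk.
  move=> H1 H2 H3 _.
  have t0 : 0 < 3 ^+ k :> R by rewrite exprn_gt0.
  have p0 : 0 < (3 ^+ k)^-1 :> R by rewrite invr_gt0.
  have B0 : 0 < B by apply: lt_trans zk; rewrite exprn_gt0.
  have h1 : B * U <= B * (2^-1 * (3 ^+ k)^-1).
    by rewrite ler_wpM2l ?(ltW B0)//; lra.
  have h2 : (3 ^+ k)^-1 * (3 / 4 * B) < (3 ^+ k)^-1 * Y by rewrite ltr_pM2l.
  have h3 : (3 ^+ k)^-1 * 4 ^+ k < (3 ^+ k)^-1 * B by rewrite ltr_pM2l.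
  lra.
(* Strong continuity at 0 keeps [T s g] within 1 of [g] for small [s], whereas [lb] grows without
   bound along times tending to 0. *)
have [d d0 Hd] := T_cvg Pg ltr01.
have [k kd] : exists k, k.+1%:R^-1 < d.
  by have [k _ Hk] := near_infty_natSinv_lt (PosNum d0); exists k; apply: Hk => /=.
have b43 : 1 < 4 / 3 :> R by lra.
pose K := N g + 1.
have [m Hm] : exists m, 4 * K < (4 / 3) ^+ m.
  have bern m : 1 + m%:R / 3 <= (4 / 3) ^+ m :> R.
    elim: m => [|m IH]; first by rewrite mul0r addr0.
    have m0 : 0 <= m%:R :> R by [].
    by rewrite exprS -natr1; nra.
  exists (Num.truncn (12 * K)).+1; apply: lt_le_trans (bern _).
  by have := truncnS_gt (12 * K); lra.
pose p := maxn k m.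
have [/andP[z0 zp] _ _ _ _] := Hz p.
have : N (T (z p).1.1 g) <= K.
  apply: le_trans (sn_le (T_stable (ltW z0) Pg) Pg) _.
  rewrite lerD2l; apply: Hd; rewrite z0 (lt_trans zp)//.
  apply: le_lt_trans kd; rewrite lef_pV2 ?posrE// ler_nat ltnS.
  exact: leq_maxl.
have : (4 / 3) ^+ m <= (4 / 3) ^+ p :> R.
  by apply: ler_weXn2l; [exact: ltW|exact: leq_maxr].
by have := lb p; lra.
Qed.

(** Iterating the semigroup law in steps of [d / 2] costs one factor [M] per step. Half of [d] is
    used because the bound near 0 holds strictly below [d], and [M >= 1] makes the powers
    monotone. *)
Lemma sg_bounded t : 0 <= t -> exists M : R, 0 <= M /\
  forall s f, 0 <= s <= t -> P f -> N (T s f) <= M * N f.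
Proof.
move=> t0; have [d d0 [M0 HM0]] := sg_bounded0.
pose M := Num.max 1 M0.
have M1 : 1 <= M by rewrite le_max lexx.
have HM s f : 0 <= s < d -> P f -> N (T s f) <= M * N f.
  move=> sd Pf; apply: le_trans (HM0 _ _ sd Pf) _.
  by rewrite ler_wpM2r// le_max lexx orbT.
have step n : forall s f, 0 <= s < n.+1%:R * (d / 2) -> P f ->
    N (T s f) <= M ^+ n.+1 * N f.
  elim: n => [|n IH] s f /andP[s0 sn] Pf.
    rewrite expr1; apply: HM => //; rewrite s0 (lt_le_trans sn)// mul1r.
    by rewrite ler_pdivrMr// ler_peMr ?ler1n// ltW.
  have [sd|ds] := ltP s (d / 2).
    apply: le_trans (IH s f _ Pf) _.
      rewrite s0 (lt_le_trans sd)// ler_peMl ?ler1n//.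
      by rewrite divr_ge0// ltW.
    by rewrite ler_wpM2r// ler_weXn2l.
  have d20 : 0 <= d / 2 by rewrite divr_ge0// ltW.
  have sd0 : 0 <= s - d / 2 by rewrite subr_ge0.
  have E := T_D d20 sd0 Pf.
  rewrite [X in T X f]addrC subrK in E.
  rewrite (sn_eq _ _ E); [|exact: T_stable|by do 2 apply: T_stable => //].
  apply: le_trans (HM _ _ _ _) _.
  - by rewrite d20 ltr_pdivrMr// ltr_pMr// ltr1n.
  - exact: T_stable.
  rewrite [in leRHS]exprS -mulrA ler_pM2l; last exact: lt_le_trans M1.
  apply: IH => //; rewrite sd0 ltrBlDr; apply: lt_le_trans sn _.
  by rewrite [in leLHS]mulrSr mulrDl mul1r.
have [n tn] : exists n, t < n.+1%:R * (d / 2).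
  exists (Num.truncn (t / (d / 2))).
  rewrite -ltr_pdivrMr ?divr_gt0//.
  by have := truncnS_gt (t / (d / 2)).
exists (M ^+ n.+1); split; first by rewrite exprn_ge0// (le_trans ler01).
move=> s f /andP[s0 st] Pf; apply: step => //.
by rewrite s0 (le_lt_trans st).
Qed.

(** By the semigroup law the difference is [T a (f - T h g)] up to a null element, so comparing at
    two times reduces to comparing over the short time [h]. *)
Lemma sg_lip t M : (forall s f, 0 <= s <= t -> P f -> N (T s f) <= M * N f) ->
  forall a h f g, 0 <= a -> 0 <= h -> a + h <= t -> P f -> P g ->
  N (T a f - T (a + h) g) <= M * N (f - T h g).
Proof.
move=> HM a h f g a0 h0 aht Pf Pg.
have ah0 : 0 <= a + h by rewrite addr_ge0.
have at_ : a <= t by apply: le_trans aht; rewrite lerDl.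
have P1 := T_stable a0 Pf; have P2 := T_stable ah0 Pg.
have P3 := T_stable h0 Pg; have P4 := T_stable a0 P3.
apply: le_trans (snB_le P1 P4 P2) _.
rewrite [X in _ + X]snC// T_D// addr0 sgB//.
by apply: HM; [rewrite a0|exact: snPB].
Qed.

(* The Dini derivative of s |-> N (T (t - s) (u s) - T t (u 0)) vanishes. *)
Lemma sg_cauchy_unique (u v : R -> V) t : 0 <= t ->
  (forall s, 0 <= s -> P (u s)) -> (forall s, 0 <= s -> P (v s)) ->
  (forall s e : R, 0 <= s -> 0 < e -> exists2 d : R, 0 < d &
    forall h : R, 0 < h < d -> N (u (s + h) - u s - h%:C%C *: v s) <= e * h) ->
  (forall s e : R, 0 <= s -> 0 < e -> exists2 d : R, 0 < d &
    forall h : R, 0 < h < d -> N (T h (u s) - u s - h%:C%C *: v s) <= e * h) ->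
  (forall s e : R, 0 < s -> 0 < e -> exists2 d : R, 0 < d &
    forall h : R, 0 < h < d -> h <= s -> N (u (s - h) - u s) <= e) ->
  N (T t (u 0) - u t) = 0.
Proof.
move=> t0 Pu Pv du dT lu.
have [M [M0 HM]] := sg_bounded t0.
pose F s := N (T (t - s) (u s) - T t (u 0)).
have Pu0 : P (u 0) by exact: Pu.
have PTu0 := T_stable t0 Pu0.
have Put := Pu _ t0.
have F0 : F 0 = 0 by rewrite /F subr0 subrr sn0.
have Ft : F t = N (T t (u 0) - u t).
  rewrite /F subrr snC//; last exact: T_stable.
  apply/eqP; rewrite eq_le; apply/andP; split.
    apply: le_trans (snB_le PTu0 Put (T_stable (lexx 0) Put)) _.
    by rewrite [X in _ + X]snC ?T_0 ?addr0//; exact: T_stable.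
  apply: le_trans (snB_le PTu0 (T_stable (lexx 0) Put) Put) _.
  by rewrite T_0// addr0.
suff : F t <= F 0.
  by rewrite F0 Ft => F00; apply/eqP; rewrite eq_le F00 N_ge0.
have M1 : 0 < M + 1 by rewrite ltr_wpDl.
apply: right_dini_le => // s e /andP[s0 st] e0.
(* Left condition: continuity is enough. One factor [M] is spent on [T (t - s)] and one on [T h],
   hence the square. *)
- pose e1 := e / (M + 1) ^+ 2.
  have e10 : 0 < e1 by rewrite divr_gt0// exprn_gt0.
  have [d1 d10 H1] := lu s e1 s0 e10.
  have [d2 d20 H2] := T_cvg (Pu _ (ltW s0)) e10.
  exists (Num.min d1 d2); first by rewrite lt_min d10.
  move=> h /andP[h0]; rewrite lt_min => /andP[hd1 hd2] hs.
  have P1 : P (u s) by exact/Pu/ltW.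
  have P2 : P (u (s - h)) by apply: Pu; rewrite subr_ge0.
  have h0' := ltW h0; have ts : 0 <= t - s by rewrite subr_ge0.
  have tsh : t - (s - h) = t - s + h by rewrite opprB addrA addrAC.
  have P3 := T_stable ts P1.
  have P4 : P (T (t - s + h) (u (s - h))) by apply: T_stable => //; exact: addr_ge0.
  have P5 := T_stable h0' P1; have P6 := T_stable h0' P2.
  rewrite /F tsh; apply: le_trans (snB_le P3 P4 PTu0) _; rewrite addrC lerD2l.
  apply: le_trans (sg_lip HM _ _ _ P1 P2) _ => //.
    by move: hs; lra.
  have h1 : N (u s - T h (u s)) <= e1.
    by rewrite snC//; apply: H2; rewrite h0.
  have h2 : N (T h (u s) - T h (u (s - h))) <= M * e1.
    rewrite sgB//; apply: le_trans (HM _ _ _ _) _.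
    - by rewrite h0' (le_trans hs).
    - exact: snPB.
    - by rewrite ler_wpM2l// snC// H1// h0.
  have h3 := snB_le P1 P5 P6.
  have E : e = e1 * (M + 1) ^+ 2 by rewrite /e1 divfK// gt_eqF// exprn_gt0.
  apply: (@le_trans _ _ (M * (e1 + M * e1))).
    by rewrite ler_wpM2l//; lra.
  rewrite E; have : 0 <= M * e1 by rewrite mulr_ge0// ltW.
  by have := ltW e10; nra.
(* Right condition: [u (s + h)] and [T h (u s)] share the first-order expansion [u s + h v s], so
   they differ by at most [2 e1 h], and [T (t - s - h)] multiplies this by at most [M]. *)
- pose e1 := e / (2 * (M + 1)).
  have e10 : 0 < e1 by rewrite divr_gt0// mulr_gt0.
  have [d1 d10 H1] := du s e1 s0 e10.
  have [d2 d20 H2] := dT s e1 s0 e10.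
  exists (Num.min d1 d2); first by rewrite lt_min d10.
  move=> h /andP[h0]; rewrite lt_min => /andP[hd1 hd2] hs.
  have h0' := ltW h0.
  have P1 : P (u s) by exact: Pu.
  have P2 : P (u (s + h)) by apply: Pu; rewrite addr_ge0.
  have P3 := T_stable h0' P1.
  have ts : 0 <= t - (s + h) by rewrite subr_ge0.
  have tsh : t - s = t - (s + h) + h by rewrite opprD addrA subrK.
  have P4 := T_stable ts P2.
  have P5 : P (T (t - (s + h) + h) (u s)).
    by apply: T_stable => //; rewrite addr_ge0.
  rewrite /F tsh; apply: le_trans (snB_le P4 P5 PTu0) _; rewrite addrC lerD2l.
  apply: le_trans (sg_lip HM _ _ _ P2 P1) _ => //.
    by rewrite -tsh lerBlDr lerDl.
  set w := u s + h%:C%C *: v s.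
  have Pw : P w by apply: PD => //; exact/PZ/Pv.
  have h1 : N (u (s + h) - w) <= e1 * h.
    by rewrite /w opprD addrA; apply: H1; rewrite h0.
  have h2 : N (w - T h (u s)) <= e1 * h.
    by rewrite snC// /w opprD addrA; apply: H2; rewrite h0.
  have h3 := snB_le P2 Pw P3.
  have E : e = e1 * (2 * (M + 1)) by rewrite /e1 divfK// gt_eqF// mulr_gt0.
  apply: (@le_trans _ _ (M * (2 * (e1 * h)))).
    by rewrite ler_wpM2l//; lra.
  rewrite E; have : 0 <= e1 * h by rewrite mulr_ge0// ltW.
  by nra.
Qed.

End seminormed_semigroup.

(** * Matrix exponential *)

Lemma is_derive_sum_fun (R : realType) n (f : 'I_n -> R -> R) (df : 'I_n -> R) (x : R) :
  (forall i, is_derive x 1 (f i) (df i)) ->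
  is_derive x 1 (fun t => \sum_i f i t) (\sum_i df i).
Proof.
move=> H; rewrite (_ : (fun _ => _) = \sum_i f i); last first.
  by apply/funext => t; rewrite fct_sumE.
exact: is_derive_sum.
Qed.

Lemma is_derive_mulr_cst (R : realType) (f : R -> R) (df a x : R) :
  is_derive x 1 f df -> is_derive x 1 (fun t => a * f t) (a * df).
Proof. by move=> H; exact: (is_deriveZ a H). Qed.

Lemma cvg_sum_fun (R : realType) n (f : 'I_n -> nat -> R) (l : 'I_n -> R) :
  (forall i, f i @ \oo --> l i) -> \sum_i f i k @[k --> \oo] --> \sum_i l i.
Proof.
elim: n f l => [|n IH] f l H.
  by under eq_fun do rewrite big_ord0; rewrite big_ord0; exact: cvg_cst.
under eq_fun do rewrite big_ord_recl; rewrite big_ord_recl.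
by apply: cvgD; [exact: H|apply: IH].
Qed.

Lemma cvg_mx_entries (R : realType) m n (f : nat -> 'M[R]_(m, n)) (M : 'M[R]_(m, n)) :
  (forall i j, f k i j @[k --> \oo] --> M i j) -> f @ \oo --> M.
Proof.
move=> H; apply/cvg_ballP => e e0.
have : \forall k \near \oo, forall i j, ball (M i j) e (f k i j).
  apply: filter_forall => i; apply: filter_forall => j.
  by move/cvg_ballP : (H i j); apply.
by apply: filterS => k Hk; split.
Qed.

Section matrix_exponential.
Context (R : realType) (n : nat).
Implicit Types (A B : 'M[R]_n).

Lemma mulmx_exprS B k : B ^+ k.+1 = B *m B ^+ k.
Proof. by rewrite exprS. Qed.

Lemma mulmx_exprSr B k : B ^+ k.+1 = B ^+ k *m B.
Proof. by rewrite exprSr. Qed.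

Lemma expr_entry_le B k i j : `|(B ^+ k) i j| <= (\sum_i \sum_j `|B i j|) ^+ k.
Proof.
elim: k i => [|k IH] i.
  rewrite expr0 mxE; case: eqP => _; rewrite ?mulr1n ?mulr0n ?normr1 ?normr0//.
rewrite mulmx_exprS mxE (le_trans (ler_norm_sum _ _ _))//.
rewrite exprS mulr_suml.
rewrite [leRHS](bigD1 i)//= -[leLHS]addr0 lerD//; last first.
  apply: sumr_ge0 => l _; apply: mulr_ge0; first exact: sumr_ge0.
  by apply: exprn_ge0; apply: sumr_ge0 => ? _; exact: sumr_ge0.
rewrite mulr_suml; apply: ler_sum => l _.
by rewrite normrM ler_wpM2l.
Qed.

(** The exponent [k.+2] leaves room for two differentiations of the exponential series, each of
    which raises the power of the matrix by one. *)
Lemma pseries_exp_bound (c : nat -> R) K (x : R) : 0 <= K ->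
  (forall k, `|c k| <= K ^+ k.+2 / k`!%:R) -> cvgn (pseries c x).
Proof.
move=> K0 H; apply: normed_cvg => /=.
apply: (@series_le_cvg _ _ (fun k => K ^+ 2 * exp_coeff (K * `|x|) k)) => //.
- by move=> k /=.
- by move=> k; rewrite mulr_ge0 ?exprn_ge0// exp_coeff_ge0// mulr_ge0.
- move=> k; rewrite /exp_coeff /= normrM normrX exprMn.
  apply: (@le_trans _ _ (K ^+ k.+2 / k`!%:R * `|x| ^+ k)).
    by rewrite ler_wpM2r// exprn_ge0.
  rewrite -addn2 exprD le_eqVlt; apply/orP; left; apply/eqP; field.
  by rewrite pnatr_eq0 -lt0n fact_gt0.
- have := @is_cvg_seriesZ _ (exp_coeff (K * `|x|)) (K ^+ 2).
  by apply; exact: is_cvg_series_exp_coeff.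
Qed.

Lemma exp_coef_bound B i j k m : (m <= 2)%N ->
  `|(B ^+ (k + m)) i j / k`!%:R| <= (\sum_i \sum_j `|B i j| + 1) ^+ k.+2 / k`!%:R.
Proof.
move=> m2; rewrite normrM [X in _ * X]ger0_norm ?invr_ge0//.
have b0 : 0 <= \sum_i \sum_j `|B i j| by apply: sumr_ge0 => ? _; exact: sumr_ge0.
rewrite ler_wpM2r ?invr_ge0//; apply: le_trans (expr_entry_le _ _ _ _) _.
apply: (@le_trans _ _ ((\sum_i \sum_j `|B i j| + 1) ^+ (k + m))).
  by rewrite lerXn2r ?nnegrE ?addr_ge0// lerDl.
by rewrite ler_weXn2l ?lerDr// -addn2 leq_add2l.
Qed.

Lemma pseries_diffs_exp B i j m : pseries_diffs (fun k => (B ^+ (k + m)) i j / k`!%:R)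
  = (fun k => (B ^+ (k + m.+1)) i j / k`!%:R).
Proof.
apply/funext => k; rewrite /pseries_diffs addSnnS factS natrM.
by rewrite invfM mulrCA mulVKf ?pnatr_eq0.
Qed.

Lemma is_cvg_exp_coef B i j m t : (m <= 2)%N ->
  cvgn (pseries (fun k => (B ^+ (k + m)) i j / k`!%:R) t).
Proof.
move=> m2; apply: (@pseries_exp_bound _ (\sum_i \sum_j `|B i j| + 1)).
  by rewrite addr_ge0//; apply: sumr_ge0 => ? _; exact: sumr_ge0.
by move=> k; exact: exp_coef_bound.
Qed.

Lemma expr_scalemx B t k : (t *: B) ^+ k = t ^+ k *: B ^+ k.
Proof.
elim: k => [|k IH]; first by rewrite !expr0 scale1r.
by rewrite !mulmx_exprS IH -scalemxAl -scalemxAr scalerA -exprS.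
Qed.

Lemma series_expmx_entry B t k i j :
  series (fun k => (k`!%:R)^-1 *: (t *: B) ^+ k) k i j =
  pseries (fun k => (B ^+ (k + 0)) i j / k`!%:R) t k.
Proof.
rewrite /pseries /series /= summxE; apply: eq_bigr => l _.
rewrite addn0 mxE expr_scalemx mxE; ring.
Qed.

Lemma expmx_entry B t i j : expmx (t *: B) i j =
  limn (pseries (fun k => (B ^+ (k + 0)) i j / k`!%:R) t).
Proof.
rewrite /expmx.
suff -> : lim (series (fun k => (k`!%:R)^-1 *: (t *: B) ^+ k) @ \oo) =
    \matrix_(i, j) limn (pseries (fun k => (B ^+ (k + 0)) i j / k`!%:R) t).
  by rewrite mxE.
apply/cvg_lim; first exact: norm_hausdorff.
apply: cvg_mx_entries => a b; under eq_fun do rewrite series_expmx_entry.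
by rewrite mxE; exact: is_cvg_exp_coef.
Qed.

(** Termwise differentiation. It asks for convergence at [|t| + 1] of the series and of its first
    two derived series, and deriving only shifts the exponent of [B] ([pseries_diffs_exp]). *)
Lemma is_derive_expmx_entry0 B (t : R) i j : is_derive t 1 (fun s => expmx (s *: B) i j)
  (limn (pseries (fun k => (B ^+ (k + 1)) i j / k`!%:R) t)).
Proof.
rewrite (_ : (fun s => _) = fun s =>
    limn (pseries (fun k => (B ^+ (k + 0)) i j / k`!%:R) s)); last first.
  by apply/funext => s; rewrite expmx_entry.
rewrite -(pseries_diffs_exp B i j 0).
apply: (@pseries_snd_diffs _ _ (`|t| + 1)); rewrite ?pseries_diffs_exp.
- exact: is_cvg_exp_coef.
- exact: is_cvg_exp_coef.
- exact: is_cvg_exp_coef.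
- by rewrite [ltRHS]ger0_norm ?addr_ge0// ltrDl.
Qed.

Lemma pseries_exp_mull B t i j :
  limn (pseries (fun k => (B ^+ (k + 1)) i j / k`!%:R) t) = (B *m expmx (t *: B)) i j.
Proof.
rewrite mxE; apply/cvg_lim => //.
rewrite (_ : pseries _ t = fun k => \sum_l B i l *
    pseries (fun k => (B ^+ (k + 0)) l j / k`!%:R) t k); last first.
  apply/funext => k; rewrite /pseries /series /=.
  under [in RHS]eq_bigr do rewrite mulr_sumr.
  rewrite exchange_big /=; apply: eq_bigr => m _.
  rewrite addn1 addn0 mulmx_exprS mxE !mulr_suml; apply: eq_bigr => l _; ring.
apply: cvg_sum_fun => l; apply: cvgMr; rewrite expmx_entry.
exact: is_cvg_exp_coef.
Qed.

Lemma pseries_exp_mulr B t i j :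
  limn (pseries (fun k => (B ^+ (k + 1)) i j / k`!%:R) t) = (expmx (t *: B) *m B) i j.
Proof.
rewrite mxE; apply/cvg_lim => //.
rewrite (_ : pseries _ t = fun k => \sum_l
    pseries (fun k => (B ^+ (k + 0)) i l / k`!%:R) t k * B l j); last first.
  apply/funext => k; rewrite /pseries /series /=.
  under [in RHS]eq_bigr do rewrite mulr_suml.
  rewrite exchange_big /=; apply: eq_bigr => m _.
  rewrite addn1 addn0 mulmx_exprSr mxE !mulr_suml; apply: eq_bigr => l _; ring.
apply: cvg_sum_fun => l; apply: cvgMl; rewrite expmx_entry.
exact: is_cvg_exp_coef.
Qed.

Lemma is_derive_expmx B (t : R) i j :
  is_derive t 1 (fun s => expmx (s *: B) i j) ((B *m expmx (t *: B)) i j).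
Proof. by rewrite -pseries_exp_mull; exact: is_derive_expmx_entry0. Qed.

Lemma expmx_comm B t : B *m expmx (t *: B) = expmx (t *: B) *m B.
Proof. by apply/matrixP => i j; rewrite -pseries_exp_mull pseries_exp_mulr. Qed.

Lemma trmx_expr B k : (B ^+ k)^T = B^T ^+ k.
Proof.
elim: k => [|k IH]; first by rewrite !expr0 trmx1.
by rewrite mulmx_exprS trmx_mul IH -mulmx_exprSr.
Qed.

Lemma trmx_expmx B t : (expmx (t *: B))^T = expmx (t *: B^T).
Proof.
apply/matrixP => i j; rewrite mxE !expmx_entry.
congr (limn (pseries _ t)); apply/funext => k; by rewrite -trmx_expr mxE.
Qed.

Lemma expmx0 B : expmx (0 *: B) = 1%:M.
Proof.
apply/matrixP => i j; rewrite expmx_entry.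
(* The partial sum over no terms is 0, so the sequence is constant only from index 1. *)
apply/cvg_lim => //; rewrite -(cvg_shiftn 1) /=.
rewrite (_ : (fun k => _) = cst ((1%:M : 'M[R]_n) i j)); first exact: cvg_cst.
apply/funext => k; rewrite addn1 /pseries /series /= big_nat_recl// big1.
  by rewrite addr0 add0n !expr0 fact0 divr1 mulr1.
by move=> l _; rewrite expr0n /= mulr0.
Qed.

End matrix_exponential.

Lemma ge0_derive_le (R : realType) (f df : R -> R) :
  (forall t : R, is_derive t 1 f (df t)) -> (forall t : R, 0 <= t -> df t <= 0) ->
  forall t : R, 0 <= t -> f t <= f 0.
Proof.
move=> Hf Hd t t0; apply: (@ler0_derive1_nincry _ f 0) => //.
- move=> x; rewrite in_itv /= andbT => x0; rewrite derive1E.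
  by have [_ ->] := Hf x; apply/Hd/ltW.
- apply: derivable_within_continuous => x _; by have [] := Hf x.
Qed.

(** [expR (d * s) * (q s - c)] does not increase. When [q t > c], dropping the factor
    [expR (d * t) >= 1] gives [q t - c <= q 0 - c]. *)
Lemma gronwall_exp_decay (R : realType) (q dq : R -> R) (d c : R) : 0 < d -> 0 <= c ->
  (forall t : R, is_derive t 1 q (dq t)) ->
  (forall t : R, 0 <= t -> dq t <= - d * (q t - c)) ->
  0 <= q 0 -> forall t : R, 0 <= t -> q t <= c + q 0.
Proof.
move=> d0 c0 Hq Hdq q0 t t0.
pose g s := expR (d * s) * (q s - c).
have Hg (s : R) : is_derive s 1 g (expR (d * s) * (d * (q s - c) + dq s)).
  have H1 := Hq s; rewrite /g; apply: is_derive_eq.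
  by rewrite /GRing.scale /=; ring.
have : g t <= g 0.
  apply: (ge0_derive_le Hg) => // s s0.
  by rewrite mulr_ge0_le0 ?expR_ge0//; have := Hdq s s0; lra.
rewrite /g mulr0 expR0 mul1r => H.
have e1 : 1 <= expR (d * t) by rewrite -expR0 ler_expR mulr_ge0// ltW.
have [qc|qc] := leP (q t - c) 0; first by lra.
have : q t - c <= expR (d * t) * (q t - c) by rewrite ler_peMl// ltW.
lra.
Qed.

(* Variation of constants for z' = (a + i b) z + r1 + i r2 with z = x + i y, through
   the differential inequality satisfied by e^{2 tau t} |z|^2. *)
Lemma scalar_forced_decay (R : realType) (a b tau tau1 K : R) (x y r1 r2 : R -> R) :
  a <= - tau1 -> tau < tau1 -> 0 <= K ->
  (forall t : R, is_derive t 1 x (a * x t - b * y t + r1 t)) ->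
  (forall t : R, is_derive t 1 y (b * x t + a * y t + r2 t)) ->
  (forall t, 0 <= t -> `|r1 t| <= K * expR (- tau * t)) ->
  (forall t, 0 <= t -> `|r2 t| <= K * expR (- tau * t)) ->
  exists C, 0 <= C /\ forall t, 0 <= t ->
    `|x t| <= C * expR (- tau * t) /\ `|y t| <= C * expR (- tau * t).
Proof.
move=> atau tau1P K0 Hx Hy Hr1 Hr2.
pose d := tau1 - tau; have d0 : 0 < d by rewrite subr_gt0.
(* [c] is the equilibrium of the inequality [q' <= - d q + 2 K^2 / d] obtained below. *)
pose c := 2 * K ^+ 2 / d ^+ 2.
have c0 : 0 <= c by rewrite /c divr_ge0 ?mulr_ge0 ?exprn_ge0// ltW.
pose q t := expR (2 * tau * t) * (x t ^+ 2 + y t ^+ 2).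
pose dq t := expR (2 * tau * t) * (2 * tau * (x t ^+ 2 + y t ^+ 2) +
  2 * (x t * (a * x t - b * y t + r1 t) + y t * (b * x t + a * y t + r2 t))).
have Hq (t : R) : is_derive t 1 q (dq t).
  have H1 := Hx t; have H2 := Hy t.
  rewrite /q /dq; apply: is_derive_eq; rewrite /GRing.scale /=; ring.
have Hdq t : 0 <= t -> dq t <= - d * (q t - c).
  move=> t0; rewrite /dq /q.
  set E := expR _.
  have E0 : 0 < E by exact: expR_gt0.
  have Es : E * expR (- tau * t) ^+ 2 = 1.
    rewrite /E -expRM_natl -expRD -expR0; congr expR; rewrite -mulr_natl; ring.
  have s1 (r : R) : `|r| <= K * expR (- tau * t) -> E * r ^+ 2 <= K ^+ 2.
    move=> Hr; have : r ^+ 2 <= (K * expR (- tau * t)) ^+ 2.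
      by rewrite -[leLHS]real_normK ?num_real// lerXn2r// nnegrE mulr_ge0// expR_ge0.
    rewrite exprMn => H; apply: (@le_trans _ _ (E * (K ^+ 2 * expR (- tau * t) ^+ 2))).
      by rewrite ler_pM2l.
    by rewrite mulrCA Es mulr1.
  (* Young with weight [d]: it spends half of the dissipation, whose coefficient is
     [2 (tau1 - tau) = 2 d]. *)
  have y1 (u r : R) : 2 * (u * r) <= d * u ^+ 2 + d^-1 * r ^+ 2.
    have : 0 <= d^-1 * (d * u - r) ^+ 2 by rewrite mulr_ge0 ?sqr_ge0// invr_ge0 ltW.
    rewrite (_ : d^-1 * _ = d * u ^+ 2 + d^-1 * r ^+ 2 - 2 * (u * r)); first by lra.
    by field; rewrite gt_eqF.
  have A1 := y1 (x t) (r1 t); have A2 := y1 (y t) (r2 t).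
  have B1 := s1 _ (Hr1 t t0); have B2 := s1 _ (Hr2 t t0).
  have p0 : 0 <= x t ^+ 2 + y t ^+ 2 by rewrite addr_ge0 ?sqr_ge0.
  have A3 : a * (x t ^+ 2 + y t ^+ 2) <= - tau1 * (x t ^+ 2 + y t ^+ 2).
    by rewrite ler_wpM2r.
  set p := x t ^+ 2 + y t ^+ 2 in p0 A3 *.
  have A4 : 2 * tau * p + 2 * (x t * (a * x t - b * y t + r1 t) +
      y t * (b * x t + a * y t + r2 t)) <=
      - d * p + d^-1 * (r1 t ^+ 2 + r2 t ^+ 2).
    have -> : 2 * (x t * (a * x t - b * y t + r1 t) + y t * (b * x t + a * y t + r2 t))
      = 2 * (a * p) + 2 * (x t * r1 t) + 2 * (y t * r2 t) by rewrite /p; ring.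
    move: A1 A2 A3; rewrite /d /p; lra.
  apply: (@le_trans _ _ (E * (- d * p + d^-1 * (r1 t ^+ 2 + r2 t ^+ 2)))).
    by rewrite ler_pM2l.
  have -> : - d * (E * p - c) = - d * (E * p) + d^-1 * (2 * K ^+ 2).
    by rewrite /c; field; rewrite gt_eqF.
  have : d^-1 * (E * r1 t ^+ 2 + E * r2 t ^+ 2) <= d^-1 * (2 * K ^+ 2).
    by rewrite ler_wpM2l ?invr_ge0 ?(ltW d0)//; lra.
  lra.
have q00 : 0 <= q 0 by rewrite /q mulr_ge0 ?expR_ge0// addr_ge0 ?sqr_ge0.
have Hb := gronwall_exp_decay d0 c0 Hq Hdq q00.
exists (Num.sqrt (c + q 0)); split; first exact: sqrtr_ge0.
move=> t t0; have := Hb t t0; rewrite {1}/q => Hbt.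
have main (u : R) : u ^+ 2 <= x t ^+ 2 + y t ^+ 2 ->
    `|u| <= Num.sqrt (c + q 0) * expR (- tau * t).
  move=> Hu.
  rewrite -ler_sqr ?nnegrE ?mulr_ge0 ?sqrtr_ge0 ?expR_ge0//.
  rewrite real_normK ?num_real// exprMn sqr_sqrtr ?addr_ge0//.
  apply: le_trans Hu _.
  have -> : expR (- tau * t) ^+ 2 = (expR (2 * tau * t))^-1.
    rewrite -expRN -expRM_natl; congr expR; rewrite -mulr_natl; ring.
  by rewrite ler_pdivlMr ?expR_gt0// mulrC.
by split; apply: main; rewrite ?lerDl ?lerDr sqr_ge0.
Qed.

Lemma ReM (R : realType) (z w : R[i]) :
  complex.Re (z * w) = complex.Re z * complex.Re w - complex.Im z * complex.Im w.
Proof. by case: z => ? ?; case: w. Qed.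

Lemma ImM (R : realType) (z w : R[i]) :
  complex.Im (z * w) = complex.Re z * complex.Im w + complex.Im z * complex.Re w.
Proof. by case: z => ? ?; case: w => ? ? /=; rewrite addrC [X in _ + X]mulrC mulrC addrC mulrC [X in _ + X]mulrC. Qed.

Lemma Re_sum (R : realType) n (f : 'I_n -> R[i]) :
  complex.Re (\sum_i f i) = \sum_i complex.Re (f i).
Proof. exact: (raddf_sum (@complex.Re R)). Qed.

Lemma Im_sum (R : realType) n (f : 'I_n -> R[i]) :
  complex.Im (\sum_i f i) = \sum_i complex.Im (f i).
Proof. exact: (raddf_sum (@complex.Im R)). Qed.

(** * Decay of the matrix exponential from the spectrum *)

Section spectral_decay.
Context (R : realType) (n : nat) (B : 'M[R]_n).
Let cB := map_mx (real_complex R) B.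
Let cE t := map_mx (real_complex R) (expmx (t *: B)).

(** [z t = P e^{tB}] solves [z' = L z] with [L] lower triangular: row [i] is a scalar equation of
    rate [L i i], forced by the rows above, which decay by induction. The gap [tau < tau1] lets
    every row keep the rate [tau], where equal rates could produce powers of [t]. *)
Lemma triangular_decay (P L : 'M[R[i]]_n) (tau tau1 : R) :
  P *m cB = L *m P -> is_trig_mx L ->
  (forall i, complex.Re (L i i) <= - tau1) -> tau < tau1 ->
  exists C, 0 <= C /\ forall t, 0 <= t -> forall i j,
    `|complex.Re ((P *m cE t) i j)| <= C * expR (- tau * t) /\
    `|complex.Im ((P *m cE t) i j)| <= C * expR (- tau * t).
Proof.
move=> PB trigL reL tau1P.
pose z t := P *m cE t.
pose dz t := L *m z t.
have dzE t : dz t = P *m map_mx (real_complex R) (B *m expmx (t *: B)).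
  by rewrite /dz /z mulmxA -PB map_mxM mulmxA.
have Hre (t : R) i j : is_derive t 1 (fun s => complex.Re (z s i j)) (complex.Re (dz t i j)).
  rewrite dzE mxE Re_sum.
  rewrite (_ : (fun s => _) = fun s => \sum_k complex.Re (P i k) * expmx (s *: B) k j).
    rewrite (eq_bigr (fun k => complex.Re (P i k) * (B *m expmx (t *: B)) k j)).
      apply: is_derive_sum_fun => k; apply: is_derive_mulr_cst.
      exact: is_derive_expmx.
    by move=> k _; rewrite mxE ReM /= mulr0 subr0.
  apply/funext => s; rewrite mxE Re_sum; apply: eq_bigr => k _.
  by rewrite mxE ReM /= mulr0 subr0.
have Him (t : R) i j : is_derive t 1 (fun s => complex.Im (z s i j)) (complex.Im (dz t i j)).
  rewrite dzE mxE Im_sum.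
  rewrite (_ : (fun s => _) = fun s => \sum_k complex.Im (P i k) * expmx (s *: B) k j).
    rewrite (eq_bigr (fun k => complex.Im (P i k) * (B *m expmx (t *: B)) k j)).
      apply: is_derive_sum_fun => k; apply: is_derive_mulr_cst.
      exact: is_derive_expmx.
    by move=> k _; rewrite mxE ImM /= mulr0 add0r.
  apply/funext => s; rewrite mxE Im_sum; apply: eq_bigr => k _.
  by rewrite mxE ImM /= mulr0 add0r.
have row_bound m : forall i : 'I_n, (i < m)%N -> forall j,
    exists C, 0 <= C /\ forall t, 0 <= t ->
    `|complex.Re (z t i j)| <= C * expR (- tau * t) /\
    `|complex.Im (z t i j)| <= C * expR (- tau * t).
  elim: m => [//|m IH] i im j.
  (* Stated for every [k], with default constant 0 from row [i] on, so that [choice] yields a total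
     function. *)
  have IH' (k : 'I_n) : exists C, 0 <= C /\ ((k < i)%N -> forall t, 0 <= t ->
      `|complex.Re (z t k j)| <= C * expR (- tau * t) /\
      `|complex.Im (z t k j)| <= C * expR (- tau * t)).
    have [ki|ik] := ltnP k i; last by exists 0.
    have [C [C0 HC]] := IH k (leq_trans ki im) j.
    by exists C.
  have [C HC] := choice IH'.
  pose K := \sum_(k < n | (k < i)%N) (`|complex.Re (L i k)| + `|complex.Im (L i k)|) * C k.
  have K0 : 0 <= K.
    apply: sumr_ge0 => k _; apply: mulr_ge0; first exact: addr_ge0.
    by have [] := HC k.
  pose r1 t := \sum_(k < n | (k < i)%N) complex.Re (L i k * z t k j).
  pose r2 t := \sum_(k < n | (k < i)%N) complex.Im (L i k * z t k j).
  have split_row t (f : {additive R[i] -> R}) : f (dz t i j) =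
      f (L i i * z t i j) + \sum_(k < n | (k < i)%N) f (L i k * z t k j).
    rewrite /dz mxE raddf_sum (bigD1 i)//=; congr (_ + _).
    rewrite big_mkcond [RHS]big_mkcond /=; apply: eq_bigr => k _.
    case: (ltngtP k i) => [ki|ik|/val_inj ->].
    - by rewrite -val_eqE /= ltn_eqF.
    - rewrite -val_eqE /= gtn_eqF//; have /is_trig_mxP -> // := trigL.
      by rewrite mul0r raddf0.
    - by rewrite eqxx.
  have E1 t : complex.Re (dz t i j) = complex.Re (L i i) * complex.Re (z t i j)
      - complex.Im (L i i) * complex.Im (z t i j) + r1 t.
    by have := split_row t (@complex.Re R); rewrite /= ReM.
  have E2 t : complex.Im (dz t i j) = complex.Im (L i i) * complex.Re (z t i j)
      + complex.Re (L i i) * complex.Im (z t i j) + r2 t.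
    by have := split_row t (@complex.Im R); rewrite /= ImM [_ * _ + _ * complex.Re _]addrC.
  apply: (@scalar_forced_decay _ (complex.Re (L i i)) (complex.Im (L i i)) tau tau1 K
    (fun s => complex.Re (z s i j)) (fun s => complex.Im (z s i j)) r1 r2 (reL i) tau1P K0).
  - by move=> t; rewrite -E1.
  - by move=> t; rewrite -E2.
  - move=> t t0; apply: le_trans (ler_norm_sum _ _ _) _.
    rewrite mulr_suml; apply: ler_sum => k ki.
    have [C0 /(_ ki t t0) [h1 h2]] := HC k.
    rewrite ReM (le_trans (ler_normB _ _))// !normrM -mulrA mulrDl.
    by rewrite lerD// ler_wpM2l.
  - move=> t t0; apply: le_trans (ler_norm_sum _ _ _) _.
    rewrite mulr_suml; apply: ler_sum => k ki.
    have [C0 /(_ ki t t0) [h1 h2]] := HC k.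
    rewrite ImM (le_trans (ler_normD _ _))// !normrM -mulrA mulrDl.
    by rewrite lerD// ler_wpM2l.
have row_bound' (ij : 'I_n * 'I_n) := row_bound n ij.1 (ltn_ord ij.1) ij.2.
have [C HC] := choice row_bound'.
exists (\sum_ij C ij); split; first by apply: sumr_ge0 => k _; have [] := HC k.
move=> t t0 i j; have [C0 /(_ t t0) /= [h1 h2]] := HC (i, j).
have CC : C (i, j) <= \sum_ij C ij.
  rewrite (bigD1 (i, j))//= lerDl; apply: sumr_ge0 => k _; by have [] := HC k.
by split; [apply: le_trans h1 _|apply: le_trans h2 _]; rewrite ler_wpM2r ?expR_ge0.
Qed.

(** Schur triangularisation over [R[i]]: the diagonal entries of the triangular form are eigenvalues
    of [B], and coming back through [invmx P] only changes the constant. *)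
Lemma expmx_decay (tau tau1 : R) :
  (forall z, spectrum B z -> complex.Re z <= - tau1) -> tau < tau1 ->
  exists C, 0 <= C /\ forall t, 0 <= t -> forall i j,
    `|expmx (t *: B) i j| <= C * expR (- tau * t).
Proof.
case: (posnP n) => [n0|n0] specB tau1P.
  exists 0; split => // t _ i; exfalso; by have := leq_ltn_trans (leq0n i) (ltn_ord i); rewrite n0.
have [P Pu trigP] := Schur cB n0.
have {}Pu := unitarymx_unit Pu.
pose L := conjmx P cB.
have PB : P *m cB = L *m P by rewrite /L conjumx// mulmxKV.
have reL i : complex.Re (L i i) <= - tau1.
  apply: specB; rewrite /spectrum /= -/cB.
  have eigL : eigenvalue L (L i i).
    rewrite eigenvalue_root_char char_poly_trig//.
    rewrite /root horner_prod (bigD1 i)//= hornerXsubC subrr mul0r//.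
  have /eigenvalueP [v vL vn0] := eigL.
  apply/eigenvalueP; exists (v *m P).
    by rewrite -mulmxA PB mulmxA vL scalemxAl.
  apply: contraNneq vn0 => vP0.
  by rewrite -(mulmxK Pu v) vP0 mul0mx.
have [C [C0 HC]] := triangular_decay PB trigP reL tau1P.
pose D := \sum_i \sum_k (`|complex.Re (invmx P i k)| + `|complex.Im (invmx P i k)|) * C.
exists D; split.
  by apply: sumr_ge0 => i _; apply: sumr_ge0 => k _; rewrite mulr_ge0 ?addr_ge0.
move=> t t0 i j.
have -> : expmx (t *: B) i j = complex.Re ((invmx P *m (P *m cE t)) i j).
  by rewrite mulKmx// mxE.
rewrite mxE Re_sum (le_trans (ler_norm_sum _ _ _))//.
rewrite /D [X in _ <= X * _](bigD1 i)//= mulrDl -[leLHS]addr0 lerD//; last first.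
  rewrite mulr_ge0 ?expR_ge0//; apply: sumr_ge0 => l _.
  by apply: sumr_ge0 => k _; rewrite mulr_ge0 ?addr_ge0.
rewrite mulr_suml; apply: ler_sum => k _.
have [h1 h2] := HC t t0 k j.
rewrite ReM (le_trans (ler_normB _ _))// !normrM -mulrA mulrDl.
by rewrite lerD// ler_wpM2l.
Qed.

End spectral_decay.

(** * The Lyapunov equation *)

Lemma continuous_exp_decay (R : realType) (K a : R) :
  continuous (fun t : R => K * expR (- a * t)).
Proof.
move=> t; apply: cvgMr; apply: continuous_comp; last exact: continuous_expR.
by apply: cvgMr; exact: cvg_id.
Qed.

Lemma cvg_exp_decay (R : realType) (K a : R) : 0 < a ->
  K * expR (- a * t) @[t --> +oo] --> (0 : R).
Proof.
move=> a0; rewrite -(mulr0 K); apply: cvgMr.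
under eq_fun do rewrite mulNr.
apply: (cvg_comp (fun t => a * t) (fun t => expR (- t))); last exact: cvgr_expR.
exact: gt0_cvgMry.
Qed.

Lemma is_derive_exp_decay (R : realType) (K a t : R) : a != 0 ->
  is_derive t 1 (fun t : R => - (K / a) * expR (- a * t)) (K * expR (- a * t)).
Proof.
move=> a0; apply: is_derive_eq; rewrite /GRing.scale /=.
by field.
Qed.

Lemma integral_exp_decay (R : realType) (K a : R) : 0 < a -> 0 <= K ->
  (\int[@lebesgue_measure R]_(t in `[0%R, +oo[) (K * expR (- a * t))%:E = (K / a)%:E)%E.
Proof.
move=> a0 K0.
have D (t : R) := is_derive_exp_decay K t (lt0r_neq0 a0).
have := @ge0_continuous_FTC2y R (fun t => K * expR (- a * t))
  (fun t : R => - (K / a) * expR (- a * t)) 0 0.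
rewrite mulr0 expR0 mulr1 EFinN oppeK add0e; apply.
- by move=> x _; rewrite mulr_ge0 ?expR_ge0.
- by apply: continuous_subspaceT => x; exact: continuous_exp_decay.
- exact: cvg_exp_decay.
- by move=> x _; have [] := D x.
- by apply: cvg_at_right_filter; have := @continuous_exp_decay R (- (K / a)) a 0; rewrite /continuous_at /= mulr0 expR0 mulr1.
- by move=> x _; rewrite derive1E; have [_ ->] := D x.
Qed.

Lemma integrable_exp_decay (R : realType) (K a : R) (f : R -> R) : 0 < a -> 0 <= K ->
  continuous f -> (forall t, 0 <= t -> `|f t| <= K * expR (- a * t)) ->
  (@lebesgue_measure R).-integrable `[0%R, +oo[ (EFin \o f).
Proof.
move=> a0 K0 cf fK.
have mf : measurable_fun (setT : set R) f by exact: continuous_measurable_fun.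
have mg : measurable_fun (setT : set R) (fun t => K * expR (- a * t)).
  exact: (continuous_measurable_fun (@continuous_exp_decay R K a)).
have ig : (@lebesgue_measure R).-integrable `[0%R, +oo[
    (EFin \o (fun t => K * expR (- a * t))).
  apply/integrableP; split; first by apply/measurable_EFinP; exact: measurable_funTS.
  under eq_integral => x _ do rewrite /= ger0_norm ?mulr_ge0 ?expR_ge0//.
  by rewrite integral_exp_decay// ltry.
apply: le_integrable ig => //.
- by apply/measurable_EFinP; exact: measurable_funTS.
- move=> x; rewrite /= in_itv /= andbT => x0.
  by rewrite lee_fin (le_trans (fK x x0))// ler_norm.
Qed.

(** [f] has no sign, while the fundamental theorem on the half-line is applied to a nonnegative
    integrand: [K * expR (- a * t)] dominates [|f|], so it is added to [f] and its known integral
    removed at the end. *)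
Lemma Rintegral_exp_decay (R : realType) (K a : R) (f F : R -> R) : 0 < a -> 0 <= K ->
  continuous f -> (forall t : R, is_derive t 1 F (f t)) ->
  (forall t, 0 <= t -> `|f t| <= K * expR (- a * t)) ->
  (forall t, 0 <= t -> `|F t| <= K * expR (- a * t)) ->
  \int[@lebesgue_measure R]_(t in `[0, +oo[) f t = - F 0.
Proof.
move=> a0 K0 cf dF fK FK.
pose e t := K * expR (- a * t).
have ie : (@lebesgue_measure R).-integrable `[0%R, +oo[ (EFin \o e).
  apply: (integrable_exp_decay a0 K0); first exact: continuous_exp_decay.
  by move=> t _; rewrite ger0_norm ?mulr_ge0 ?expR_ge0.
have if_ := integrable_exp_decay a0 K0 cf fK.
have De (t : R) := is_derive_exp_decay K t (lt0r_neq0 a0).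
pose G t := F t + - (K / a) * expR (- a * t).
have DG (t : R) : is_derive t 1 G (f t + e t).
  by have H1 := dF t; have H2 := De t; exact: is_deriveD.
have F0 : F x @[x --> +oo] --> (0 : R).
  have Hn : \forall t \near +oo, cst 0 t <= `|F t| <= e t.
    by near=> t; rewrite normr_ge0 /= FK//; near: t; exact: nbhs_pinfty_ge.
  apply: norm_cvg0; apply: (squeeze_cvgr Hn); first exact: cvg_cst.
  exact: cvg_exp_decay.
have cG : continuous G.
  move=> x; apply: differentiable_continuous; apply/derivable1_diffP.
  by have [] := DG x.
have H : \int[@lebesgue_measure R]_(t in `[0, +oo[) (f t + e t) = 0 - G 0.
  apply: Rintegral_ge0_continuous_FTC2y.
  - by move=> x x0; have := fK x x0; rewrite ler_norml /e => /andP[]; lra.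
  - apply: continuous_subspaceT => x; apply: cvgD; first exact: cf.
    exact: continuous_exp_decay.
  - rewrite -[0]addr0; apply: cvgD => //; exact: cvg_exp_decay.
  - by move=> x _; have [] := DG x.
  - by apply: cvg_at_right_filter; exact: cG.
  - by move=> x _; rewrite derive1E; have [_ ->] := DG x.
move: H; rewrite RintegralD//.
have -> : \int[@lebesgue_measure R]_(t in `[0, +oo[) e t = K / a.
  by rewrite /Rintegral /e integral_exp_decay.
rewrite /G mulr0 expR0 mulr1; lra.
Unshelve. all: by end_near.
Qed.

Section Qinf.
Context (R : realType) (n : nat) (Q B : 'M[R]_n) (tau C : R).
Hypothesis tau0 : 0 < tau.
Hypothesis C0 : 0 <= C.
Hypothesis decay : forall t, 0 <= t -> forall i j, `|expmx (t *: B) i j| <= C * expR (- tau * t).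

Let X s := expmx (s *: B) *m Q *m expmx (s *: B^T).
Let dX s := B *m X s + X s *m B^T.

Lemma QinfX_entry s i j : X s i j =
  \sum_k \sum_l Q k l * (expmx (s *: B) i k * expmx (s *: B) j l).
Proof.
rewrite /X -trmx_expmx mxE exchange_big /=; apply: eq_bigr => l _.
rewrite !mxE mulr_suml; apply: eq_bigr => k _; ring.
Qed.

Lemma is_derive_QinfX (s : R) i j : is_derive s 1 (fun s => X s i j) (dX s i j).
Proof.
rewrite (_ : (fun s => _) = (fun s => \sum_k \sum_l
    Q k l * (expmx (s *: B) i k * expmx (s *: B) j l))); last first.
  by apply/funext => t; rewrite QinfX_entry.
have -> : dX s i j = \sum_k \sum_l Q k l *
    ((B *m expmx (s *: B)) i k * expmx (s *: B) j l +
     expmx (s *: B) i k * (B *m expmx (s *: B)) j l).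
  under eq_bigr do under eq_bigr do rewrite mulrDr.
  under eq_bigr do rewrite big_split /=.
  rewrite big_split /= /dX mxE; congr (_ + _).
    rewrite /X -trmx_expmx !mulmxA mxE exchange_big /=; apply: eq_bigr => l _.
    by rewrite !mxE mulr_suml; apply: eq_bigr => k _; rewrite mxE; ring.
  rewrite /X -mulmxA -trmx_expmx -trmx_mul mxE exchange_big /=; apply: eq_bigr => l _.
  by rewrite !mxE mulr_suml; apply: eq_bigr => k _; rewrite ?mxE; ring.
apply: is_derive_sum_fun => k; apply: is_derive_sum_fun => l.
apply: is_derive_mulr_cst.
have H1 := is_derive_expmx B s i k; have H2 := is_derive_expmx B s j l.
apply: is_derive_eq; rewrite /GRing.scale /=; ring.
Qed.

(** Of the two exponential factors one supplies the rate [tau] and the other is bounded by its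
    constant [C]. This rate is enough for integrability and for vanishing at infinity. *)
Lemma QinfX_decay : exists K, 0 <= K /\ forall t, 0 <= t -> forall i j,
  `|X t i j| <= K * expR (- tau * t) /\ `|dX t i j| <= K * expR (- tau * t).
Proof.
pose K := \sum_k \sum_l `|Q k l| * C ^+ 2.
have K0 : 0 <= K.
  by apply: sumr_ge0 => k _; apply: sumr_ge0 => l _; rewrite mulr_ge0// exprn_ge0.
have XK t : 0 <= t -> forall i j, `|X t i j| <= K * expR (- tau * t).
  move=> t0 i j; rewrite QinfX_entry (le_trans (ler_norm_sum _ _ _))// mulr_suml.
  apply: ler_sum => k _; rewrite (le_trans (ler_norm_sum _ _ _))// mulr_suml.
  apply: ler_sum => l _; rewrite !normrM -mulrA ler_wpM2l//.
  apply: (@le_trans _ _ (C * expR (- tau * t) * (C * 1))).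
    apply: ler_pM => //; first exact: decay.
    apply: le_trans (decay t0 j l) _; rewrite ler_wpM2l//.
    by rewrite -expR0 ler_expR mulNr oppr_le0 mulr_ge0// ltW.
  by rewrite mulr1 expr2 mulrAC.
pose b := \sum_i \sum_j `|B i j|.
have b0 : 0 <= b by apply: sumr_ge0 => ? _; exact: sumr_ge0.
have bB i : \sum_k `|B i k| <= b.
  rewrite [leRHS](bigD1 i)//= lerDl; apply: sumr_ge0 => ? _; exact: sumr_ge0.
exists (K + 2 * b * K); split; first by rewrite addr_ge0// !mulr_ge0.
move=> t t0 i j; have e0 := expR_ge0 (- tau * t); split.
  by apply: le_trans (XK t t0 i j) _; rewrite ler_wpM2r// lerDl !mulr_ge0.
have h1 : `|(B *m X t) i j| <= b * (K * expR (- tau * t)).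
  rewrite mxE (le_trans (ler_norm_sum _ _ _))//.
  apply: (@le_trans _ _ (\sum_k `|B i k| * (K * expR (- tau * t)))).
    by apply: ler_sum => k _; rewrite normrM ler_wpM2l// XK.
  by rewrite -mulr_suml ler_wpM2r// mulr_ge0.
have h2 : `|(X t *m B^T) i j| <= b * (K * expR (- tau * t)).
  rewrite mxE (le_trans (ler_norm_sum _ _ _))//.
  apply: (@le_trans _ _ (\sum_k `|B j k| * (K * expR (- tau * t)))).
    by apply: ler_sum => k _; rewrite normrM [B^T k j]mxE mulrC ler_wpM2l// XK.
  by rewrite -mulr_suml ler_wpM2r// mulr_ge0.
rewrite /dX mxE (le_trans (ler_normD _ _))//.
have : 0 <= K * expR (- tau * t) by rewrite mulr_ge0.
lra.
Qed.

Lemma continuous_QinfX i j : continuous (fun s => X s i j).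
Proof.
move=> s; apply: differentiable_continuous; apply/derivable1_diffP.
by have [] := is_derive_QinfX s i j.
Qed.

Lemma continuous_dQinfX i j : continuous (fun s => dX s i j).
Proof.
have H (s : R) : is_derive s 1 (fun s => dX s i j)
    (\sum_k B i k * dX s k j + \sum_k B j k * dX s i k).
  rewrite (_ : (fun s => _) = fun s => \sum_k B i k * X s k j + \sum_k B j k * X s i k).
    apply: is_deriveD; apply: is_derive_sum_fun => k; apply: is_derive_mulr_cst;
      exact: is_derive_QinfX.
  apply/funext => t; rewrite /dX !mxE; congr (_ + _); apply: eq_bigr => k _.
  by rewrite [B^T k j]mxE mulrC.
move=> s; apply: differentiable_continuous; apply/derivable1_diffP.
by have [] := H s.
Qed.

Lemma integrable_QinfX i j :
  (@lebesgue_measure R).-integrable `[0%R, +oo[ (EFin \o (fun s => X s i j)).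
Proof.
have [K [K0 HK]] := QinfX_decay.
apply: (integrable_exp_decay tau0 K0); first exact: continuous_QinfX.
by move=> t t0; have [] := HK t t0 i j.
Qed.

Lemma Qinf_entry i j : Qinf Q B i j = \int[@lebesgue_measure R]_(s in `[0, +oo[) X s i j.
Proof. by rewrite mxE. Qed.

(** Integrability travels with the equality so that the induction can use additivity of the
    integral. One statement covers the entries of [B *m Qinf Q B], those of [Qinf Q B *m B^T], and
    quadratic forms. *)
Lemma Qinf_lincomb (I : Type) (r : seq I) (c : I -> R) (p : I -> 'I_n * 'I_n) :
  (@lebesgue_measure R).-integrable `[0%R, +oo[
     (EFin \o (fun s => \sum_(k <- r) c k * X s (p k).1 (p k).2)) /\
  \sum_(k <- r) c k * Qinf Q B (p k).1 (p k).2 =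
  \int[@lebesgue_measure R]_(s in `[0, +oo[) \sum_(k <- r) c k * X s (p k).1 (p k).2.
Proof.
elim: r => [|k r [IH1 IH2]].
  split.
    rewrite (_ : _ \o _ = cst 0%E); first exact: integrable0.
    by apply/funext => s /=; rewrite big_nil.
  rewrite big_nil; under eq_Rintegral do rewrite big_nil.
  by rewrite /Rintegral integral0.
have I1 : (@lebesgue_measure R).-integrable `[0%R, +oo[
    (EFin \o (fun s => c k * X s (p k).1 (p k).2)).
  by apply: (integrableZl _ _ (integrable_QinfX (p k).1 (p k).2)).
split.
  rewrite (_ : _ \o _ = (EFin \o (fun s => c k * X s (p k).1 (p k).2)%R) \+
    (EFin \o (fun s => \sum_(k <- r) c k * X s (p k).1 (p k).2)%R))%E.
    exact: integrableD.
  by apply/funext => s /=; rewrite big_cons.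
rewrite big_cons IH2; under [RHS]eq_Rintegral do rewrite big_cons.
rewrite RintegralD// RintegralZl//; last exact: integrable_QinfX.
by rewrite Qinf_entry.
Qed.

(** [B X + X B^T] is the derivative of [X s = e^{sB} Q e^{sB^T}], which vanishes at infinity, so its
    integral over the half-line is [- X 0 = - Q]. *)
Lemma Qinf_lyapunov : B *m Qinf Q B + Qinf Q B *m B^T = - Q.
Proof.
apply/matrixP => i j; rewrite !mxE.
have [i1 E1] := Qinf_lincomb (index_enum 'I_n) (fun k => B i k) (fun k => (k, j)).
have [i2 E2] := Qinf_lincomb (index_enum 'I_n) (fun k => B j k) (fun k => (i, k)).
rewrite /= in i1 E1 i2 E2; rewrite E1.
under [X in _ + X = _]eq_bigr do rewrite [B^T _ _]mxE mulrC.
rewrite E2 -RintegralD//.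
rewrite (_ : Q i j = X 0 i j); last first.
  have E0 : expmx (0 : 'M[R]_n) = 1%:M by rewrite -(scale0r B) expmx0.
  by rewrite /X !scale0r E0 mul1mx mulmx1.
have [K [K0 HK]] := QinfX_decay.
transitivity (\int[@lebesgue_measure R]_(s in `[0, +oo[) dX s i j).
  apply: eq_Rintegral => s _; rewrite /dX !mxE; congr (_ + _); apply: eq_bigr => k _.
  by rewrite [B^T k j]mxE mulrC.
apply: (Rintegral_exp_decay (F := fun s => X s i j) tau0 K0 (@continuous_dQinfX i j)).
- by move=> t; exact: is_derive_QinfX.
- by move=> t t0; have [] := HK t t0 i j.
- by move=> t t0; have [] := HK t t0 i j.
Qed.

Lemma Qinf_psd : psdmx Q -> psdmx (Qinf Q B).
Proof.
move=> [Qsym Qpos]; split.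
  apply/matrixP => i j; rewrite !mxE; apply: eq_Rintegral => s _.
  rewrite -/(X s) -[in LHS](trmxK (X s)) mxE; congr (_ i j).
  by rewrite /X !trmx_mul -!trmx_expmx trmxK Qsym mulmxA.
move=> x; have [_] := Qinf_lincomb (index_enum ('I_n * 'I_n)%type)
  (fun k => x 0 k.1 * x 0 k.2) (fun k => k).
have E (M : 'M[R]_n) : (x *m M *m x^T) 0 0 = \sum_k x 0 k.1 * x 0 k.2 * M k.1 k.2.
  rewrite -(pair_bigA _ (fun i j => x 0 i * x 0 j * M i j)) /= exchange_big mxE.
  apply: eq_bigr => j _.
  by rewrite !mxE mulr_suml; apply: eq_bigr => i _; ring.
rewrite E => ->; apply: Rintegral_ge0 => s _.
rewrite -(E (X s)) /X -trmx_expmx !mulmxA.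
by have := Qpos (x *m expmx (s *: B)); rewrite trmx_mul !mulmxA.
Qed.

End Qinf.

(** * Positive definiteness from the Kalman rank condition *)

Section positive_definite.
Context (R : realType) (n : nat).
Implicit Types (Q B S : 'M[R]_n).

Lemma rV_sq_eq0 m (x : 'rV[R]_m) : (x *m x^T) 0 0 <= 0 -> x = 0.
Proof.
rewrite mxE => H; apply/rowP => i; rewrite mxE.
have H0 j : 0 <= x 0 j * x^T j 0 by rewrite mxE -expr2 sqr_ge0.
have /eqP : \sum_j x 0 j * x^T j 0 = 0.
  by apply/eqP; rewrite eq_le H; apply: sumr_ge0.
rewrite psumr_eq0// => /allP /(_ i (mem_index_enum _)) /=.
by rewrite mxE -expr2 sqrf_eq0 => /eqP.
Qed.

(** Positivity at [x - e *: (x *m S)] reads [0 <= - 2 e a + e^2 c], with [a] the squared length of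
    [x *m S]. For small [e > 0] the linear term dominates, which forces [a = 0]. *)
Lemma psdmx_kernel S (x : 'rV[R]_n) : psdmx S -> (x *m S *m x^T) 0 0 = 0 -> x *m S = 0.
Proof.
move=> [Ssym Spos] xS; apply: rV_sq_eq0.
set y := x *m S; set a := (y *m y^T) 0 0.
pose c := (y *m S *m y^T) 0 0.
have H e : 0 <= - (2 * e * a) + e ^+ 2 * c.
  have := Spos (x - e *: y).
  have -> : (x - e *: y)^T = x^T - e *: y^T by apply/matrixP => i j; rewrite !mxE.
  rewrite mulmxBr !mulmxBl -/y -!scalemxAr -!scalemxAl.
  have mE (A C : 'M[R]_1) : (A - C) 0 0 = A 0 0 - C 0 0 by rewrite !mxE.
  have zE (b : R) (A : 'M[R]_1) : (b *: A) 0 0 = b * A 0 0 by rewrite mxE.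
  rewrite !(mE, zE).
  have -> : (y *m S *m x^T) 0 0 = a.
    by rewrite /a {3}/y trmx_mul Ssym mulmxA.
  have -> : (y *m x^T) 0 0 = 0 by [].
  by rewrite -/a -/c; lra.
have c0 : 0 <= c by exact: Spos.
rewrite leNgt; apply/negP => a0.
(* Small enough for the linear term to win; [+ 1] covers [c = 0]. *)
have := H (a / (c + 1)).
have -> : - (2 * (a / (c + 1)) * a) + (a / (c + 1)) ^+ 2 * c =
  (a / (c + 1)) ^+ 2 * (- (2 * (c + 1)) + c) by field; rewrite gt_eqF// ltr_wpDl.
rewrite pmulr_rge0; first lra.
by rewrite exprn_gt0// divr_gt0// ltr_wpDl.
Qed.

(** The left kernel of [S] is stable under [B] and killed by [sqrtQ]: if [y S = 0], the Lyapunov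
    equation gives [y Q y^T = 0], hence [y Q = 0], and then [y B S = 0]. A vector of this kernel is
    therefore killed by every Kalman block, and full rank makes it 0. *)
Lemma lyapunov_posdef Q B S (sqrtQ : 'M[R]_n) : psdmx Q -> is_sqrtmx sqrtQ Q ->
  \rank (kalman_mx sqrtQ B) = n -> psdmx S -> B *m S + S *m B^T = - Q ->
  forall x : 'rV[R]_n, x != 0 -> 0 < (x *m S *m x^T) 0 0.
Proof.
move=> hQ [[sQs sQp] sQQ] hrank hS lyap x xn0.
rewrite lt_neqAle hS.2 andbT eq_sym; apply/negP => /eqP xS0.
have ker_step (y : 'rV[R]_n) : y *m S = 0 -> y *m Q = 0 /\ (y *m B) *m S = 0.
  move=> yS.
  have yQ : y *m Q = 0.
    apply: psdmx_kernel => //.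
    have -> : Q = - (B *m S + S *m B^T) by rewrite lyap opprK.
    rewrite mulmxN mulNmx mulmxDr !mulmxA yS mul0mx addr0 -mulmxA.
    have -> : S *m y^T = 0 by rewrite -[LHS]trmxK trmx_mul trmxK hS.1 yS trmx0.
    by rewrite mulmx0 oppr0 mxE.
  split => //; move/(congr1 (mulmx y)): lyap.
  by rewrite mulmxDr !mulmxA yS mul0mx addr0 mulmxN yQ oppr0.
have kerB k : x *m B ^+ k *m S = 0.
  elim: k => [|k IH]; first by rewrite expr0 mulmx1; exact: psdmx_kernel.
  by rewrite mulmx_exprSr mulmxA; have [] := ker_step _ IH.
have kerQ k : x *m B ^+ k *m sqrtQ = 0.
  apply: rV_sq_eq0; rewrite trmx_mul sQs mulmxA -(mulmxA _ sqrtQ sqrtQ) sQQ.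
  by have [-> _] := ker_step _ (kerB k); rewrite mul0mx mxE.
have : x *m kalman_mx sqrtQ B = 0.
  rewrite /kalman_mx mul_mxrow; apply/mxrowP => k.
  by rewrite mxrowK mulmxA kerQ submxrow0.
move/eqP; rewrite mulmx_free_eq0; last by rewrite /row_free hrank.
by rewrite (negbTE xn0).
Qed.

End positive_definite.

(** * Spectral abscissa *)

Section spectral_abscissa.
Context (R : realType) (n : nat) (B : 'M[R]_n).

Lemma seq_max_exists (T : eqType) (s : seq T) (f : T -> R) : s != [::] ->
  exists2 x, x \in s & forall y, y \in s -> f y <= f x.
Proof.
elim: s => [//|a s IH] _; have [->|sn0] := eqVneq s [::].
  by exists a; rewrite ?mem_head// => y; rewrite inE => /eqP ->.
have [x xs Hx] := IH sn0; have [ax|xa] := leP (f a) (f x).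
  by exists x; rewrite ?inE ?xs ?orbT// => y; rewrite inE => /predU1P[->//|/Hx].
exists a; rewrite ?mem_head// => y; rewrite inE => /predU1P[->//|/Hx yx].
exact: le_trans yx (ltW xa).
Qed.

(** The characteristic polynomial splits over [R[i]], so the spectrum is a finite list of roots,
    nonempty because the degree is [n > 0]. That the maximum is attained turns [Re < 0] into a
    strictly positive [tau0]. *)
Lemma spectrum_max : (0 < n)%N -> exists2 z, spectrum B z &
  forall w, spectrum B w -> complex.Re w <= complex.Re z.
Proof.
move=> n0; set cB := map_mx (real_complex R) B.
have [s Hs] := closed_field_poly_normal (char_poly cB).
have ch1 : lead_coef (char_poly cB) = 1 by apply/monicP; exact: char_poly_monic.
rewrite ch1 scale1r in Hs.
have specE z : spectrum B z <-> z \in s.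
  rewrite /spectrum /= -/cB eigenvalue_root_char Hs.
  by rewrite root_prod_XsubC.
have sn0 : s != [::].
  apply: contraTneq n0 => s0; rewrite s0 big_nil in Hs.
  by have := size_char_poly cB; rewrite Hs size_poly1 => -[<-].
have [z zs Hz] := seq_max_exists (@complex.Re R) sn0.
by exists z; [exact/specE|move=> w /specE; exact: Hz].
Qed.

Lemma ReN (z : R[i]) : complex.Re (- z) = - complex.Re z.
Proof. by case: z. Qed.

Lemma spectral_abscissaP : (0 < n)%N ->
  (forall z, spectrum B z -> complex.Re z < 0) ->
  let tau0 := inf [set complex.Re (- z) | z in spectrum B] in
  [/\ tau0 = - sup [set complex.Re z | z in spectrum B], 0 < tau0 &
     forall z, spectrum B z -> complex.Re z <= - tau0].
Proof.
move=> n0 hB tau0.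
have E : tau0 = - sup [set complex.Re z | z in spectrum B].
  rewrite /tau0 /inf image_comp; congr (- sup _).
  by apply: eq_imagel => z _ /=; rewrite ReN opprK.
have [z Sz Hz] := spectrum_max n0.
have supE : sup [set complex.Re z | z in spectrum B] = complex.Re z.
  apply/eqP; rewrite eq_le; apply/andP; split.
    by apply: ge_sup; [exists (complex.Re z), z|move=> _ [w Sw <-]; exact: Hz].
  apply: ub_le_sup; last by exists z.
  by exists (complex.Re z) => _ [w Sw <-]; exact: Hz.
split => //; first by rewrite E supE oppr_gt0; exact: hB.
by move=> w Sw; rewrite E supE opprK; exact: Hz.
Qed.

End spectral_abscissa.

(** * Gaussian integrals *)

Lemma cvg_integral_dominated d (T : measurableType d) (R : realType)
    (mu : {measure set T -> \bar R}) (f_ : nat -> T -> R) (f g : T -> R) :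
  (forall n, measurable_fun setT (f_ n)) ->
  (forall x, f_ n x @[n --> \oo] --> f x) ->
  mu.-integrable setT (EFin \o g) -> (forall n x, `|f_ n x| <= g x) ->
  (\int[mu]_x (f_ n x)%:E)%E @[n --> \oo] --> (\int[mu]_x (f x)%:E)%E.
Proof.
move=> mf_ cf ig fg.
have mf : measurable_fun setT f.
  exact: (measurable_fun_cvg (D := setT) mf_ (fun x _ => cf x)).
have mf_' n : measurable_fun setT (EFin \o f_ n) by exact/measurable_EFinP.
have mf' : measurable_fun setT (EFin \o f) by exact/measurable_EFinP.
have cf' : {ae mu, forall x, setT x -> (EFin \o f_ n) x @[n --> \oo] --> (EFin \o f) x}.
  by apply: aeW => x _; apply/fine_cvgP; split; [exact: nearW|exact: cf].
have fg' : {ae mu, forall x n, setT x -> (`|(EFin \o f_ n) x| <= (EFin \o g) x)%E}.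
  by apply: aeW => x n _; rewrite lee_fin.
by have [_ _] := dominated_convergence measurableT mf_' mf' cf' ig fg'.
Qed.

Section gauss1.
Context (R : realType).
Notation mu := (@lebesgue_measure R).

Definition gauss1 (a m x : R) : R := expR (- (a / 2 * (x - m) ^+ 2)).

Lemma continuous_of_is_derive (f df : R -> R) :
  (forall x : R, is_derive x 1 f (df x)) -> continuous f.
Proof.
move=> H x; apply: differentiable_continuous; apply/derivable1_diffP.
by have [] := H x.
Qed.

Lemma is_derive_gauss1 (a m x : R) :
  is_derive x 1 (gauss1 a m) (- (a * (x - m)) * gauss1 a m x).
Proof.
rewrite /gauss1; apply: is_derive_eq; rewrite /GRing.scale /=.
by field.
Qed.

Lemma measurable_gauss1 (a m : R) : measurable_fun (setT : set R) (gauss1 a m).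
Proof.
apply: continuous_measurable_fun.
exact: (continuous_of_is_derive (is_derive_gauss1 a m)).
Qed.

Lemma integral_gauss1 (a m : R) : 0 < a ->
  (\int[mu]_x (gauss1 a m x)%:E = (Num.sqrt (2 * pi / a))%:E)%E.
Proof.
move=> a0; pose s := Num.sqrt a^-1.
have s0 : 0 < s by rewrite sqrtr_gt0 invr_gt0.
have s2 : s ^+ 2 = a^-1 by rewrite sqr_sqrtr// invr_ge0 ltW.
set k := Num.sqrt (2 * pi / a).
have k0 : 0 < k by rewrite sqrtr_gt0 divr_gt0// mulr_gt0// pi_gt0.
transitivity (\int[mu]_x (k%:E * (normal_pdf m s x)%:E))%E.
  apply: eq_integral => x _; rewrite -EFinM normal_pdfE ?gt_eqF//.
  rewrite /normal_peak /normal_fun s2.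
  have -> : a^-1 * pi *+ 2 = 2 * pi / a by rewrite -mulr_natr; ring.
  rewrite mulrA mulfV ?gt_eqF// mul1r /gauss1; congr (expR _)%:E.
  rewrite -mulr_natr; field; exact: lt0r_neq0.
rewrite integralZl//; last exact: integrable_normal_pdf.
by rewrite integral_normal_pdf mule1.
Qed.

Lemma integrable_gauss1 (a m : R) : 0 < a -> mu.-integrable setT (EFin \o gauss1 a m).
Proof.
move=> a0; apply/integrableP; split.
  by apply/measurable_EFinP; exact: measurable_gauss1.
under eq_integral => x _ do rewrite /= ger0_norm ?expR_ge0//.
by rewrite integral_gauss1// ltry.
Qed.

Lemma Rintegral_gauss1 (a m : R) : 0 < a ->
  \int[mu]_x gauss1 a m x = Num.sqrt (2 * pi / a).
Proof. by move=> a0; rewrite /Rintegral integral_gauss1. Qed.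

Lemma gauss1_le1 (a m x : R) : 0 < a -> gauss1 a m x <= 1.
Proof.
move=> a0; rewrite /gauss1 -expR0 ler_expR oppr_le0 mulr_ge0 ?sqr_ge0//.
by rewrite divr_ge0// ltW.
Qed.

Lemma gauss1_half (a m x : R) : gauss1 a m x = gauss1 (a / 2) m x ^+ 2.
Proof. by rewrite /gauss1 -expRM_natl; congr expR; rewrite -mulr_natl; field. Qed.

(** Half of the exponent absorbs the linear factor: with [y = x - m], [|y| <= 1 + y^2 <= (1 + 4 / a)
    (1 + a y^2 / 4)], and the last factor is at most [expR (a y^2 / 4)]. *)
Lemma norm_gauss1_le (a m x : R) : 0 < a ->
  `|x - m| * gauss1 a m x <= (1 + 4 / a) * gauss1 (a / 2) m x.
Proof.
move=> a0; rewrite gauss1_half expr2 mulrA.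
have g0 : 0 < gauss1 (a / 2) m x by exact: expR_gt0.
rewrite ler_pM2r//.
set y := x - m; rewrite /gauss1 -/y expRN ler_pdivrMr ?expR_gt0//.
have h1 : 1 + a / 2 / 2 * y ^+ 2 <= expR (a / 2 / 2 * y ^+ 2) by exact: expR_ge1Dx.
have h2 : `|y| <= 1 + y ^+ 2.
  rewrite ler_norml; apply/andP; split; nra.
apply: (le_trans h2); apply: (@le_trans _ _ ((1 + 4 / a) * (1 + a / 2 / 2 * y ^+ 2))).
  have -> : (1 + 4 / a) * (1 + a / 2 / 2 * y ^+ 2) =
     1 + y ^+ 2 + 4 / a + a / 4 * y ^+ 2 by field; exact: lt0r_neq0.
  have : 0 <= 4 / a by rewrite divr_ge0// ltW.
  have : 0 <= a / 4 * y ^+ 2 by rewrite mulr_ge0 ?sqr_ge0// divr_ge0// ltW.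
  lra.
by rewrite ler_pM2l// addr_gt0// divr_gt0.
Qed.

(* Dominated convergence on the exhausting intervals [-k, k]. *)
Lemma Rintegral_derive_eq0 (f F : R -> R) : continuous f ->
  (forall x : R, is_derive x 1 F (f x)) -> mu.-integrable setT (EFin \o f) ->
  F x @[x --> +oo] --> (0 : R) -> F (- x) @[x --> +oo] --> (0 : R) ->
  \int[mu]_x f x = 0.
Proof.
move=> cf dF intf Fy FNy.
have cF : continuous F := continuous_of_is_derive dF.
pose g (k : nat) x := (f \_ `[- k.+1%:R, k.+1%:R]) x.
have gE k : (\int[mu]_x (g k x)%:E = (F k.+1%:R - F (- k.+1%:R))%:E)%E.
  have -> : (\int[mu]_x (g k x)%:E =
      \int[mu]_(x in `[(- k.+1%:R)%R, k.+1%:R]) (f x)%:E)%E.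
    rewrite [RHS]integral_mkcond; apply: eq_integral => x _.
    by rewrite /g restrict_EFin.
  rewrite (@continuous_FTC2 _ f F) -?EFinB//.
  - by rewrite -subr_gt0 opprK addr_gt0.
  - by apply: continuous_subspaceT.
  - split.
    + by move=> x _; have [] := dF x.
    + by apply: cvg_at_right_filter; exact: cF.
    + by apply: cvg_at_left_filter; exact: cF.
  - by move=> x _; rewrite derive1E; have [_ ->] := dF x.
have mf : measurable_fun setT (EFin \o f) by have /integrableP[] := intf.
have H := @cvg_integral_dominated _ _ _ mu g f (fun x => `|f x|).
have {}H : (F k.+1%:R - F (- k.+1%:R))%:E @[k --> \oo] --> (\int[mu]_x (f x)%:E)%E.
  under eq_fun do rewrite -gE.
  apply: H.
  - move=> k; apply/(measurable_restrictT _ _).1 => //.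
    by apply: measurable_funTS; apply/measurable_EFinP.
  - move=> x; apply: cvg_near_cst; near=> k; rewrite /g patchE ifT//.
    rewrite inE /= in_itv /= -ler_norml; apply: (@le_trans _ _ k%:R); last by rewrite ler_nat.
    by near: k; exact: nbhs_infty_ger.
  - exact: (integrable_abse intf).
  - by move=> k x; rewrite /g patchE; case: ifP => // _; rewrite normr0.
have H0 : (F k.+1%:R - F (- k.+1%:R))%:E @[k --> \oo] --> (0 : R)%:E.
  apply: cvg_EFin; first by near=> k.
  have cy : k.+1%:R @[k --> \oo] --> (+oo : set_system R).
    by rewrite (cvg_shiftS (fun n : nat => (n%:R : R))); exact: cvgr_idn.
  rewrite -[0 in X in _ --> X](subrr 0); apply: cvgB.
    exact: (cvg_comp _ _ cy Fy).
  exact: (cvg_comp _ _ cy FNy).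
rewrite /Rintegral.
suff -> : (\int[mu]_x (f x)%:E = 0%:E)%E by [].
exact: (cvg_unique _ H H0).
Unshelve. all: by end_near.
Qed.

Lemma cvg_gauss1 (a m : R) : 0 < a -> gauss1 a m x @[x --> +oo] --> (0 : R).
Proof.
move=> a0; rewrite /gauss1.
apply: (cvg_comp (fun x => a / 2 * (x - m) ^+ 2) (fun t => expR (- t)));
  last exact: cvgr_expR.
apply/cvgryPge => A; near=> x.
have xA : m + 1 + 2 * `|A| / a <= x.
    by near: x; apply: nbhs_pinfty_ge; exact: num_real.
have h0 : 0 <= 2 * `|A| / a by rewrite divr_ge0 ?mulr_ge0// ltW.
have h1 : 1 + 2 * `|A| / a <= (x - m) ^+ 2 by nra.
apply: (@le_trans _ _ (a / 2 * (1 + 2 * `|A| / a))).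
  have -> : a / 2 * (1 + 2 * `|A| / a) = a / 2 + `|A| by field; exact: lt0r_neq0.
  by apply: (le_trans (ler_norm A)); rewrite lerDr divr_ge0// ltW.
by rewrite ler_pM2l// divr_gt0.
Unshelve. all: by end_near.
Qed.

Lemma cvg_gauss1_mul (a m : R) (s : R -> R) (K : R) : 0 < a -> (forall x, `|s x| <= K) ->
  gauss1 a m x * s x @[x --> +oo] --> (0 : R).
Proof.
move=> a0 sK; apply: norm_cvg0.
have Hn : \forall x \near +oo, cst 0 x <= `|gauss1 a m x * s x| <= gauss1 a m x * K.
  by near=> x; rewrite normr_ge0 /= normrM ger0_norm ?expR_ge0// ler_wpM2l ?expR_ge0.
apply: (squeeze_cvgr Hn); first exact: cvg_cst.
by rewrite -[0 in X in _ --> X](mul0r K); apply: cvgMl; exact: cvg_gauss1.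
Unshelve. all: by end_near.
Qed.

(** The integrand is the derivative of [gauss1 a m x * sin (be * (x - m) + th)], which vanishes at
    both infinities. This yields the differential equation of the Fourier transform in the frequency
    [be]. *)
Lemma cos_gauss1_ibp (a m be th : R) : 0 < a ->
  \int[mu]_x (- (a * (x - m)) * gauss1 a m x * sin (be * (x - m) + th) +
              be * (gauss1 a m x * cos (be * (x - m) + th))) = 0.
Proof.
move=> a0.
pose F x := gauss1 a m x * sin (be * (x - m) + th).
pose f x := - (a * (x - m)) * gauss1 a m x * sin (be * (x - m) + th) +
              be * (gauss1 a m x * cos (be * (x - m) + th)).
have dF (x : R) : is_derive x 1 F (f x).
  have H := is_derive_gauss1 a m x.
  by rewrite /F /f; apply: is_derive_eq; rewrite /GRing.scale /=; ring.
have cf : continuous f.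
  pose df x := (- a * gauss1 a m x + (a * (x - m)) ^+ 2 * gauss1 a m x) * sin (be * (x - m) + th)
   + 2 * (- (a * (x - m)) * gauss1 a m x * (be * cos (be * (x - m) + th)))
   - be ^+ 2 * (gauss1 a m x * sin (be * (x - m) + th)).
  apply: (@continuous_of_is_derive _ df) => x.
  have H := is_derive_gauss1 a m x.
  by rewrite /f /df; apply: is_derive_eq; rewrite /GRing.scale /=; ring.
apply: (@Rintegral_derive_eq0 f F cf dF).
- have c0 : 0 <= 1 + 4 / a by rewrite addr_ge0// divr_ge0// ltW.
  have a20 : 0 < a / 2 by rewrite divr_gt0.
  have ig : mu.-integrable setT (EFin \o
      (fun x => a * (1 + 4 / a) * gauss1 (a / 2) m x + `|be| * gauss1 a m x)).
    rewrite (_ : _ \o _ = (fun x => (a * (1 + 4 / a))%:E * (EFin \o gauss1 (a / 2) m) x) \+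
      (fun x => `|be|%:E * (EFin \o gauss1 a m) x))%E//.
    by apply: integrableD => //; apply: integrableZl => //; exact: integrable_gauss1.
  apply: le_integrable ig => //.
    by apply/measurable_EFinP; exact: continuous_measurable_fun.
  move=> x _; rewrite lee_fin [leRHS]ger0_norm; last first.
    by rewrite addr_ge0 ?mulr_ge0 ?expR_ge0// ltW.
  rewrite /f (le_trans (ler_normD _ _))// lerD//.
    rewrite !normrM normrN normrM (ger0_norm (ltW a0)) (ger0_norm (expR_ge0 _)).
    apply: (@le_trans _ _ (a * (`|x - m| * gauss1 a m x) * 1)).
      rewrite -/(gauss1 a m x) mulr1 mulrA ler_piMr ?sin_max//.
      by rewrite !mulr_ge0 ?expR_ge0// ltW.
    by rewrite mulr1 -mulrA ler_pM2l//; exact: norm_gauss1_le.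
  rewrite !normrM ler_wpM2l// (ger0_norm (expR_ge0 _)) ler_piMr ?expR_ge0//.
  exact: cos_max.
- by apply: (cvg_gauss1_mul m a0) => x; exact: sin_max.
- have -> : (fun x => F (- x)) = fun x => gauss1 a (- m) x * sin (be * (- x - m) + th).
    apply/funext => x; rewrite /F; congr (_ * _); rewrite /gauss1; congr expR.
    ring.
  by apply: (@cvg_gauss1_mul a (- m) (fun x => sin (be * (- x - m) + th)) 1 a0) => x; exact: sin_max.
Qed.

Lemma integrable_gauss1_mul (a m : R) (s : R -> R) (K : R) : 0 < a ->
  measurable_fun setT s -> (forall x, `|s x| <= K) ->
  mu.-integrable setT (EFin \o (fun x => gauss1 a m x * s x)).
Proof.
move=> a0 ms sK.
have ig : mu.-integrable setT (EFin \o (fun x => K * gauss1 a m x)).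
  by apply: (integrableZl _ _ (integrable_gauss1 m a0)).
apply: le_integrable ig => //.
  by apply/measurable_EFinP; apply: measurable_funM => //; exact: measurable_gauss1.
move=> x _; rewrite lee_fin normrM mulrC [leRHS]normrM ler_wpM2r//.
exact: le_trans (sK x) (ler_norm K).
Qed.

Lemma measurable_trig_affine (be m th : R) :
  measurable_fun (setT : set R) (fun x => cos (be * (x - m) + th)) /\
  measurable_fun (setT : set R) (fun x => sin (be * (x - m) + th)).
Proof.
split; apply: continuous_measurable_fun.
  apply: (@continuous_of_is_derive _ (fun x => - (be * sin (be * (x - m) + th)))) => x.
  by apply: is_derive_eq; rewrite /GRing.scale /=; ring.
apply: (@continuous_of_is_derive _ (fun x => be * cos (be * (x - m) + th))) => x.
by apply: is_derive_eq; rewrite /GRing.scale /=; ring.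
Qed.

(** As a function [F] of the frequency the integral satisfies [F' b = - (b / a) F b], by
    differentiation under the integral and [cos_gauss1_ibp]; hence [F b * expR (b^2 / (2 a))] is
    constant. The phase [th] treats cosine and sine together. *)
Lemma integral_cos_gauss1 (a m be th : R) : 0 < a ->
  \int[mu]_x (gauss1 a m x * cos (be * (x - m) + th)) =
  Num.sqrt (2 * pi / a) * expR (- (be ^+ 2 / (2 * a))) * cos th.
Proof.
move=> a0.
pose f (b x : R) := gauss1 a m x * cos (b * (x - m) + th).
pose F b := \int[mu]_x f b x.
pose G x := (1 + 4 / a) * gauss1 (a / 2) m x.
have a20 : 0 < a / 2 by rewrite divr_gt0.
have c0 : 0 <= 1 + 4 / a by rewrite addr_ge0// divr_ge0// ltW.
have if_ b : mu.-integrable setT (EFin \o f b).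
  apply: (@integrable_gauss1_mul a m _ 1) => //.
    by have [] := measurable_trig_affine b m th.
  by move=> x; exact: cos_max.
have df (x b : R) : is_derive b 1 (f^~ x) (- (x - m) * gauss1 a m x * sin (b * (x - m) + th)).
  by rewrite /f; apply: is_derive_eq; rewrite /GRing.scale /=; ring.
have pE (b x : R) : partial1of2 f b x = - (x - m) * gauss1 a m x * sin (b * (x - m) + th).
  by rewrite partial1of2E; have [_ ->] := df x b.
have dF (b : R) : is_derive b 1 F (- (b / a) * F b).
  (* The majorant [G] does not depend on the frequency, so any neighbourhood of [b] will do. *)
  have Ib : `]b - 1, b + 1[%classic b by rewrite /= in_itv /= gtrBl ltr01 ltrDl ltr01.
  have intf (x : R) : `]b - 1, b + 1[%classic x -> mu.-integrable setT (EFin \o f x) by [].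
  have d1 (x y : R) : `]b - 1, b + 1[%classic x -> setT y -> derivable (f^~ y) x 1.
    by move=> _ _; have [] := df y x.
  have G0 y : 0 <= G y by rewrite mulr_ge0 ?expR_ge0.
  have iG : mu.-integrable setT (EFin \o G).
    by apply: (integrableZl _ _ (integrable_gauss1 m a20)).
  have Gub (x y : R) : `]b - 1, b + 1[%classic x -> setT y -> `|partial1of2 f x y| <= G y.
    move=> _ _; rewrite pE !normrM normrN (ger0_norm (expR_ge0 _)).
    apply: (@le_trans _ _ (`|y - m| * gauss1 a m y)); last exact: norm_gauss1_le.
    by rewrite ler_piMr ?sin_max// mulr_ge0 ?expR_ge0.
  have D1 := @derivable_under_integral _ _ _ mu f setT measurableT b _ _ Ib intf d1 G G0 iG Gub.
  have D2 := @differentiation_under_integral _ _ _ mu f setT measurableT b _ _ Ib intf d1 G G0 iG Gub.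
  split; first exact: D1.
  rewrite -derive1E D2.
  have H := cos_gauss1_ibp m b th a0.
  have i1 : mu.-integrable setT (EFin \o (fun x => partial1of2 f b x)).
    apply: le_integrable iG => //.
      apply/measurable_EFinP; under eq_fun do rewrite pE.
      apply: measurable_funM; last by have [] := measurable_trig_affine b m th.
      apply: measurable_funM; last exact: measurable_gauss1.
      by apply: measurableT_comp => //; apply: measurable_funB.
    by move=> x _; rewrite lee_fin [leRHS]ger0_norm//; apply: Gub.
  have : \int[mu]_x (a * partial1of2 f b x + b * f b x) = 0.
    rewrite -[RHS]H; apply: eq_Rintegral => x _; rewrite pE /f; ring.
  rewrite RintegralD//; last 2 first.
  - exact: (integrableZl _ _ i1).
  - exact: (integrableZl _ _ (if_ b)).
  rewrite !RintegralZl// -/(F b) => E.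
  apply: (mulfI (lt0r_neq0 a0)).
  have -> : a * (- (b / a) * F b) = - (b * F b) by field; exact: lt0r_neq0.
  by apply/eqP; rewrite -addr_eq0 E.
pose H b := F b * expR (b ^+ 2 / (2 * a)).
have dH (b : R) : is_derive b 1 H 0.
  have D := dF b; rewrite /H; apply: is_derive_eq; rewrite /GRing.scale /=.
  by field; exact: lt0r_neq0.
have HE : H be = H 0.
  have := is_derive_0_is_cst (f := H).
  by apply => x; exact: dH.
have F0 : F 0 = Num.sqrt (2 * pi / a) * cos th.
  rewrite /F /f; under eq_Rintegral do rewrite mul0r add0r mulrC.
  rewrite RintegralZl//; last exact: integrable_gauss1.
  by rewrite Rintegral_gauss1// mulrC.
move: HE; rewrite /H expr0n /= mul0r expR0 mulr1 F0 -/(f be) -/(F be) => E.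
rewrite mulrAC -E -mulrA -expRD subrr expR0 mulr1//.
Qed.

End gauss1.

(** * Fubini along the first coordinate *)

Section pushforward_cons_fubini.
Context (R : realType) (n : nat).
Notation mu := (@lebesgue_measure R).
Context (m2 : {sigma_finite_measure set 'rV[R]_n -> \bar R}).
Notation push := (pushforward (mu \x m2)%E (@rV_cons R n)).

Lemma measurable_rV_cons' :
  measurable_fun [set: measurableTypeR R * 'rV[R]_n] (@rV_cons R n).
Proof. exact: measurable_rV_cons. Qed.

(** Stated for any sigma-finite measure on the remaining coordinates: [lebesgue_rV R n.+1] unfolds
    to such a pushforward, so the specialisation below is by conversion. *)
Lemma ge0_integral_push_cons (f : 'rV[R]_n.+1 -> \bar R) :
  measurable_fun setT f -> (forall x, 0 <= f x)%E ->
  (\int[push]_x f x = \int[m2]_y \int[mu]_x f (rV_cons (x, y)))%E.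
Proof.
move=> mf f0.
rewrite (ge0_integral_pushforward measurable_rV_cons')// preimage_setT.
rewrite fubini_tonelli2//; last by move=> p; exact: f0.
by apply: measurableT_comp => //; exact: measurable_rV_cons'.
Qed.

Lemma integrable_push_cons (f : 'rV[R]_n.+1 -> \bar R) :
  push.-integrable setT f -> (mu \x m2)%E.-integrable setT (f \o @rV_cons R n).
Proof.
move=> /integrableP[mf fi]; apply/integrableP; split.
  by apply: measurableT_comp => //; exact: measurable_rV_cons'.
apply: le_lt_trans fi.
rewrite (ge0_integral_pushforward measurable_rV_cons')//.
exact: measurableT_comp.
Qed.

Lemma integral_push_cons (f : 'rV[R]_n.+1 -> \bar R) : push.-integrable setT f ->
  (\int[push]_x f x = \int[m2]_y \int[mu]_x f (rV_cons (x, y)))%E.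
Proof.
move=> fi; have fi' := integrable_push_cons fi.
rewrite (integral_pushforward measurable_rV_cons')//; last first.
  by have /integrableP[] := fi.
by rewrite preimage_setT -integral21_prod_meas1.
Qed.

Lemma integral_push_cons_swap (f : 'rV[R]_n.+1 -> \bar R) : push.-integrable setT f ->
  (\int[push]_x f x = \int[mu]_x \int[m2]_y f (rV_cons (x, y)))%E.
Proof.
move=> fi; rewrite integral_push_cons//.
by rewrite (Fubini (integrable_push_cons fi)).
Qed.

End pushforward_cons_fubini.

Section lebesgue_rV_fubini.
Context (R : realType) (n : nat).
Notation L := (@lebesgue_rV R).
Notation mu := (@lebesgue_measure R).

Lemma ge0_integral_rV_cons (f : 'rV[R]_n.+1 -> \bar R) :
  measurable_fun setT f -> (forall x, 0 <= f x)%E ->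
  (\int[L n.+1]_x f x = \int[L n]_y \int[mu]_x f (rV_cons (x, y)))%E.
Proof. exact: (@ge0_integral_push_cons R n (L n) f). Qed.

Lemma integral_rV_cons (f : 'rV[R]_n.+1 -> \bar R) : (L n.+1).-integrable setT f ->
  (\int[L n.+1]_x f x = \int[L n]_y \int[mu]_x f (rV_cons (x, y)))%E.
Proof. exact: (@integral_push_cons R n (L n) f). Qed.

Lemma integral_rV_cons_swap (f : 'rV[R]_n.+1 -> \bar R) : (L n.+1).-integrable setT f ->
  (\int[L n.+1]_x f x = \int[mu]_x \int[L n]_y f (rV_cons (x, y)))%E.
Proof. exact: (@integral_push_cons_swap R n (L n) f). Qed.

End lebesgue_rV_fubini.

Lemma measurable_mulmx_rV (R : realType) n (P : 'M[R]_n) (c : 'rV[R]_n) :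
  measurable_fun setT (fun x : 'rV[R]_n => (c *m P *m x^T) 0 0).
Proof.
rewrite (_ : (fun x => _) = fun x => \sum_i (c *m P) 0 i * rV_coord i x); last first.
  by apply/funext => x; rewrite mxE; apply: eq_bigr => i _; rewrite [x^T _ _]mxE.
apply: measurable_sum => i; apply: measurable_funM => //.
exact: measurable_rV_coord.
Qed.

(** * Quadratic forms and Schur complements *)

Definition qform (R : realType) n (P : 'M[R]_n) (x y : 'rV[R]_n) : R :=
  (x *m P *m y^T) 0 0.

Definition posdefmx (R : realType) n (P : 'M[R]_n) : Prop :=
  P^T = P /\ forall x : 'rV[R]_n, x != 0 -> 0 < qform P x x.

Section qform.
Context (R : realType) (n : nat).
Implicit Types (P : 'M[R]_n) (x y z : 'rV[R]_n).

Lemma qformE P x y : qform P x y = \sum_i \sum_j P i j * (x 0 i * y 0 j).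
Proof.
rewrite /qform mxE exchange_big; apply: eq_bigr => j _.
by rewrite !mxE mulr_suml; apply: eq_bigr => i _; ring.
Qed.

Lemma qformDl P x y z : qform P (x + y) z = qform P x z + qform P y z.
Proof. by rewrite /qform !mulmxDl mxE. Qed.

Lemma qformZl P a x y : qform P (a *: x) y = a * qform P x y.
Proof. by rewrite /qform -!scalemxAl mxE. Qed.

Lemma qform0l P y : qform P 0 y = 0.
Proof. by rewrite /qform !mul0mx mxE. Qed.

Lemma qformC P x y : P^T = P -> qform P x y = qform P y x.
Proof.
move=> Ps; rewrite /qform.
have -> : x *m P *m y^T = (y *m P *m x^T)^T by rewrite !trmx_mul trmxK Ps mulmxA.
by rewrite mxE.
Qed.

Lemma qformDr P x y z : qform P x (y + z) = qform P x y + qform P x z.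
Proof. by rewrite /qform linearD mulmxDr mxE. Qed.

Lemma qformZr P a x y : qform P x (a *: y) = a * qform P x y.
Proof. by rewrite /qform linearZ /= -scalemxAr mxE. Qed.

Lemma qform0r P y : qform P y 0 = 0.
Proof. by rewrite /qform trmx0 mulmx0 mxE. Qed.

Lemma posdef_qform_ge0 P x : posdefmx P -> 0 <= qform P x x.
Proof.
move=> [_ Pp]; have [->|xn0] := eqVneq x 0; first by rewrite qform0l.
exact/ltW/Pp.
Qed.

Lemma qform_CS P x y : posdefmx P -> qform P x y ^+ 2 <= qform P x x * qform P y y.
Proof.
move=> Pp; have [->|yn0] := eqVneq y 0; first by rewrite !qform0r mulr0 expr0n.
have y0 := Pp.2 _ yn0.
(* Positivity at [<y, y> x - <x, y> y]; its expansion is [<y, y>] times the difference of the two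
   sides. *)
have := posdef_qform_ge0 (qform P y y *: x + (- qform P x y) *: y) Pp.
rewrite !(qformDl, qformDr, qformZl, qformZr) (qformC y x Pp.1).
set a := qform P y y in y0 *; set b := qform P x y; set c := qform P x x => H.
have : 0 <= a * (c * a - b ^+ 2).
  by apply: le_trans H _; rewrite le_eqVlt; apply/orP; left; apply/eqP; ring.
by rewrite pmulr_rge0// subr_ge0.
Qed.

End qform.

Section schur_complement.
Context (R : realType) (n : nat) (P : 'M[R]_(1 + n)).
Hypothesis Pp : posdefmx P.

Definition schur_pivot : R := P 0 0.
Definition schur_row : 'rV[R]_n := ursubmx P.
Definition schur_compl : 'M[R]_n :=
  drsubmx P - schur_pivot^-1 *: (schur_row^T *m schur_row).
Definition schur_shift (y : 'rV[R]_n) : R := schur_pivot^-1 * (schur_row *m y^T) 0 0.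

Let a := schur_pivot.
Let v := schur_row.
Let S := schur_compl.

Lemma schur_block : P = block_mx a%:M v v^T (drsubmx P).
Proof.
rewrite -[LHS]submxK; congr block_mx.
  apply/matrixP => i j; rewrite !ord1 !mxE eqxx mulr1n /a /schur_pivot.
  by congr (P _ _); exact: val_inj.
by rewrite /v /schur_row trmx_ursub (Pp.1).
Qed.

(** Completing the square in the first coordinate: [schur_shift] is the shift that removes the mixed
    terms, and [schur_compl] is the form left on the other coordinates. The bilinear version serves
    both quadratic forms and frequencies. *)
Lemma schur_qform (c0 x0 : R) (c x : 'rV[R]_n) : a != 0 ->
  qform P (rV_cons (c0, c)) (rV_cons (x0, x)) =
  a * (c0 + schur_shift c) * (x0 + schur_shift x) + qform S c x.
Proof.
move=> a0; rewrite /qform {1}schur_block /rV_cons /= mul_row_block tr_row_mx mul_row_col.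
rewrite /S /schur_compl -/a -/v /schur_shift -/a -/v.
rewrite -(scalemx1 1 c0) -(scalemx1 1 x0) -(scalemx1 1 a).
have -> : (x0 *: 1%:M : 'M[R]_1)^T = x0 *: 1%:M by rewrite linearZ /= trmx1.
rewrite mulmxBr mulmxBl !mulmxDl -!scalemxAl -!scalemxAr !mulmx1 !mul1mx.
rewrite -!scalemxAl ?mul1mx.
have mD (A C : 'M[R]_1) : (A + C) 0 0 = A 0 0 + C 0 0 by rewrite !mxE.
have mN (A : 'M[R]_1) : (- A) 0 0 = - A 0 0 by rewrite !mxE.
have zE (b : R) (A : 'M[R]_1) : (b *: A) 0 0 = b * A 0 0 by rewrite mxE.
have -> : c *m v^T = ((v *m c^T) 0 0) *: (1%:M : 'M[R]_1).
  rewrite scalemx1; apply/matrixP => i j; rewrite !ord1 [RHS]mxE eqxx mulr1n.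
  by rewrite !mxE; apply: eq_bigr => k _; rewrite !mxE mulrC.
have -> : c *m (v^T *m v) *m x^T = ((v *m c^T) 0 0 * (v *m x^T) 0 0) *: (1%:M : 'M[R]_1).
  rewrite mulmxA -mulmxA.
  have -> : c *m v^T = ((v *m c^T) 0 0) *: (1%:M : 'M[R]_1).
    rewrite scalemx1; apply/matrixP => i j; rewrite !ord1 [RHS]mxE eqxx mulr1n.
    by rewrite !mxE; apply: eq_bigr => k _; rewrite !mxE mulrC.
  rewrite -scalemxAl mul1mx -scalerA; congr (_ *: _).
  by rewrite scalemx1; apply/matrixP => i j; rewrite !ord1 [RHS]mxE eqxx mulr1n.
rewrite !(mD, mN, zE) mxE eqxx /=.
by field.
Qed.

Lemma schur_pivot_gt0 : 0 < a.
Proof.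
have -> : a = qform P (delta_mx 0 0) (delta_mx 0 0).
  by rewrite /qform -rowE trmx_delta -colE !mxE.
apply: Pp.2; apply/eqP => /matrixP /(_ 0 0); rewrite !mxE !eqxx.
by move/eqP; rewrite oner_eq0.
Qed.

Lemma schur_compl_posdef : posdefmx S.
Proof.
have a0 := schur_pivot_gt0.
split.
  rewrite /S /schur_compl linearB linearZ /= trmx_mul trmxK; congr (_ - _).
  by rewrite trmx_drsub (Pp.1).
move=> x xn0.
(* The first coordinate [- schur_shift x] annihilates the square and leaves the complement. *)
have E := schur_qform (- schur_shift x) (- schur_shift x) x x (lt0r_neq0 a0).
rewrite addNr mulr0 add0r in E; rewrite -E; apply: Pp.2.
apply: contraNneq xn0 => x0; apply/eqP/rowP => i.
by rewrite -(rV_consS (- schur_shift x, x)) x0 !mxE.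
Qed.

(** Elimination by a unit lower triangular block matrix, of determinant 1, makes [P] block upper
    triangular. *)
Lemma schur_det : \det P = a * \det S.
Proof.
have a0 := schur_pivot_gt0.
pose L : 'M[R]_(1 + n) := block_mx 1%:M 0 (- (a^-1 *: v^T)) 1%:M.
have detL : \det L = 1 by rewrite det_lblock !det1 mulr1.
have -> : \det P = \det (L *m P) by rewrite det_mulmx detL mul1r.
have -> : L *m P = block_mx a%:M v 0 S.
  rewrite [in LHS]schur_block mulmx_block !mul1mx !mul0mx !addr0; congr block_mx.
    rewrite mul_mx_scalar scalerN scalerA mulfV ?lt0r_neq0// scale1r.
    by rewrite addNr.
  by rewrite mulNmx -scalemxAl addrC.
by rewrite det_ublock det_scalar1.
Qed.

End schur_complement.

(** * Gaussian integrals in several variables *)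

Section gaussian_integral.
Context (R : realType).
Notation L := (@lebesgue_rV R).
Notation mu := (@lebesgue_measure R).

Definition gaussn n (P : 'M[R]_n) (x : 'rV[R]_n) : R := expR (- 2^-1 * qform P x x).

Lemma measurable_qform n (P : 'M[R]_n) (c : 'rV[R]_n) :
  measurable_fun setT (qform P c).
Proof. exact: measurable_mulmx_rV. Qed.

Lemma measurable_qform_diag n (P : 'M[R]_n) :
  measurable_fun setT (fun x : 'rV[R]_n => qform P x x).
Proof.
under eq_fun do rewrite qformE.
apply: measurable_sum => i; apply: measurable_sum => j.
apply: measurable_funM => //.
by apply: measurable_funM; exact: measurable_rV_coord.
Qed.

Lemma measurable_gaussn n (P : 'M[R]_n) : measurable_fun setT (gaussn P).
Proof.
apply: measurableT_comp => //; apply: measurable_funM => //.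
exact: measurable_qform_diag.
Qed.

Lemma measurable_cos_qform n (P : 'M[R]_n) (c : 'rV[R]_n) (th : R) :
  measurable_fun setT (fun x : 'rV[R]_n => cos (qform P c x + th)).
Proof.
have mc : measurable_fun (setT : set R) (@cos R).
  by apply: continuous_measurable_fun; exact: continuous_cos.
have mq : measurable_fun setT (fun x => qform P c x + th).
  by apply: measurable_funD => //; exact: measurable_qform.
exact: (measurableT_comp mc mq).
Qed.

Lemma det_posdef_gt0 n (P : 'M[R]_n) : posdefmx P -> 0 < \det P.
Proof.
elim: n P => [|n IH] P Pp; first by rewrite det_mx00.
rewrite (@schur_det R n P Pp) mulr_gt0//; first exact: (@schur_pivot_gt0 R n P).
exact/IH/(@schur_compl_posdef R n P).
Qed.

Lemma gaussn_cons n (P : 'M[R]_n.+1) (x : R) (y : 'rV[R]_n) : posdefmx P ->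
  gaussn P (rV_cons (x, y)) =
  gaussn (schur_compl (P : 'M[R]_(1 + n))) y *
  gauss1 (schur_pivot (P : 'M[R]_(1 + n))) (- schur_shift (P : 'M[R]_(1 + n)) y) x.
Proof.
move=> Pp; rewrite /gaussn (@schur_qform R n P Pp) ?(lt0r_neq0 (schur_pivot_gt0 Pp))//.
rewrite /gauss1 -expRD; congr expR; rewrite opprK; by field.
Qed.

Lemma integral_gaussn n (P : 'M[R]_n) : posdefmx P ->
  (\int[L n]_x (gaussn P x)%:E = (Num.sqrt ((2 * pi) ^+ n / \det P))%:E)%E.
Proof.
elim: n P => [|n IH] P Pp.
  rewrite /= integral_dirac//; last by apply/measurable_EFinP; exact: measurable_gaussn.
  rewrite diracE in_setT mul1e det_mx00 divr1 expr0 sqrtr1.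
  by rewrite /gaussn qform0l mulr0 expR0.
have a0 := @schur_pivot_gt0 R n P Pp.
have Sp := @schur_compl_posdef R n P Pp.
rewrite ge0_integral_rV_cons; last 2 first.
- by apply/measurable_EFinP; exact: measurable_gaussn.
- by move=> x; rewrite lee_fin expR_ge0.
transitivity (\int[L n]_y ((Num.sqrt (2 * pi / schur_pivot (P : 'M[R]_(1 + n))))%:E *
    (gaussn (schur_compl (P : 'M[R]_(1 + n))) y)%:E))%E.
  apply: eq_integral => y _.
  under eq_integral => x _ do rewrite gaussn_cons// EFinM.
  rewrite integralZl//; last exact: integrable_gauss1.
  by rewrite integral_gauss1// muleC.
rewrite ge0_integralZl//; last 2 first.
- by apply/measurable_EFinP; exact: measurable_gaussn.
- by move=> x _; rewrite lee_fin expR_ge0.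
rewrite IH// -EFinM -sqrtrM; last by rewrite divr_ge0 ?mulr_ge0 ?pi_ge0// ltW.
congr (Num.sqrt _)%:E; rewrite (@schur_det R n P Pp) exprS.
have d0 := det_posdef_gt0 Sp.
by field; rewrite !lt0r_neq0.
Qed.

Lemma integrable_gaussn n (P : 'M[R]_n) : posdefmx P ->
  (L n).-integrable setT (EFin \o gaussn P).
Proof.
move=> Pp; apply/integrableP; split.
  by apply/measurable_EFinP; exact: measurable_gaussn.
under eq_integral => x _ do rewrite /= ger0_norm ?expR_ge0//.
by rewrite integral_gaussn// ltry.
Qed.

Lemma integrable_gaussn_mul n (P : 'M[R]_n) (s : 'rV[R]_n -> R) (K : R) : posdefmx P ->
  measurable_fun setT s -> (forall x, `|s x| <= K) ->
  (L n).-integrable setT (EFin \o (fun x => gaussn P x * s x)).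
Proof.
move=> Pp ms sK.
have ig : (L n).-integrable setT (EFin \o (fun x => K * gaussn P x)).
  by apply: (integrableZl _ _ (integrable_gaussn Pp)).
apply: le_integrable ig => //.
  by apply/measurable_EFinP; apply: measurable_funM => //; exact: measurable_gaussn.
move=> x _; rewrite lee_fin normrM mulrC [leRHS]normrM ler_wpM2r//.
exact: le_trans (sK x) (ler_norm K).
Qed.

(** Writing the frequency as [P c] keeps the recursion on Schur complements closed: the integral in
    the first coordinate is one-dimensional of frequency [a * (c0 + sh c')], and the remainder
    [qform S c' y + th] enters as its phase, ready for the induction hypothesis. *)
Lemma integral_cos_gaussn n (P : 'M[R]_n) (c : 'rV[R]_n) (th : R) : posdefmx P ->
  \int[L n]_x (gaussn P x * cos (qform P c x + th)) =
  Num.sqrt ((2 * pi) ^+ n / \det P) * expR (- 2^-1 * qform P c c) * cos th.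
Proof.
elim: n P c th => [|n IH] P c th Pp.
  have m0 : measurable_fun setT (EFin \o (fun x : 'rV[R]_0 => gaussn P x * cos (qform P c x + th))).
    apply/measurable_EFinP; apply: measurable_funM; first exact: measurable_gaussn.
    exact: measurable_cos_qform.
  rewrite /Rintegral /= integral_dirac// diracE in_setT mul1e /=.
  rewrite det_mx00 divr1 expr0 sqrtr1 /gaussn (thinmx0 c).
  by rewrite !qform0l !mulr0 expR0 add0r !mul1r.
have a0 := @schur_pivot_gt0 R n P Pp.
have Sp := @schur_compl_posdef R n P Pp.
set a := schur_pivot (P : 'M[R]_(1 + n)) in a0 *.
set S := schur_compl (P : 'M[R]_(1 + n)) in Sp *.
have [c0 [c' ->]] : exists c0 c', c = rV_cons (c0, c').
  by exists (rV_uncons c).1, (rV_uncons c).2; rewrite -surjective_pairing rV_unconsK.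
pose sh := schur_shift (P : 'M[R]_(1 + n)).
have ifu : (L n.+1).-integrable setT
    (EFin \o (fun x => gaussn P x * cos (qform P (rV_cons (c0, c')) x + th))).
  apply: (@integrable_gaussn_mul _ _ _ 1) => //; last by move=> x; exact: cos_max.
  exact: measurable_cos_qform.
rewrite /Rintegral integral_rV_cons//=.
pose k := Num.sqrt (2 * pi / a) * expR (- ((a * (c0 + sh c')) ^+ 2 / (2 * a))).
transitivity (\int[L n]_y (k * (gaussn S y * cos (qform S c' y + th)))).
  rewrite /Rintegral; congr fine; apply: eq_integral => y _.
  have E x : gaussn P (rV_cons (x, y)) * cos (qform P (rV_cons (c0, c')) (rV_cons (x, y)) + th)
     = gaussn S y * (gauss1 a (- sh y) x *
         cos (a * (c0 + sh c') * (x - - sh y) + (qform S c' y + th))).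
    rewrite gaussn_cons// -/S -/a -/sh mulrA; congr (_ * _); congr cos.
    by rewrite (@schur_qform R n P Pp) ?lt0r_neq0// -/S -/a -/sh opprK addrA.
  have ig : mu.-integrable setT (EFin \o (fun x => gauss1 a (- sh y) x *
         cos (a * (c0 + sh c') * (x - - sh y) + (qform S c' y + th)))).
    apply: (@integrable_gauss1_mul _ _ _ _ 1) => //; last by move=> x; exact: cos_max.
    by have [] := measurable_trig_affine (a * (c0 + sh c')) (- sh y) (qform S c' y + th).
  under eq_integral => x _ do rewrite E EFinM.
  rewrite integralZl//.
  have := @integral_cos_gauss1 R a (- sh y) (a * (c0 + sh c')) (qform S c' y + th) a0.
  rewrite /Rintegral => H.
  rewrite -[X in (_ * X)%E]fineK; last exact: integrable_fin_num.
  by rewrite H -EFinM; congr EFin; rewrite /k; ring.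
rewrite RintegralZl//; last first.
  apply: (@integrable_gaussn_mul _ _ _ 1) => //; last by move=> x; exact: cos_max.
  exact: measurable_cos_qform.
rewrite IH// (@schur_qform R n P Pp) ?lt0r_neq0// -/S -/a -/sh /k.
rewrite (@schur_det R n P Pp) -/S -/a [(2 * pi) ^+ n.+1]exprS.
have d0 := det_posdef_gt0 Sp.
have -> : 2 * pi * (2 * pi) ^+ n / (a * \det S) =
   (2 * pi / a) * ((2 * pi) ^+ n / \det S) by field; rewrite !lt0r_neq0.
rewrite (@sqrtrM _ (2 * pi / a)); last by rewrite divr_ge0 ?mulr_ge0 ?pi_ge0// ltW.
rewrite [- 2^-1 * (_ + qform _ _ _)]mulrDr expRD.
have -> : - 2^-1 * (a * (c0 + sh c') * (c0 + sh c')) = - ((a * (c0 + sh c')) ^+ 2 / (2 * a)).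
  by field; exact: lt0r_neq0.
ring.
Qed.

End gaussian_integral.

(** * The weighted L2 space *)

Section normc_facts.
Context (R : realType).
Implicit Types z u : R[i].

Lemma normc_sqE z : Normc.normc z ^+ 2 = complex.Re z ^+ 2 + complex.Im z ^+ 2.
Proof. by case: z => a b /=; rewrite sqr_sqrtr// addr_ge0 ?sqr_ge0. Qed.

Lemma normc_ge0 z : 0 <= Normc.normc z.
Proof. by case: z => a b /=; exact: sqrtr_ge0. Qed.

Lemma Re_le_normc z : `|complex.Re z| <= Normc.normc z.
Proof.
rewrite -ler_sqr ?nnegrE ?normc_ge0// normc_sqE real_normK ?num_real//.
by rewrite lerDl sqr_ge0.
Qed.

Lemma Im_le_normc z : `|complex.Im z| <= Normc.normc z.
Proof.
rewrite -ler_sqr ?nnegrE ?normc_ge0// normc_sqE real_normK ?num_real//.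
by rewrite lerDr sqr_ge0.
Qed.

Lemma ReD z u : complex.Re (z + u) = complex.Re z + complex.Re u.
Proof. by case: z => ? ?; case: u. Qed.

Lemma ImD z u : complex.Im (z + u) = complex.Im z + complex.Im u.
Proof. by case: z => ? ?; case: u. Qed.

Lemma ReB z u : complex.Re (z - u) = complex.Re z - complex.Re u.
Proof. by case: z => ? ?; case: u. Qed.

Lemma ImB z u : complex.Im (z - u) = complex.Im z - complex.Im u.
Proof. by case: z => ? ?; case: u. Qed.

(** Young's form of the triangle inequality is linear in the two squares, so it can be integrated as
    it stands; [sq_le_of_young] then recovers the triangle inequality for the norm. *)
Lemma normcD_sq_le z u (a : R) : 0 < a -> Normc.normc (z + u) ^+ 2 <=
  (1 + a) * Normc.normc z ^+ 2 + (1 + a^-1) * Normc.normc u ^+ 2.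
Proof.
move=> a0; rewrite !normc_sqE ReD ImD.
have key (x y : R) : (x + y) ^+ 2 <= (1 + a) * x ^+ 2 + (1 + a^-1) * y ^+ 2.
  have : 0 <= a^-1 * (a * x - y) ^+ 2 by rewrite mulr_ge0 ?sqr_ge0// invr_ge0 ltW.
  have -> : a^-1 * (a * x - y) ^+ 2 = a * x ^+ 2 - 2 * x * y + a^-1 * y ^+ 2.
    by field; exact: lt0r_neq0.
  lra.
by have := key (complex.Re z) (complex.Re u); have := key (complex.Im z) (complex.Im u); lra.
Qed.

Lemma normc_real (a : R) : Normc.normc a%:C%C = `|a|.
Proof. by rewrite /Normc.normc /= expr0n addr0 sqrtr_sqr. Qed.

(* The infimum over a of (1 + a) x^2 + (1 + 1/a) y^2 is (x + y)^2. *)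
Lemma sq_le_of_young (x y z : R) : 0 <= x -> 0 <= y -> 0 <= z ->
  (forall a, 0 < a -> z ^+ 2 <= (1 + a) * x ^+ 2 + (1 + a^-1) * y ^+ 2) ->
  z <= x + y.
Proof.
move=> x0 y0 z0 H; apply/ler_addgt0Pr => e e0.
rewrite -ler_sqr ?nnegrE ?addr_ge0// ?(ltW e0)//.
(* Both lengths are enlarged by [e / 2] so that the optimal weight [y' / x'] is defined and positive
   even when one of them is 0. *)
pose x' := x + e / 2; pose y' := y + e / 2.
have e2 : 0 < e / 2 by rewrite divr_gt0.
have x'0 : 0 < x' by rewrite ltr_wpDl.
have y'0 : 0 < y' by rewrite ltr_wpDl.
have xx : x ^+ 2 <= x' ^+ 2 by rewrite lerXn2r ?nnegrE ?(ltW x'0)// lerDl ltW.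
have yy : y ^+ 2 <= y' ^+ 2 by rewrite lerXn2r ?nnegrE ?(ltW y'0)// lerDl ltW.
have a0 : 0 < y' / x' by rewrite divr_gt0.
apply: le_trans (H _ a0) _.
apply: (@le_trans _ _ ((1 + y' / x') * x' ^+ 2 + (1 + (y' / x')^-1) * y' ^+ 2)).
  apply: lerD.
    by rewrite ler_pM2l// ltr_wpDl.
  by rewrite ler_pM2l// ltr_wpDl// invr_gt0.
have -> : (1 + y' / x') * x' ^+ 2 + (1 + (y' / x')^-1) * y' ^+ 2 = (x' + y') ^+ 2.
  by field; rewrite !lt0r_neq0.
rewrite le_eqVlt; apply/orP; left; apply/eqP; congr (_ ^+ 2); rewrite /x' /y'; by field.
Qed.

Lemma geometric_half_cvg (a : nat -> R) (K : R) : 0 <= K ->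
  (forall k, `|a k| <= K * 2^-1 ^+ k) ->
  exists l, (\sum_(k < m) a k) @[m --> \oo] --> l /\
    forall n, `|l - \sum_(k < n) a k| <= 2 * K * 2^-1 ^+ n.
Proof.
move=> K0 aK.
have tail n m : `|\sum_(k < n + m) a k - \sum_(k < n) a k| <= 2 * K * (2^-1 ^+ n - 2^-1 ^+ (n + m)).
  elim: m => [|m IH]; first by rewrite addn0 !subrr normr0 mulr0.
  rewrite addnS big_ord_recr /= addrAC (le_trans (ler_normD _ _))//.
  by have := aK (n + m)%N; rewrite exprS; lra.
have cv : cvgn (series a).
  apply: normed_cvg => /=.
  apply: (@series_le_cvg _ _ (fun k => K * 2^-1 ^+ k)) => //.
  - by move=> k /=.
  - by move=> k; rewrite mulr_ge0// exprn_ge0// invr_ge0.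
  - apply: (@is_cvg_geometric_series R K 2^-1).
    by rewrite ger0_norm ?invr_ge0// invf_lt1// ltr1n.
have /cvg_ex[/= l Hl] := cv.
have {}Hl : (\sum_(k < m) a k) @[m --> \oo] --> l.
  by move: Hl; rewrite /series /=; under eq_fun do rewrite big_mkord.
exists l; split => // n; apply/ler_addgt0Pr => e e0.
move/cvgrPdist_le : Hl => /(_ e e0) [M _ HM].
have := HM (n + M)%N (leq_addl _ _); rewrite /= => h1.
have h2 := tail n M.
have -> : l - \sum_(k < n) a k =
  (l - \sum_(k < n + M) a k) + (\sum_(k < n + M) a k - \sum_(k < n) a k).
  by rewrite addrA subrK.
rewrite (le_trans (ler_normD _ _))//.
have p0 : 0 <= 2 * K * 2^-1 ^+ (n + M) by rewrite !mulr_ge0// exprn_ge0// invr_ge0.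
lra.
Qed.

End normc_facts.

Section weighted_L2.
Context (R : realType) (n : nat) (w : 'rV[R]_n -> R).
Hypothesis w_gt0 : forall x, 0 < w x.
Hypothesis mw : measurable_fun setT w.
Notation L := (lebesgue_rV R n).
Implicit Types f g : 'rV[R]_n -> R[i].

(** [fine] sends an infinite square norm to 0, so the value is meaningful on [inL2] only. *)
Definition normL2 f : R := Num.sqrt (fine (sqnormL2 w f)).

Lemma cmeasurableD f g : cmeasurable f -> cmeasurable g -> cmeasurable (f + g).
Proof.
move=> [f1 f2] [g1 g2]; split.
  by under eq_fun do rewrite ReD; exact: measurable_funD.
by under eq_fun do rewrite ImD; exact: measurable_funD.
Qed.

Lemma cmeasurableZ a f : cmeasurable f -> cmeasurable (a *: f).
Proof.
move=> [f1 f2]; split.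
  under eq_fun do rewrite [complex.Re _]ReM.
  by apply: measurable_funB; apply: measurable_funM.
under eq_fun do rewrite [complex.Im _]ImM.
by apply: measurable_funD; apply: measurable_funM.
Qed.

Lemma measurable_normc_sq f : cmeasurable f ->
  measurable_fun setT (fun x => Normc.normc (f x) ^+ 2).
Proof.
move=> [f1 f2]; under eq_fun do rewrite normc_sqE.
by apply: measurable_funD; exact: measurable_funX.
Qed.

Lemma measurable_invw : measurable_fun setT (fun x => (w x)^-1).
Proof.
rewrite (_ : (fun x => (w x)^-1) = fun x => (w x) `^ (-1)).
  exact: (measurableT_comp (@measurable_powR R (-1)) mw).
by apply/funext => x; rewrite powR_inv1// ltW.
Qed.

Lemma measurable_sqintR f : cmeasurable f ->
  measurable_fun setT (fun x => Normc.normc (f x) ^+ 2 / w x).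
Proof.
move=> mf; apply: measurable_funM; last exact: measurable_invw.
exact: measurable_normc_sq.
Qed.

Lemma measurable_sqint f : cmeasurable f ->
  measurable_fun setT (fun x => (Normc.normc (f x) ^+ 2 / w x)%:E).
Proof. by move=> mf; apply/measurable_EFinP; exact: measurable_sqintR. Qed.

Lemma sqint_ge0 f x : 0 <= Normc.normc (f x) ^+ 2 / w x.
Proof. by rewrite divr_ge0 ?sqr_ge0// ltW. Qed.

Lemma sqnormL2_ge0 f : (0 <= sqnormL2 w f)%E.
Proof. by apply: integral_ge0 => x _; rewrite lee_fin sqint_ge0. Qed.

Lemma sqnormL2_fin f : inL2 w f -> sqnormL2 w f \is a fin_num.
Proof. by move=> [_ fin]; rewrite ge0_fin_numE// sqnormL2_ge0. Qed.

Lemma normL2_ge0 f : 0 <= normL2 f. Proof. exact: sqrtr_ge0. Qed.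

Lemma sqnormL2E f : inL2 w f -> sqnormL2 w f = (normL2 f ^+ 2)%:E.
Proof.
move=> Hf; rewrite sqr_sqrtr ?fineK ?sqnormL2_fin//.
by rewrite fine_ge0 ?sqnormL2_ge0.
Qed.

Lemma sqnormL2Z a f : cmeasurable f ->
  sqnormL2 w (a *: f) = ((Normc.normc a ^+ 2)%:E * sqnormL2 w f)%E.
Proof.
move=> mf; rewrite /sqnormL2 -ge0_integralZl//.
- apply: eq_integral => x _; rewrite -EFinM mulrA -exprMn; congr (_ ^+ 2 / _)%:E.
  exact: Normc.normcM.
- exact: measurable_sqint.
- by move=> x _; rewrite lee_fin sqint_ge0.
- by rewrite lee_fin sqr_ge0.
Qed.

Lemma sqnormL2D_le f g (a : R) : 0 < a -> cmeasurable f -> cmeasurable g ->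
  (sqnormL2 w (f + g)%R <=
   (1 + a)%:E * sqnormL2 w f + (1 + a^-1)%:E * sqnormL2 w g)%E.
Proof.
move=> a0 mf mg; have a1 : 0 <= 1 + a by rewrite addr_ge0// ltW.
have a2 : 0 <= 1 + a^-1 by rewrite addr_ge0// invr_ge0 ltW.
have m1 := measurable_sqint mf; have m2 := measurable_sqint mg.
rewrite /sqnormL2 -!ge0_integralZl//; try by [rewrite lee_fin|move=> x _; rewrite lee_fin sqint_ge0].
rewrite -ge0_integralD//; last 4 first.
- by move=> x _; rewrite -EFinM lee_fin mulr_ge0 ?sqint_ge0.
- by apply: measurable_funeM.
- by move=> x _; rewrite -EFinM lee_fin mulr_ge0 ?sqint_ge0.
- by apply: measurable_funeM.
apply: ge0_le_integral => //.
- by move=> x _; rewrite lee_fin sqint_ge0.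
- by apply: measurable_sqint; exact: cmeasurableD.
- by apply: emeasurable_funD; exact: measurable_funeM.
- move=> x _; rewrite -!EFinM -EFinD lee_fin.
  rewrite [leRHS](_ : _ = ((1 + a) * Normc.normc (f x) ^+ 2 +
    (1 + a^-1) * Normc.normc (g x) ^+ 2) / w x); last by ring.
  by rewrite ler_pM2r ?invr_gt0//; exact: normcD_sq_le.
Qed.

Lemma inL2D f g : inL2 w f -> inL2 w g -> inL2 w (f + g).
Proof.
move=> Hf Hg; have [mf _] := Hf; have [mg _] := Hg; split; first exact: cmeasurableD.
apply: le_lt_trans (sqnormL2D_le ltr01 mf mg) _.
by rewrite !sqnormL2E// -!EFinM -EFinD ltry.
Qed.

Lemma inL2Z a f : inL2 w f -> inL2 w (a *: f).
Proof.
move=> Hf; have [mf _] := Hf; split; first exact: cmeasurableZ.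
by rewrite sqnormL2Z// sqnormL2E// -EFinM ltry.
Qed.

Lemma inL2B f g : inL2 w f -> inL2 w g -> inL2 w (f - g).
Proof. by move=> Hf Hg; rewrite -scaleN1r; apply: inL2D => //; exact: inL2Z. Qed.

Lemma normL2Z a f : inL2 w f -> normL2 (a *: f) = Normc.normc a * normL2 f.
Proof.
move=> Hf; have [mf _] := Hf; rewrite {1}/normL2 sqnormL2Z// sqnormL2E//.
rewrite -EFinM /= -exprMn sqrtr_sqr ger0_norm// mulr_ge0 ?normc_ge0//.
exact: normL2_ge0.
Qed.

Lemma normL2D f g : inL2 w f -> inL2 w g -> normL2 (f + g) <= normL2 f + normL2 g.
Proof.
move=> Hf Hg; have [mf _] := Hf; have [mg _] := Hg.
apply: sq_le_of_young; rewrite ?normL2_ge0// => a a0.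
have := sqnormL2D_le a0 mf mg.
by rewrite (sqnormL2E Hf) (sqnormL2E Hg) (sqnormL2E (inL2D Hf Hg)) -!EFinM -EFinD lee_fin.
Qed.

Lemma inL2_0 : inL2 w (0 : 'rV[R]_n -> R[i]).
Proof.
split; first by split; exact: measurable_cst.
rewrite /sqnormL2; under eq_integral => x _.
  rewrite [(0 : 'rV[R]_n -> R[i]) x]/(0 : R[i]) [Normc.normc _]/= expr0n addr0 sqrtr0 expr0n mul0r.
  over.
by rewrite integral0.
Qed.

Lemma ae_eq_sqnormL2 f g : cmeasurable f -> cmeasurable g -> ae_eqC f g ->
  sqnormL2 w f = sqnormL2 w g.
Proof.
move=> mf mg fg; apply: ge0_ae_eq_integral => //; try exact: measurable_sqint.
- by move=> x _; rewrite lee_fin sqint_ge0.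
- by move=> x _; rewrite lee_fin sqint_ge0.
- by apply: filterS fg => x /= -> _.
Qed.

Lemma normL2_ae_eq0 f g : inL2 w f -> inL2 w g -> ae_eqC f g -> normL2 (f - g) = 0.
Proof.
move=> Hf Hg fg; have [mfg _] := inL2B Hf Hg; have [m0 _] := inL2_0.
rewrite /normL2 (@ae_eq_sqnormL2 _ (0 : 'rV[R]_n -> R[i]))//.
  have := normL2Z 0 inL2_0; rewrite scaler0 {1}/normL2 => ->.
  by rewrite [Normc.normc 0]/= expr0n addr0 sqrtr0 mul0r.
by apply: filterS fg => x /= fgx; rewrite -[LHS]/(f x - g x) fgx subrr.
Qed.

Lemma normL2_le_of_sq f c : inL2 w f -> 0 <= c ->
  (sqnormL2 w f <= (c ^+ 2)%:E)%E -> normL2 f <= c.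
Proof.
move=> Hf c0; rewrite sqnormL2E// lee_fin => H.
by rewrite -ler_sqr ?nnegrE ?normL2_ge0.
Qed.

Lemma inL2_sum (I : Type) (r : seq I) (F : I -> 'rV[R]_n -> R[i]) :
  (forall i, inL2 w (F i)) -> inL2 w (\sum_(i <- r) F i).
Proof.
move=> HF; elim: r => [|i r IH]; first by rewrite big_nil; exact: inL2_0.
by rewrite big_cons; exact: inL2D.
Qed.

Lemma normL2_0 : normL2 0 = 0.
Proof.
rewrite -(scale0r 0) normL2Z; last exact: inL2_0.
by rewrite [Normc.normc 0]/= expr0n addr0 sqrtr0 mul0r.
Qed.

Lemma normL2_sum_tail (F : nat -> 'rV[R]_n -> R[i]) (a b : nat) :
  (forall k, inL2 w (F k)) -> (forall k, normL2 (F k) <= 3^-1 ^+ k) ->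
  normL2 (\sum_(k < a + b) F k - \sum_(k < a) F k) <= 3 / 2 * (3^-1 ^+ a - 3^-1 ^+ (a + b)).
Proof.
move=> HF NF; elim: b => [|b IH]; first by rewrite addn0 !subrr mulr0 normL2_0.
have HS m : inL2 w (\sum_(k < m) F k) by exact: inL2_sum.
rewrite addnS big_ord_recr /= addrAC.
apply: le_trans (normL2D (inL2B (HS _) (HS _)) (HF _)) _.
by have := NF (a + b)%N; rewrite exprS; lra.
Qed.

(* Riesz-Fischer for a geometrically convergent series: the weights 4^k make
   G = sum_k 4^k |f_k|^2 / w integrable, hence |f_k(x)| = O(2^-k) for a.e. x. *)
Lemma L2_complete (F : nat -> 'rV[R]_n -> R[i]) :
  (forall k, inL2 w (F k)) -> (forall k, normL2 (F k) <= 3^-1 ^+ k) ->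
  exists2 g, inL2 w g & forall m, normL2 (g - \sum_(k < m) F k) <= 3 / 2 * 3^-1 ^+ m.
Proof.
move=> HF NF.
pose G m x := \sum_(k < m) 4 ^+ k * (Normc.normc (F k x) ^+ 2 / w x).
have G0 m x : 0 <= G m x.
  by apply: sumr_ge0 => k _; rewrite mulr_ge0 ?exprn_ge0// sqint_ge0.
have mG m : measurable_fun setT (fun x => (G m x)%:E).
  apply/measurable_EFinP; apply: measurable_sum => k; apply: measurable_funM => //.
  by apply: measurable_sqintR; have [] := HF k.
have ndG x : {homo (fun m => (G m x)%:E) : a b / (a <= b)%N >-> (a <= b)%E}.
  move=> a b ab; rewrite lee_fin /G -(subnK ab) addnC.
  elim: (b - a)%N => [|m IH]; first by rewrite addn0.
  rewrite addnS big_ord_recr /=; apply: le_trans IH _; rewrite lerDl.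
  by rewrite mulr_ge0 ?exprn_ge0// sqint_ge0.
(* By the rate 1/3 the integral is at most the sum of all [(4/9)^k], that is 9/5. *)
have intG m : (\int[L]_x (G m x)%:E <= 2%:E)%E.
  suff -> : (\int[L]_x (G m x)%:E = (\sum_(k < m) 4 ^+ k * normL2 (F k) ^+ 2)%:E)%E.
    rewrite lee_fin; apply: (@le_trans _ _ (9 / 5 * (1 - (4 / 9) ^+ m))); last first.
      have : 0 <= (4 / 9) ^+ m :> R by rewrite exprn_ge0// divr_ge0.
      lra.
    elim: m => [|m IH]; first by rewrite big_ord0 expr0 subrr mulr0.
    rewrite big_ord_recr /= [(4 / 9) ^+ m.+1]exprS.
    have : normL2 (F m) ^+ 2 <= 9^-1 ^+ m.
      have -> : 9^-1 ^+ m = (3^-1 ^+ m) ^+ 2 :> R.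
        by rewrite exprAC; congr (_ ^+ _); field.
      by rewrite lerXn2r// ?nnegrE ?normL2_ge0// exprn_ge0// invr_ge0.
    have p4 : 0 < 4 ^+ m :> R by rewrite exprn_gt0.
    rewrite -(ler_pM2l p4) -exprMn => H.
    by move: IH H; lra.
  rewrite (_ : (fun x => (G m x)%:E) = fun x => (\sum_(k < m) (4 ^+ k * (Normc.normc (F k x) ^+ 2 / w x))%:E)%E); last first.
    by apply/funext => x; rewrite sumEFin.
  rewrite ge0_integral_sum//; last 2 first.
  - move=> k; apply/measurable_EFinP; apply: measurable_funM => //.
    by apply: measurable_sqintR; have [] := HF k.
  - by move=> k x _; rewrite lee_fin mulr_ge0 ?exprn_ge0// sqint_ge0.
  rewrite -sumEFin; apply: eq_bigr => k _.
  under eq_integral do rewrite EFinM.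
  rewrite ge0_integralZl//; last 2 first.
  - by apply: measurable_sqint; have [] := HF k.
  - by move=> x _; rewrite lee_fin sqint_ge0.
  by rewrite -[X in (_ * X)%E]/(sqnormL2 w (F k)) sqnormL2E// -EFinM.
pose Goo x := limn (fun m => (G m x)%:E).
have cG x : (G m x)%:E @[m --> \oo] --> Goo x.
  exact/ereal_nondecreasing_is_cvgn/ndG.
have mGoo : measurable_fun setT Goo.
  apply: (emeasurable_fun_cvg (fun m x => (G m x)%:E)); first exact: mG.
  by move=> x _; exact: cG.
have Goo0 x : (0 <= Goo x)%E.
  by apply: lime_ge; [exact: cG|apply: nearW => m; rewrite lee_fin].
have intGoo : (\int[L]_x Goo x <= 2%:E)%E.
  rewrite [leLHS](monotone_convergence L measurableT mG); last 2 first.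
  - by move=> m x _; rewrite lee_fin.
  - by move=> x _; exact: ndG.
  apply: lime_le; last by apply: nearW => m; exact: intG.
  apply: ereal_nondecreasing_is_cvgn => a b ab.
  apply: ge0_le_integral => //; try by move=> x _; rewrite lee_fin.
  by move=> x _; exact: ndG.
have iGoo : L.-integrable setT Goo.
  apply/integrableP; split => //; under eq_integral do rewrite gee0_abs//.
  by apply: le_lt_trans intGoo _; rewrite ltry.
pose A := [set x | Goo x \is a fin_num].
have mA : measurable A.
  have -> : A = ~` (Goo @^-1` [set +oo%E]).
    apply/seteqP; split => x /=; rewrite /A /= ge0_fin_numE//.
      by move=> + E; rewrite E ltxx.
    by move=> H; rewrite ltey; apply/eqP.
  by apply: measurableC; rewrite -[X in measurable X]setTI; apply: mGoo => //; exact: emeasurable_set1.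
have aeA : {ae L, forall x, A x}.
  by apply: filterS (integrable_ae measurableT iGoo) => x /=; apply.
pose K x := Num.sqrt (w x * fine (Goo x)).
have K0 x : 0 <= K x by exact: sqrtr_ge0.
(* Outside the set [A] of full measure the terms are set to 0, so that the series converges at every
   point and its sum is measurable. *)
pose F' k x := if x \in A then F k x else 0.
have mF' k : cmeasurable (F' k).
  have [f1 f2] := (HF k).1.
  have mb : measurable_fun setT (fun x => x \in A).
    apply: (measurable_fun_bool true); rewrite setTI [X in measurable X](_ : _ = A)//.
    by apply/seteqP; split => x /=; [move/set_mem|move/mem_set].
  split; rewrite /F'.
    rewrite (_ : (fun x => _) = fun x => if x \in A then complex.Re (F k x) else 0).
      exact: measurable_fun_ifT.
    by apply/funext => x; case: ifP.
  rewrite (_ : (fun x => _) = fun x => if x \in A then complex.Im (F k x) else 0).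
    exact: measurable_fun_ifT.
  by apply/funext => x; case: ifP.
have F'K k x : Normc.normc (F' k x) <= K x * 2^-1 ^+ k.
  rewrite /F'; case: ifPn => [|_]; last first.
    rewrite [Normc.normc 0]/= expr0n addr0 sqrtr0 mulr_ge0// exprn_ge0// invr_ge0//.
  rewrite inE /A /= => Ax.
  have Gk : 4 ^+ k * (Normc.normc (F k x) ^+ 2 / w x) <= fine (Goo x).
    have h : ((G k.+1 x)%:E <= Goo x)%E.
      apply: lime_ge; first exact: cG.
      by exists k.+1 => // m /= km; exact: ndG.
    rewrite -lee_fin fineK//; apply: le_trans h; rewrite lee_fin /G big_ord_recr /= lerDr.
    exact: G0.
  have k0 : 0 < 4 ^+ k :> R by rewrite exprn_gt0.
  rewrite -ler_sqr ?nnegrE ?normc_ge0 ?mulr_ge0 ?exprn_ge0 ?invr_ge0//.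
  rewrite exprMn sqr_sqrtr; last first.
    by rewrite mulr_ge0 ?fine_ge0// ltW.
  have -> : (2^-1 ^+ k) ^+ 2 = (4 ^+ k)^-1 :> R.
    by rewrite exprAC -exprVn; congr (_ ^+ _); field.
  rewrite ler_pdivlMr// [leRHS]mulrC -ler_pdivrMr//.
  by move: Gk; rewrite mulrA [4 ^+ k * _]mulrC.
have [gre Hre] := choice (fun x => geometric_half_cvg (K0 x)
  (fun k => le_trans (Re_le_normc (F' k x)) (F'K k x))).
have [gim Him] := choice (fun x => geometric_half_cvg (K0 x)
  (fun k => le_trans (Im_le_normc (F' k x)) (F'K k x))).
pose g x : R[i] := Complex (gre x) (gim x).
have mg : cmeasurable g.
  split.
    apply: (measurable_fun_cvg (h := fun m x => \sum_(k < m) complex.Re (F' k x))).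
      by move=> m; apply: measurable_sum => k; have [] := mF' k.
    by move=> x _; have [] := Hre x.
  apply: (measurable_fun_cvg (h := fun m x => \sum_(k < m) complex.Im (F' k x))).
    by move=> m; apply: measurable_sum => k; have [] := mF' k.
  by move=> x _; have [] := Him x.
have sumfE (H : nat -> 'rV[R]_n -> R[i]) m x : (\sum_(k < m) H k) x = \sum_(k < m) H k x.
  by rewrite fct_sumE.
have HS m : inL2 w (\sum_(k < m) F k) by exact: inL2_sum.
have mS' m : cmeasurable (\sum_(k < m) F' k).
  elim: m => [|m IH]; first by rewrite big_ord0; have [] := inL2_0.
  by rewrite big_ord_recr /=; exact: cmeasurableD.
have bound m : (sqnormL2 w (g - \sum_(k < m) F k)%R <= ((4 * 2^-1 ^+ m) ^+ 2)%:E)%E.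
  have mgS : cmeasurable (g - \sum_(k < m) F k).
    by rewrite -scaleN1r; apply: cmeasurableD => //; apply: cmeasurableZ; have [] := HS m.
  have mgS' : cmeasurable (g - \sum_(k < m) F' k).
    by rewrite -scaleN1r; apply: cmeasurableD => //; apply: cmeasurableZ.
  rewrite (ae_eq_sqnormL2 mgS mgS'); last first.
    apply: filterS aeA => x Ax /=; rewrite -![(g - _) x]/(g x - _) !sumfE.
    by congr (_ - _); apply: eq_bigr => k _; rewrite /F' mem_set.
  (* 8 is the square of the constant 2 in [geometric_half_cvg], counted once for the real and once
     for the imaginary part. As the integral of [Goo] is at most 2, this makes [16 * 4^-m]. *)
  apply: (@le_trans _ _ (\int[L]_x ((8 * (2^-1 ^+ m) ^+ 2)%:E * Goo x))%E).
    have c0 : 0 <= 8 * (2^-1 ^+ m) ^+ 2 :> R by rewrite mulr_ge0// sqr_ge0.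
    apply: ge0_le_integral => //.
    - by move=> x _; rewrite lee_fin sqint_ge0.
    - exact: measurable_sqint.
    - exact: measurable_funeM.
    - move=> x _.
      have [Ax|Ax] := boolP (x \in A); last first.
        have -> : Goo x = +oo%E.
          apply/eqP; move: Ax; rewrite notin_setE /A /= ge0_fin_numE// => /negP.
          by rewrite -leNgt leye_eq.
        by rewrite gt0_muley ?leey// lte_fin mulr_gt0// exprn_gt0// exprn_gt0// invr_gt0.
      have Gfin : Goo x \is a fin_num by move: Ax; rewrite inE.
      rewrite -[Goo x]fineK// -EFinM lee_fin ler_pdivrMr// normc_sqE ReB ImB !sumfE.
      rewrite Re_sum Im_sum /=.
      have [_ /(_ m) h1] := Hre x; have [_ /(_ m) h2] := Him x.
      have sq (u : R) : `|u| <= 2 * K x * 2^-1 ^+ m -> u ^+ 2 <= 4 * (w x * fine (Goo x)) * (2^-1 ^+ m) ^+ 2.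
        move=> Hu; rewrite -[u ^+ 2]real_normK ?num_real//.
        apply: (@le_trans _ _ ((2 * K x * 2^-1 ^+ m) ^+ 2)).
          by rewrite lerXn2r// ?nnegrE// !mulr_ge0// exprn_ge0// invr_ge0.
        rewrite !exprMn sqr_sqrtr ?mulr_ge0 ?fine_ge0 ?(ltW (w_gt0 x))//.
        by rewrite le_eqVlt; apply/orP; left; apply/eqP; ring.
      have := sq _ h1; have := sq _ h2; lra.
  rewrite ge0_integralZl// ?lee_fin ?mulr_ge0 ?sqr_ge0//.
  apply: (@le_trans _ _ ((8 * (2^-1 ^+ m) ^+ 2)%:E * 2%:E)%E).
    by apply: lee_pmul => //; rewrite ?lee_fin ?mulr_ge0 ?sqr_ge0//; exact: integral_ge0.
  rewrite -EFinM lee_fin exprMn le_eqVlt; apply/orP; left; apply/eqP; ring.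
have gS m : inL2 w (g - \sum_(k < m) F k).
  split; last by apply: le_lt_trans (bound m) _; rewrite ltry.
  by rewrite -scaleN1r; apply: cmeasurableD => //; apply: cmeasurableZ; have [] := HS m.
exists g; first by have := gS 0; rewrite big_ord0 subr0.
(* The pointwise estimate only has rate 1/2. The announced tail is reached through a partial sum far
   enough for that estimate to fall below [e]. *)
move=> m; apply/ler_addgt0Pr => e e0.
have [M HM] : exists M, 4 * 2^-1 ^+ (m + M) <= e.
  have : (4 * 2^-1 ^+ k) @[k --> \oo] --> (0 : R).
    rewrite -(mulr0 4); apply: cvgMr; apply: cvg_expr.
    by rewrite ger0_norm ?invr_ge0// invf_lt1// ltr1n.
  move/cvgrPdist_le => /(_ e e0) [M _ HM]; exists M.
  have := HM (m + M)%N (leq_addl _ _); by rewrite /= sub0r normrN ger0_norm// mulr_ge0// exprn_ge0// invr_ge0.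
have -> : g - \sum_(k < m) F k = (g - \sum_(k < m + M) F k) +
   (\sum_(k < m + M) F k - \sum_(k < m) F k) by rewrite addrA subrK.
apply: le_trans (normL2D (gS _) (inL2B (HS _) (HS _))) _.
have h1 : normL2 (g - \sum_(k < m + M) F k) <= 4 * 2^-1 ^+ (m + M).
  have c0 : 0 <= 4 * 2^-1 ^+ (m + M) :> R by rewrite mulr_ge0// exprn_ge0// invr_ge0.
  exact: (normL2_le_of_sq (gS _) c0 (bound _)).
have h2 := normL2_sum_tail m M HF NF.
have h3 : 0 <= 3^-1 ^+ (m + M) :> R by rewrite exprn_ge0// invr_ge0.
lra.
Qed.

End weighted_L2.

(** * Integration by parts against test functions *)

Section measurable_continuous_rV.
Context (R : realType) (n : nat).

Lemma countable_bigcup_measurable d (T : measurableType d) (I : countType) (S : I -> set T) :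
  (forall i, measurable (S i)) -> measurable (\bigcup_i S i).
Proof.
move=> mS.
have -> : \bigcup_i S i = \bigcup_k (if unpickle k is Some i then S i else set0).
  apply/seteqP; split => x [i _ Six].
    by exists (pickle i) => //; rewrite pickleK.
  by move: Six; case: unpickle => // j Sj; exists j.
by apply: bigcup_measurable => k _; case: unpickle.
Qed.

Definition grid (k : nat) (x : 'rV[R]_n) : 'rV[R]_n :=
  \row_i ((Num.floor (x 0 i * k.+1%:R))%:~R / k.+1%:R).

Lemma cvg_grid (x : 'rV[R]_n) : grid k x @[k --> \oo] --> x.
Proof.
apply: cvg_mx_entries => i j; rewrite ord1; apply/cvgrPdist_le => e e0.
have [M _ HM] := near_infty_natSinv_lt (PosNum e0).
exists M => // k /= Mk; rewrite mxE.
have k0 : 0 < k.+1%:R :> R by [].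
set y := x 0 j * _.
have -> : x 0 j - (Num.floor y)%:~R / k.+1%:R = (y - (Num.floor y)%:~R) / k.+1%:R.
  by rewrite mulrBl /y mulfK ?gt_eqF.
rewrite normrM [X in _ * X]ger0_norm ?invr_ge0//.
have y1 : `|y - (Num.floor y)%:~R| <= 1.
  have := floor_le y; have := floorD1_gt y; rewrite intrD => h1 h2.
  by rewrite ler_norml; lra.
apply: le_trans (ltW (HM k Mk)); rewrite -[leRHS]mul1r ler_wpM2r// invr_ge0//.
Qed.

Lemma measurable_grid_cell (k : nat) (z : 'rV[int]_n) :
  measurable [set x : 'rV[R]_n | forall i, Num.floor (x 0 i * k.+1%:R) = z 0 i].
Proof.
rewrite (_ : mkset _ = \bigcap_(i in [set: 'I_n])
   (@rV_coord R n i @^-1` `[(z 0 i)%:~R / k.+1%:R, (z 0 i + 1)%:~R / k.+1%:R[)).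
  apply: fin_bigcap_measurable => // i _.
  by rewrite -[X in measurable X]setTI; apply: measurable_rV_coord.
have k0 : 0 < k.+1%:R :> R by [].
apply/seteqP; split => [x Hx i _|x Hx i].
  rewrite /= in_itv /= /rV_coord -(Hx i) ler_pdivrMr// ltr_pdivlMr//.
  by rewrite floor_le floorD1_gt.
have := Hx i I; rewrite /= in_itv /= /rV_coord ler_pdivrMr// ltr_pdivlMr//.
by move=> h; apply/floor_def.
Qed.

(** The sigma-algebra is given by the coordinates rather than by the open sets. So [h] is obtained
    as the pointwise limit of [h (grid k x)], which is constant on each of countably many measurable
    cells. *)
Lemma continuous_measurable_rV (h : 'rV[R]_n -> R) : continuous h ->
  measurable_fun setT h.
Proof.
move=> ch; apply: (measurable_fun_cvg (h := fun k x => h (grid k x))); last first.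
  by move=> x _; apply: continuous_cvg; [exact: ch|exact: cvg_grid].
move=> k _ Y mY; rewrite setTI.
pose pt (z : 'rV[int]_n) : 'rV[R]_n := \row_i ((z 0 i)%:~R / k.+1%:R).
rewrite (_ : _ @^-1` _ = \bigcup_(z : 'rV[int]_n)
   (if `[< Y (h (pt z)) >] then [set x : 'rV[R]_n | forall i, Num.floor (x 0 i * k.+1%:R) = z 0 i]
    else set0)).
  by apply: countable_bigcup_measurable => z; case: ifP => // _; exact: measurable_grid_cell.
apply/seteqP; split => x /=.
  move=> Yx; exists (\row_i Num.floor (x 0 i * k.+1%:R)) => //.
  rewrite ifT; first by move=> i; rewrite mxE.
  apply/asboolP; rewrite (_ : pt _ = grid k x)//.
  by apply/rowP => i; rewrite !mxE.
move=> [z _]; case: asboolP => // Yz Hz.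
rewrite (_ : grid k x = pt z)//.
by apply/rowP => i; rewrite !mxE Hz.
Qed.

End measurable_continuous_rV.

(** * Derivatives of functions with bounded support integrate to 0 *)

Section compactly_supported.
Context (R : realType).
Notation L := (@lebesgue_rV R).

(** A substitute for compact support that speaks of coordinates only; multiplication by a
    [box_bounded] function preserves it. *)
Definition box_supported n (v : 'rV[R]_n -> R) : Prop :=
  measurable_fun setT v /\ exists M C : R, forall x : 'rV[R]_n,
    `|v x| <= C /\ ((exists j, M < `|x 0 j|) -> v x = 0).

Definition box_bounded n (a : 'rV[R]_n -> R) : Prop :=
  measurable_fun setT a /\ forall M : R, exists C : R, forall x : 'rV[R]_n,
    (forall j, `|x 0 j| <= M) -> `|a x| <= C.

Lemma box_boundedM n (a b : 'rV[R]_n -> R) :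
  box_bounded a -> box_bounded b -> box_bounded (fun x => a x * b x).
Proof.
move=> [ma Ha] [mb Hb]; split; first exact: measurable_funM.
move=> M; have [C HC] := Ha M; have [D HD] := Hb M.
by exists (C * D) => x Hx; rewrite normrM ler_pM// ?HC// ?HD.
Qed.

Lemma box_boundedD n (a b : 'rV[R]_n -> R) :
  box_bounded a -> box_bounded b -> box_bounded (fun x => a x + b x).
Proof.
move=> [ma Ha] [mb Hb]; split; first exact: measurable_funD.
move=> M; have [C HC] := Ha M; have [D HD] := Hb M.
exists (C + D) => x Hx; apply: le_trans (ler_normD _ _) _.
by rewrite lerD// ?HC// ?HD.
Qed.

Lemma box_bounded_cst n (c : R) : box_bounded (fun _ : 'rV[R]_n => c).
Proof. by split => // M; exists `|c|. Qed.

Lemma box_bounded_coord n (i : 'I_n) : box_bounded (fun x : 'rV[R]_n => x 0 i).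
Proof. by split; [exact: measurable_rV_coord|move=> M; exists M => x]. Qed.

Lemma box_bounded_sum n m (a : 'I_m -> 'rV[R]_n -> R) :
  (forall k, box_bounded (a k)) -> box_bounded (fun x => \sum_k a k x).
Proof.
elim: m a => [|m IH] a Ha.
  by under eq_fun do rewrite big_ord0; exact: box_bounded_cst.
under eq_fun do rewrite big_ord_recl.
by apply: box_boundedD => //; apply: IH.
Qed.

Lemma box_bounded_bounded n (a : 'rV[R]_n -> R) (C : R) : measurable_fun setT a ->
  (forall x, `|a x| <= C) -> box_bounded a.
Proof. by move=> ma aC; split => // M; exists C. Qed.

Lemma box_supportedM n (a v : 'rV[R]_n -> R) :
  box_bounded a -> box_supported v -> box_supported (fun x => a x * v x).
Proof.
move=> [ma Ha] [mv [M [C HC]]]; split; first exact: measurable_funM.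
have [D HD] := Ha M; exists M, (`|D| * C) => x; split; last first.
  by move=> /(HC x).2 ->; rewrite mulr0.
have [/existsP [j Mj]|] := boolP [exists j, M < `|x 0 j|].
  rewrite (HC x).2; last by exists j.
  by rewrite mulr0 normr0 mulr_ge0// (le_trans (normr_ge0 (v x)) (HC x).1).
rewrite negb_exists => /forallP Hx; rewrite normrM ler_pM//; last by have [] := HC x.
apply: le_trans (ler_norm D); apply: HD => j.
by have := Hx j; rewrite -leNgt.
Qed.

Lemma box_supportedD n (u v : 'rV[R]_n -> R) :
  box_supported u -> box_supported v -> box_supported (fun x => u x + v x).
Proof.
move=> [mu [M [C HC]]] [mv [N [D HD]]]; split; first exact: measurable_funD.
exists (Num.max M N), (C + D) => x; split.
  by apply: le_trans (ler_normD _ _) _; rewrite lerD ?(HC x).1 ?(HD x).1.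
move=> [j]; rewrite gt_max => /andP[h1 h2].
by rewrite (HC x).2 ?(HD x).2 ?addr0//; exists j.
Qed.

Lemma qform1E n (x y : 'rV[R]_n) : qform 1%:M x y = \sum_i x 0 i * y 0 i.
Proof. by rewrite /qform mulmx1 mxE; apply: eq_bigr => i _; rewrite mxE. Qed.

Lemma posdef1 n : posdefmx (1%:M : 'M[R]_n).
Proof.
split; first exact: trmx1.
move=> x xn0; rewrite /qform mulmx1 ltNge; apply: contra xn0 => H.
by apply/eqP; exact: rV_sq_eq0.
Qed.

(** On the cube [|x_j| <= M] the squared length is at most [n M^2], so the Gaussian is bounded below
    there. A Gaussian majorant is integrable and factors over the coordinates, which suits
    Fubini. *)
Lemma box_supported_gauss n (v : 'rV[R]_n -> R) : box_supported v ->
  exists C, forall x, `|v x| <= C * gaussn 1%:M x.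
Proof.
move=> [mv [M [C HC]]]; exists (C * expR (2^-1 * (n%:R * M ^+ 2))) => x.
have C0 : 0 <= C by apply: le_trans (normr_ge0 (v x)) (HC x).1.
have [/existsP [j Mj]|] := boolP [exists j, M < `|x 0 j|].
  rewrite (HC x).2; last by exists j.
  by rewrite normr0 !mulr_ge0 ?expR_ge0.
rewrite negb_exists => /forallP Hx.
apply: le_trans (HC x).1 _; rewrite -mulrA ler_peMr//.
rewrite /gaussn -expRD; apply: le_trans (expR_ge1Dx _).
rewrite lerDl mulNr -mulrBr mulr_ge0// subr_ge0.
rewrite qform1E mulrC mulr_natr -[X in _ *+ X]card_ord -sumr_const.
apply: ler_sum => j _; rewrite -expr2 -real_normK ?num_real//.
have h : `|x 0 j| <= M by rewrite leNgt.
by rewrite lerXn2r// nnegrE (le_trans _ h).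
Qed.

Lemma box_supported_integrable n (v : 'rV[R]_n -> R) : box_supported v ->
  (L n).-integrable setT (EFin \o v).
Proof.
move=> Hv; have [C HC] := box_supported_gauss Hv.
have ig : (L n).-integrable setT (EFin \o (fun x => C * gaussn 1%:M x)).
  by apply: (integrableZl _ _ (integrable_gaussn (posdef1 n))).
apply: le_integrable ig => //; first by apply/measurable_EFinP; have [] := Hv.
by move=> x _; rewrite lee_fin (le_trans (HC x))// ler_norm.
Qed.

(** Derivability along the lines of one coordinate direction, weaker than differentiability: it
    passes to slices with other coordinates fixed. *)
Definition line_derive n (i : 'I_n) (u v : 'rV[R]_n -> R) : Prop :=
  forall (x : 'rV[R]_n) (t : R),
    is_derive t 1 (fun s : R => u (x + s *: delta_mx 0 i)) (v (x + t *: delta_mx 0 i)).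

Lemma line_deriveM n (i : 'I_n) (u v u' v' : 'rV[R]_n -> R) :
  line_derive i u v -> line_derive i u' v' ->
  line_derive i (fun x => u x * u' x) (fun x => v x * u' x + u x * v' x).
Proof.
move=> H H' x t; have h := H x t; have h' := H' x t.
by apply: is_derive_eq; rewrite /GRing.scale /=; ring.
Qed.

Lemma line_deriveD n (i : 'I_n) (u v u' v' : 'rV[R]_n -> R) :
  line_derive i u v -> line_derive i u' v' ->
  line_derive i (fun x => u x + u' x) (fun x => v x + v' x).
Proof.
move=> H H' x t; have h := H x t; have h' := H' x t.
by apply: is_derive_eq.
Qed.

Lemma line_derive_continuous n (i : 'I_n) (u v : 'rV[R]_n -> R) (x : 'rV[R]_n) :
  line_derive i u v -> continuous (fun s : R => u (x + s *: delta_mx 0 i)).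
Proof. by move=> H; apply: continuous_of_is_derive => t; exact: H. Qed.

Lemma line_derive_coord n (i j : 'I_n) :
  line_derive i (fun x : 'rV[R]_n => x 0 j) (fun=> (i == j)%:R).
Proof.
move=> x t; rewrite (_ : (fun s => _) = fun s => x 0 j + (i == j)%:R * s); last first.
  by apply/funext => s; rewrite !mxE eqxx /= [j == i]eq_sym mulrC.
have h := is_derive_mulr_cst (i == j)%:R (is_derive_id t (1 : R)).
have := is_deriveD (is_derive_cst (x 0 j) t (1 : R)) h.
by rewrite add0r mulr1.
Qed.

Lemma line_derive_cst n (i : 'I_n) (c : R) :
  line_derive i (fun _ : 'rV[R]_n => c) (fun=> 0).
Proof. by move=> x t; apply: is_derive_eq. Qed.

Lemma rV_add_scale_entry n (x v : 'rV[R]_n) (t : R) (i : 'I_n) :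
  (x + t *: v) 0 i = x 0 i + t * v 0 i.
Proof. by rewrite !mxE. Qed.

Lemma delta_rV_entry n (i j : 'I_n) : (delta_mx 0 i : 'rV[R]_n) 0 j = (j == i)%:R.
Proof. by rewrite mxE eqxx. Qed.

Lemma rV_cons_line0 n (x t : R) (y : 'rV[R]_n) :
  rV_cons (x, y) + t *: delta_mx 0 0 = rV_cons (x + t, y).
Proof.
apply/rowP => i; rewrite rV_add_scale_entry delta_rV_entry.
have [j ->|->] := unliftP 0 i; rewrite ?rV_consS ?rV_cons0 /=.
  by rewrite mulr0 addr0.
by rewrite mulr1.
Qed.

Lemma rV_cons_lineS n (x t : R) (y : 'rV[R]_n) (i : 'I_n) :
  rV_cons (x, y) + t *: delta_mx 0 (lift 0 i) = rV_cons (x, y + t *: delta_mx 0 i).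
Proof.
apply/rowP => k; rewrite rV_add_scale_entry delta_rV_entry.
have [j ->|->] := unliftP 0 k; rewrite ?rV_consS ?rV_cons0 /=.
  by rewrite rV_add_scale_entry delta_rV_entry (inj_eq lift_inj).
by rewrite mulr0 addr0.
Qed.

Lemma gaussn1_cons n (x : R) (y : 'rV[R]_n) :
  gaussn 1%:M (rV_cons (x, y)) = gauss1 1 0 x * gaussn 1%:M y.
Proof.
rewrite /gaussn /gauss1 -expRD !qform1E big_ord_recl !rV_cons0; congr expR.
rewrite (eq_bigr (fun i => y 0 i * y 0 i)).
  by rewrite subr0 /=; field.
by move=> i _; rewrite (rV_consS (x, y) i).
Qed.

(** Induction on the dimension. If [i] is the first coordinate, the inner integral vanishes on each
    line by the fundamental theorem; otherwise the first coordinate is fixed and the induction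
    hypothesis applies to the slice, whose Gaussian majorant keeps the constant [C]. *)
Lemma integral_line_derive_gauss n (i : 'I_n) (u v : 'rV[R]_n -> R) (M C : R) :
  measurable_fun setT v -> (forall x : 'rV[R]_n, `|v x| <= C * gaussn 1%:M x) ->
  (forall x : 'rV[R]_n, (exists j, M < `|x 0 j|) -> u x = 0) ->
  line_derive i u v ->
  (forall x : 'rV[R]_n, continuous (fun s : R => v (x + s *: delta_mx 0 i))) ->
  (\int[L n]_x (v x)%:E = 0)%E.
Proof.
elim: n i u v => [[]//|n IH] i u v mv vC uM uv cv.
have C0 : 0 <= C.
  have := le_trans (normr_ge0 _) (vC 0); rewrite pmulr_lge0// expR_gt0//.
have iv : (L n.+1).-integrable setT (EFin \o v).
  have ig : (L n.+1).-integrable setT (EFin \o (fun x => C * gaussn 1%:M x)).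
    by apply: (integrableZl _ _ (integrable_gaussn (posdef1 n.+1))).
  apply: le_integrable ig => //; first exact/measurable_EFinP.
  by move=> x _; rewrite lee_fin (le_trans (vC x))// ler_norm.
have [j ij|ij] := unliftP 0 i.
- rewrite (integral_rV_cons_swap iv) /=.
  rewrite (eq_integral (cst 0)) ?integral_cst ?mul0e// => x _.
  apply: (IH j (fun y => u (rV_cons (x, y))) (fun y => v (rV_cons (x, y)))).
  + have m1 : measurable_fun setT (fun y : 'rV[R]_n => (x : R, y)).
      by apply: measurable_fun_pair.
    exact: (measurableT_comp mv (measurableT_comp (@measurable_rV_cons R n) m1)).
  + move=> y; apply: le_trans (vC _) _; rewrite gaussn1_cons mulrA ler_pM2r ?expR_gt0//.
    by rewrite ler_piMr// gauss1_le1.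
  + move=> y [k Mk]; apply: uM; exists (lift 0 k); by rewrite rV_consS.
  + move=> y t; have := uv (rV_cons (x, y)) t; rewrite ij rV_cons_lineS.
    by under eq_fun do rewrite rV_cons_lineS.
  + move=> y; have := cv (rV_cons (x, y)); rewrite ij.
    by under eq_fun do rewrite rV_cons_lineS.
- rewrite (integral_rV_cons iv) /=.
  rewrite (eq_integral (cst 0)) ?integral_cst ?mul0e// => y _.
  have Du (t : R) : is_derive t 1 (fun s => u (rV_cons (s, y))) (v (rV_cons (t, y))).
    have := uv (rV_cons (0, y)) t; rewrite ij rV_cons_line0 add0r.
    by under eq_fun do rewrite rV_cons_line0 add0r.
  have cv' : continuous (fun s : R => v (rV_cons (s, y))).
    have := cv (rV_cons (0, y)); rewrite ij.
    by under eq_fun do rewrite rV_cons_line0 add0r.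
  have iv' : (@lebesgue_measure R).-integrable setT (EFin \o (fun s : R => v (rV_cons (s, y)))).
    have ig : (@lebesgue_measure R).-integrable setT (EFin \o (fun x => C * gauss1 1 0 x)).
      by apply: (integrableZl _ _ (integrable_gauss1 0 ltr01)).
    apply: le_integrable ig => //.
      by apply/measurable_EFinP; exact: continuous_measurable_fun.
    move=> s _; rewrite lee_fin (le_trans (vC _))// gaussn1_cons.
    apply: le_trans (ler_norm _); rewrite mulrA ler_piMr ?mulr_ge0 ?expR_ge0//.
    rewrite /gaussn -[leRHS]expR0 ler_expR mulNr oppr_le0 mulr_ge0//.
    exact: posdef_qform_ge0 (posdef1 n).
  have u0 (s : R) : M < `|s| -> u (rV_cons (s, y)) = 0.
    by move=> Ms; apply: uM; exists 0; rewrite rV_cons0.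
  have := Rintegral_derive_eq0 cv' Du iv'; rewrite /Rintegral => H.
  rewrite -[LHS]fineK; last exact: integrable_fin_num.
  congr EFin; apply: H.
  + apply: cvg_near_cst; near=> s; apply: u0.
    apply: lt_le_trans (ler_norm s); near: s; apply: nbhs_pinfty_gt; exact: num_real.
  + apply: cvg_near_cst; near=> s; apply: u0; rewrite normrN.
    apply: lt_le_trans (ler_norm s); near: s; apply: nbhs_pinfty_gt; exact: num_real.
Unshelve. all: by end_near.
Qed.

Definition null_integral n (v : 'rV[R]_n -> R) : Prop :=
  (L n).-integrable setT (EFin \o v) /\ \int[L n]_x v x = 0.

(** The derivative [v'] serves to make [v] continuous along the lines, as the fundamental theorem
    asks. *)
Lemma null_integral_line_derive n (i : 'I_n) (u v v' : 'rV[R]_n -> R) :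
  box_supported u -> box_supported v -> line_derive i u v -> line_derive i v v' ->
  null_integral v.
Proof.
move=> [_ [M [C HC]]] Hv uv vv'; split; first exact: box_supported_integrable.
have [D HD] := box_supported_gauss Hv.
rewrite /Rintegral (@integral_line_derive_gauss n i u v M D)//.
- by have [] := Hv.
- by move=> x /(HC x).2.
- by move=> x; exact: line_derive_continuous vv'.
Qed.

Lemma null_integralD n (u v : 'rV[R]_n -> R) : null_integral u -> null_integral v ->
  null_integral (fun x => u x + v x).
Proof.
move=> [iu u0] [iv v0]; split; first exact: (integrableD measurableT iu iv).
by rewrite RintegralD// u0 v0 addr0.
Qed.

Lemma null_integralZ n (a : R) (u : 'rV[R]_n -> R) : null_integral u ->
  null_integral (fun x => a * u x).
Proof.
move=> [iu u0]; split; first exact: (integrableZl measurableT a iu).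
by rewrite RintegralZl// u0 mulr0.
Qed.

Lemma null_integral_sum n m (a : 'I_m -> 'rV[R]_n -> R) :
  (forall k, null_integral (a k)) -> null_integral (fun x => \sum_k a k x).
Proof.
elim: m a => [|m IH] a Ha.
  under eq_fun do rewrite big_ord0; split; first exact: integrable0.
  by rewrite /Rintegral integral0.
under eq_fun do rewrite big_ord_recl.
by apply: null_integralD => //; apply: IH.
Qed.

Lemma mx_entry_le_norm n (x : 'rV[R]_n) (j : 'I_n) : `|x 0 j| <= `|x|.
Proof.
rewrite [leRHS]mx_normrE.
exact: (le_bigmax _ (fun ij : 'I_1 * 'I_n => `|x ij.1 ij.2|) (0, j)).
Qed.

Lemma partial_eq0_open n (O : set 'rV[R]_n) (phi : 'rV[R]_n -> R) (i : 'I_n) :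
  open O -> (forall x, O x -> phi x = 0) -> forall x, O x -> partial i phi x = 0.
Proof.
move=> oO phi0 x Ox; rewrite /partial.
have Hn : \forall y \near x, cst 0 y = phi y.
  by have := open_nbhs_nbhs (conj oO Ox); apply: filterS => y /phi0.
have : is_derive x (delta_mx 0 i) phi 0.
  exact: (near_eq_is_derive Hn (is_derive_cst 0 x _)).
by case.
Qed.

Lemma test_function_box_supported n (phi : 'rV[R]_n -> R) (s : seq 'I_n) :
  test_function phi -> box_supported (foldr (@partial R n) phi s).
Proof.
move=> [dphi cphi]; set psi := foldr _ _ _.
have cpsi : continuous psi by move=> x; apply: differentiable_continuous; exact: dphi.
split; first exact: continuous_measurable_rV.
set K := closure _ in cphi.
(* The complement of the closed support is open, so vanishing there is inherited by every iterated
   partial derivative. *)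
have out0 x : ~ K x -> psi x = 0.
  rewrite /psi => Kx; have oK : open (~` K) by exact/closed_openC/closed_closure.
  elim: s {psi cpsi} x Kx => [|i s IH] x Kx /=.
    by apply/eqP; apply: contra_notT Kx => phix; exact: subset_closure.
  exact: (@partial_eq0_open n _ _ i oK IH).
have [M [_ HM]] := compact_bounded cphi.
have cK : compact (psi @` K).
  by apply: continuous_compact => //; apply: continuous_subspaceT => x; exact: cpsi.
have [C [_ HC]] := compact_bounded cK.
exists (M + 1), (`|C| + 1) => x; split.
  have [Kx|Kx] := pselect (K x).
    apply: HC; last by exists x.
    by apply: le_lt_trans (ler_norm C) _; rewrite ltrDl.
  by rewrite out0// normr0 addr_ge0.
move=> [j Mj]; apply: out0 => Kx; move: Mj; rewrite ltNge; apply/negP; rewrite negbK.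
apply: le_trans (mx_entry_le_norm _ _) _; apply: HM => //.
by rewrite ltrDl.
Qed.

Lemma line_derive_partial n (phi : 'rV[R]_n -> R) (i : 'I_n) :
  (forall x, differentiable phi x) -> line_derive i phi (partial i phi).
Proof.
move=> dphi x t; set v : 'rV[R]_n := delta_mx 0 i.
have Hd : derivable phi (x + t *: v) v by exact: diff_derivable.
have E : (fun h : R => h^-1 *: ((fun s : R => phi (x + s *: v)) (h *: 1 + t) - phi (x + t *: v)))
  = fun h : R => h^-1 *: (phi (h *: v + (x + t *: v)) - phi (x + t *: v)).
  apply/funext => h; congr (_ *: (phi _ - _)).
  by rewrite [h *: 1]mulr1 scalerDl addrCA.
split; first by rewrite /derivable E.
by rewrite /partial /derive E.
Qed.

Lemma test_function_line_derive n (phi : 'rV[R]_n -> R) (s : seq 'I_n) (i : 'I_n) :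
  test_function phi ->
  line_derive i (foldr (@partial R n) phi s) (foldr (@partial R n) phi (i :: s)).
Proof. by move=> [dphi _]; apply: line_derive_partial => x; exact: dphi. Qed.

Lemma line_derive_partialE n (u v : 'rV[R]_n -> R) (i : 'I_n) :
  line_derive i u v -> partial i u =1 v.
Proof.
move=> uv x; have := uv x 0; rewrite scale0r addr0 => -[_ <-].
rewrite /partial /derive; set f1 := (fun h => _); set f2 := (fun h => _).
suff -> : f1 = f2 by [].
apply/funext => h; rewrite /f1 /f2 /= !scale0r !addr0.
rewrite (addrC (h *: _)); congr (_ *: (u (x + _ *: _) - _)); exact: (esym (mulr1 h)).
Qed.

End compactly_supported.

(** * Gaussian plane waves *)

Definition dotv (R : realType) n (b x : 'rV[R]_n) : R := (b *m x^T) 0 0.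

Section dotv.
Context (R : realType) (n : nat).
Implicit Types (b c x : 'rV[R]_n).

Lemma dotvE b x : dotv b x = \sum_i b 0 i * x 0 i.
Proof. by rewrite /dotv mxE; apply: eq_bigr => i _; rewrite mxE. Qed.

Lemma dotvBl b c x : dotv (b - c) x = dotv b x - dotv c x.
Proof. by rewrite /dotv mulmxBl !mxE. Qed.

Lemma dotvDl b c x : dotv (b + c) x = dotv b x + dotv c x.
Proof. by rewrite /dotv mulmxDl !mxE. Qed.

Lemma dotv0l x : dotv 0 x = 0.
Proof. by rewrite /dotv mul0mx mxE. Qed.

Lemma measurable_dotv b : measurable_fun setT (dotv b).
Proof.
rewrite (_ : dotv b = qform 1%:M b); first exact: measurable_qform.
by apply/funext => x; rewrite /dotv /qform mulmx1.
Qed.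

Lemma line_derive_cos_dotv (i : 'I_n) b (th : R) :
  line_derive i (fun x => cos (dotv b x + th)) (fun x => - (b 0 i * sin (dotv b x + th))).
Proof.
move=> x t.
have E (s : R) : dotv b (x + s *: delta_mx 0 i) = dotv b x + b 0 i * s.
  rewrite /dotv linearD linearZ /= mulmxDr -scalemxAr mxE [X in _ + X]mxE; congr (_ + _).
  by rewrite mulrC trmx_delta -colE mxE.
rewrite E (_ : (fun s : R => _) = fun s => cos (dotv b x + b 0 i * s + th)); last first.
  by apply/funext => s; rewrite E.
have h : is_derive t 1 (fun s : R => dotv b x + th + b 0 i * s) (b 0 i).
  have := is_deriveD (is_derive_cst (dotv b x + th) t (1 : R))
    (is_derive_mulr_cst (b 0 i) (is_derive_id t (1 : R))).
  by rewrite add0r mulr1.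
have := is_derive1_comp (is_derive_cos _) h.
rewrite (_ : cos \o _ = fun s => cos (dotv b x + b 0 i * s + th)); last first.
  by apply/funext => s /=; rewrite addrAC.
by rewrite mulNr addrAC mulrC.
Qed.

End dotv.

Lemma quadratic_is_derive (R : realType) (a b c t : R) :
  is_derive t 1 (fun s : R => - 2^-1 * (a + 2 * s * b + s ^+ 2 * c)) (- (b + t * c)).
Proof.
have h1 := is_derive_mulr_cst b (is_derive_id t (1 : R)).
have h2 := is_derive_mulr_cst (2^-1 * c) (is_deriveX 2 (is_derive_id t (1 : R))).
have := is_deriveN (is_deriveD (is_deriveD (is_derive_cst (2^-1 * a) t (1 : R)) h1) h2).
set f1 := - _ : R -> R; rewrite (_ : f1 = fun s : R => - 2^-1 * (a + 2 * s * b + s ^+ 2 * c)).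
  by move=> h; apply: is_derive_eq h _; rewrite /GRing.scale /= expr1; field.
by apply/funext => s; rewrite /f1 /= !fctE; field.
Qed.

Section gaussian_density.
Context (R : realType) (n : nat) (Q B : 'M[R]_n).
Let S := Qinf Q B.
Hypothesis Sp : posdefmx S.
Let P := invmx S.
Notation L := (lebesgue_rV R n).
Notation w := (rho Q B).

Definition rho_const : R := ((2 * pi) `^ (n%:R / 2) * Num.sqrt (\det (Qinf Q B)))^-1.

Lemma Qinf_unit : S \in unitmx.
Proof. by rewrite unitmxE unitfE lt0r_neq0// det_posdef_gt0. Qed.

Lemma Qinf_inv_sym : P^T = P.
Proof. by rewrite /P trmx_inv Sp.1. Qed.

Lemma Qinf_inv_posdef : posdefmx P.
Proof.
split; first exact: Qinf_inv_sym.
move=> x xn0; have -> : qform P x x = qform S (x *m P) (x *m P).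
  by rewrite /qform trmx_mul Qinf_inv_sym !mulmxA mulmxKV// Qinf_unit.
apply: Sp.2; apply: contraNneq xn0 => xP0.
by rewrite -(mulmxKV Qinf_unit x) -/P xP0 mul0mx.
Qed.

Lemma rhoE x : w x = rho_const * gaussn P x.
Proof. by []. Qed.

Lemma rho_const_gt0 : 0 < rho_const.
Proof.
by rewrite invr_gt0 mulr_gt0// ?powR_gt0 ?mulr_gt0 ?pi_gt0// sqrtr_gt0 det_posdef_gt0.
Qed.

Lemma rho_gt0 x : 0 < w x.
Proof. by rewrite rhoE mulr_gt0 ?rho_const_gt0// expR_gt0. Qed.

Lemma measurable_rho : measurable_fun setT w.
Proof.
rewrite (_ : w = fun x => rho_const * gaussn P x); last exact/funext/rhoE.
by apply: measurable_funM => //; exact: measurable_gaussn.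
Qed.

Lemma rho_constE : rho_const * Num.sqrt ((2 * pi) ^+ n / \det P) = 1.
Proof.
have d0 : 0 < \det S by exact: det_posdef_gt0.
have p0 : 0 < 2 * pi :> R by rewrite mulr_gt0// pi_gt0.
rewrite det_inv invrK sqrtrM; last by rewrite exprn_ge0// ltW.
rewrite /rho_const powRrM powR_mulrn ?(ltW p0)// powR12_sqrt ?exprn_ge0 ?(ltW p0)//.
by rewrite mulVf// mulf_neq0// lt0r_neq0// sqrtr_gt0// exprn_gt0.
Qed.

(** Brings the frequency [b] into the form [P c], with [c = b *m S], that [integral_cos_gaussn]
    handles; the exponent [qform P c c] is then [qform S b b]. *)
Lemma dotv_qform (b x : 'rV[R]_n) : dotv b x = qform P (b *m S) x.
Proof. by rewrite /dotv /qform mulmxK// Qinf_unit. Qed.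

Lemma integral_rho_cos (b : 'rV[R]_n) (th : R) :
  \int[L]_x (w x * cos (dotv b x + th)) = expR (- 2^-1 * qform S b b) * cos th.
Proof.
transitivity (rho_const * \int[L]_x (gaussn P x * cos (qform P (b *m S) x + th))).
  rewrite -RintegralZl//.
    by apply: eq_Rintegral => x _; rewrite rhoE dotv_qform mulrA.
  apply: (@integrable_gaussn_mul _ _ _ _ 1); first exact: Qinf_inv_posdef.
    exact: measurable_cos_qform.
  by move=> x; exact: cos_max.
rewrite integral_cos_gaussn; last exact: Qinf_inv_posdef.
rewrite !mulrA rho_constE mul1r; congr (expR (_ * _) * _).
by rewrite /qform trmx_mul Sp.1 mulmxA mulmxK ?Qinf_unit// mulmxA.
Qed.

Lemma integrable_rho_mul (s : 'rV[R]_n -> R) (K : R) :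
  measurable_fun setT s -> (forall x, `|s x| <= K) ->
  L.-integrable setT (EFin \o (fun x => w x * s x)).
Proof.
move=> ms sK.
have := integrableZl measurableT rho_const (integrable_gaussn_mul Qinf_inv_posdef ms sK).
by congr (L.-integrable _ _); apply/funext => x /=; rewrite rhoE -mulrA.
Qed.

Lemma integral_rho : \int[L]_x w x = 1.
Proof.
have := integral_rho_cos 0 0; rewrite /qform !mul0mx mxE mulr0 expR0 cos0 mulr1 => <-.
by apply: eq_Rintegral => x _; rewrite dotv0l addr0 cos0 mulr1.
Qed.

Lemma integrable_rho : L.-integrable setT (EFin \o w).
Proof.
have m1 : measurable_fun setT (fun _ : 'rV[R]_n => 1 : R) by exact: measurable_cst.
have := @integrable_rho_mul (fun=> 1) 1 m1.
under [EFin \o (fun x => w x * 1)]eq_fun do rewrite mulr1.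
by apply => x; rewrite normr1.
Qed.

Lemma dotv_sq_le (b x : 'rV[R]_n) : dotv b x ^+ 2 <= qform S b b * qform P x x.
Proof.
rewrite dotv_qform; apply: le_trans (qform_CS _ _ Qinf_inv_posdef) _.
rewrite (_ : qform P (b *m S) (b *m S) = qform S b b)//.
by rewrite /qform trmx_mul Sp.1 mulmxA mulmxK ?Qinf_unit// mulmxA.
Qed.

(** Half of the exponent absorbs the polynomial, since [q * expR (- (q / 4)) <= 4]; the other half
    is the Gaussian of [2^-1 *: P], which is integrable. *)
Lemma integrable_rho_qform (c K : R) :
  L.-integrable setT (EFin \o (fun x => w x * (c + K * qform P x x))).
Proof.
pose D := `|c| + `|K| * 4.
have D0 : 0 <= D by rewrite addr_ge0// mulr_ge0.
have P2 : posdefmx (2^-1 *: P).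
  have [Ps Pp] := Qinf_inv_posdef; split; first by rewrite linearZ /= Ps.
  move=> x xn0; have -> : qform (2^-1 *: P) x x = 2^-1 * qform P x x.
    by rewrite /qform -scalemxAr -scalemxAl mxE.
  by rewrite mulr_gt0// Pp.
have ig := integrableZl measurableT (rho_const * D) (integrable_gaussn P2).
apply: le_integrable ig => //.
  apply/measurable_EFinP; apply: measurable_funM; first exact: measurable_rho.
  apply: measurable_funD => //; apply: measurable_funM => //.
  exact: measurable_qform_diag.
move=> x _; rewrite lee_fin [leRHS]ger0_norm; last first.
  by rewrite !mulr_ge0// ?(ltW rho_const_gt0)// expR_ge0.
rewrite normrM (ger0_norm (ltW (rho_gt0 x))) rhoE -!mulrA ler_pM2l ?rho_const_gt0//.
set q := qform P x x.
have q0 : 0 <= q by exact/posdef_qform_ge0/Qinf_inv_posdef.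
have gE : gaussn P x = gaussn (2^-1 *: P) x * expR (- (q / 4)).
  rewrite /gaussn -expRD; congr expR.
  rewrite (_ : qform (2^-1 *: P) x x = 2^-1 * q); first by rewrite -/q; field.
  by rewrite /qform -scalemxAr -scalemxAl mxE.
rewrite gE mulrAC [leRHS]mulrC -mulrA ler_pM2l ?expR_gt0//.
have e1 : expR (- (q / 4)) <= 1 by rewrite -[leRHS]expR0 ler_expR oppr_le0 divr_ge0.
have e2 : q * expR (- (q / 4)) <= 4.
  rewrite expRN ler_pdivrMr ?expR_gt0//.
  by have := expR_ge1Dx (q / 4); lra.
have e0 := expR_ge0 (- (q / 4)).
apply: (@le_trans _ _ ((`|c| + `|K| * q) * expR (- (q / 4)))).
  rewrite ler_wpM2r//; apply: le_trans (ler_normD _ _) _; rewrite lerD2l normrM.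
  by rewrite ler_wpM2l// ger0_norm.
rewrite mulrDl /D lerD//; first by rewrite ler_piMr.
by rewrite -!mulrA !ler_wpM2l.
Qed.

Lemma line_derive_rho (i : 'I_n) :
  line_derive i w (fun x => - (x *m P) 0 i * w x).
Proof.
move=> x t; set e : 'rV[R]_n := delta_mx 0 i.
have Pe (y : 'rV[R]_n) : qform P y e = (y *m P) 0 i.
  by rewrite /qform /e trmx_delta -colE mxE.
have E (s : R) : w (x + s *: e) = rho_const *
    expR (- 2^-1 * (qform P x x + 2 * s * (x *m P) 0 i + s ^+ 2 * (e *m P) 0 i)).
  rewrite rhoE /gaussn; congr (_ * expR (_ * _)).
  rewrite !(qformDl, qformDr, qformZl, qformZr) (qformC e x Qinf_inv_sym) !Pe.
  ring.
have E2 : ((x + t *: e) *m P) 0 i = (x *m P) 0 i + t * (e *m P) 0 i.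
  by rewrite mulmxDl -scalemxAl !mxE.
rewrite E2 E (_ : (fun s : R => _) = fun s : R => rho_const *
    expR (- 2^-1 * (qform P x x + 2 * s * (x *m P) 0 i + s ^+ 2 * (e *m P) 0 i))); last first.
  by apply/funext => s; rewrite E.
set a := qform P x x; set b := (x *m P) 0 i; set c := (e *m P) 0 i.
have h := is_derive1_comp (is_derive_expR _) (quadratic_is_derive a b c t).
by apply: is_derive_eq (is_derive_mulr_cst rho_const h) _; ring.
Qed.

End gaussian_density.

Lemma line_derive_sum (R : realType) n m (i : 'I_n) (u v : 'I_m -> 'rV[R]_n -> R) :
  (forall k, line_derive i (u k) (v k)) ->
  line_derive i (fun x => \sum_k u k x) (fun x => \sum_k v k x).
Proof. by move=> H x t; apply: is_derive_sum_fun => k; exact: H. Qed.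

(** One derivative in each direction is what [null_integral_line_derive] asks of the highest
    derivative that occurs. *)
Definition line_smooth (R : realType) n (u : 'rV[R]_n -> R) : Prop :=
  box_bounded u /\ forall i, exists v, line_derive i u v.

Section line_smooth.
Context (R : realType) (n : nat).
Implicit Types u v : 'rV[R]_n -> R.

Lemma line_smoothM u v : line_smooth u -> line_smooth v -> line_smooth (fun x => u x * v x).
Proof.
move=> [bu Hu] [bv Hv]; split; first exact: box_boundedM.
move=> i; have [u' uu'] := Hu i; have [v' vv'] := Hv i; eexists; exact: line_deriveM.
Qed.

Lemma line_smoothD u v : line_smooth u -> line_smooth v -> line_smooth (fun x => u x + v x).
Proof.
move=> [bu Hu] [bv Hv]; split; first exact: box_boundedD.
move=> i; have [u' uu'] := Hu i; have [v' vv'] := Hv i; eexists; exact: line_deriveD.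
Qed.

Lemma line_smooth_cst (c : R) : line_smooth (fun _ : 'rV[R]_n => c).
Proof.
split; first exact: box_bounded_cst.
by move=> i; eexists; exact: line_derive_cst.
Qed.

Lemma line_smoothN u : line_smooth u -> line_smooth (fun x => - u x).
Proof.
move=> su; rewrite (_ : (fun _ => _) = fun x => -1 * u x).
  by apply: line_smoothM su; exact: line_smooth_cst.
by apply/funext => x; rewrite mulN1r.
Qed.

Lemma line_smooth_coord (j : 'I_n) : line_smooth (fun x : 'rV[R]_n => x 0 j).
Proof.
split; first exact: box_bounded_coord.
by move=> i; eexists; exact: line_derive_coord.
Qed.

Lemma line_smooth_sum m (u : 'I_m -> 'rV[R]_n -> R) :
  (forall k, line_smooth (u k)) -> line_smooth (fun x => \sum_k u k x).
Proof.
elim: m u => [|m IH] u Hu.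
  by under eq_fun do rewrite big_ord0; exact: line_smooth_cst.
under eq_fun do rewrite big_ord_recl.
by apply: line_smoothD => //; apply: IH.
Qed.

Lemma line_smooth_mulmx (M : 'M[R]_n) (j : 'I_n) :
  line_smooth (fun x : 'rV[R]_n => (x *m M) 0 j).
Proof.
under eq_fun do rewrite mxE.
apply: line_smooth_sum => k; apply: line_smoothM; first exact: line_smooth_coord.
exact: line_smooth_cst.
Qed.

Lemma line_derive_mulmx (M : 'M[R]_n) (i j : 'I_n) :
  line_derive i (fun x : 'rV[R]_n => (x *m M) 0 j) (fun=> M i j).
Proof.
have H : line_derive i (fun x : 'rV[R]_n => \sum_k x 0 k * M k j)
    (fun x => \sum_k ((i == k)%:R * M k j + x 0 k * 0)).
  apply: line_derive_sum => k; apply: line_deriveM; first exact: line_derive_coord.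
  exact: line_derive_cst.
rewrite (_ : (fun x => _) = fun x : 'rV[R]_n => \sum_k x 0 k * M k j); last first.
  by apply/funext => x; rewrite mxE.
move=> x t; apply: is_derive_eq (H x t) _.
rewrite (bigD1 i)//= big1 ?eqxx ?mulr0 ?addr0 ?mul1r// => k ki.
by rewrite eq_sym (negPf ki) mul0r mulr0 addr0.
Qed.

(** Integration by parts: the integrand is a combination of the total derivatives [d_i (f d_j phi)],
    [d_j (D1_i phi)] and [d_i (f x_j phi)], called [u], [v], [z] in the proof, with weights
    [Q i j / 2], [- Q i j / 2] and [B i j]. *)
Lemma FP_transpose_null (Q B : 'M[R]_n) (f : 'rV[R]_n -> R) (D1 : 'I_n -> 'rV[R]_n -> R)
    (D2 : 'I_n -> 'I_n -> 'rV[R]_n -> R) (phi : 'rV[R]_n -> R) :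
  line_smooth f -> (forall i, line_smooth (D1 i)) -> (forall i j, line_smooth (D2 i j)) ->
  (forall i, line_derive i f (D1 i)) -> (forall i j, line_derive j (D1 i) (D2 i j)) ->
  test_function phi ->
  null_integral (fun x => f x * FP_transpose Q B phi x -
    (2^-1 * (\sum_i \sum_j Q i j * D2 i j x) - \sum_i \sum_j B i j * (x 0 j * D1 i x)
      - \tr B * f x) * phi x).
Proof.
move=> sf sD1 sD2 fD1 D1D2 tphi.
have bphi s := test_function_box_supported s tphi.
have dphi s i := test_function_line_derive s i tphi.
pose u i j x := (D1 i x * partial j phi x + f x * partial i (partial j phi) x).
pose v i j x := (D2 i j x * phi x + D1 i x * partial j phi x).
pose z i j x := (D1 i x * (x 0 j * phi x) +
  f x * ((i == j)%:R * phi x + x 0 j * partial i phi x)).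
have nu i j : null_integral (u i j).
  apply: (@null_integral_line_derive _ n i (fun x => f x * partial j phi x)).
  - by apply: box_supportedM; [exact: sf.1|exact: (bphi [:: j])].
  - apply: box_supportedD; apply: box_supportedM.
    + exact: (sD1 i).1.
    + exact: (bphi [:: j]).
    + exact: sf.1.
    + exact: (bphi [:: i; j]).
  - by apply: line_deriveM; [exact: fD1|exact: (dphi [:: j])].
  - apply: line_deriveD; apply: line_deriveM.
    + exact: D1D2.
    + exact: (dphi [:: j]).
    + exact: fD1.
    + exact: (dphi [:: i; j]).
have nv i j : null_integral (v i j).
  have [D3 HD3] := (sD2 i j).2 j.
  apply: (@null_integral_line_derive _ n j (fun x => D1 i x * phi x)).
  - by apply: box_supportedM; [exact: (sD1 i).1|exact: (bphi [::])].
  - apply: box_supportedD; apply: box_supportedM.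
    + exact: (sD2 i j).1.
    + exact: (bphi [::]).
    + exact: (sD1 i).1.
    + exact: (bphi [:: j]).
  - by apply: line_deriveM; [exact: D1D2|exact: (dphi [::])].
  - apply: line_deriveD; apply: line_deriveM.
    + exact: HD3.
    + exact: (dphi [::]).
    + exact: D1D2.
    + exact: (dphi [:: j]).
have nz i j : null_integral (z i j).
  have lz : line_derive i (fun x => x 0 j * phi x)
      (fun x => (i == j)%:R * phi x + x 0 j * partial i phi x).
    by apply: line_deriveM; [exact: line_derive_coord|exact: (dphi [::])].
  have bz : box_supported (fun x => x 0 j * phi x).
    by apply: box_supportedM; [exact: box_bounded_coord|exact: (bphi [::])].
  have bz' : box_supported (fun x => (i == j)%:R * phi x + x 0 j * partial i phi x).
    apply: box_supportedD; apply: box_supportedM.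
    + exact: box_bounded_cst.
    + exact: (bphi [::]).
    + exact: box_bounded_coord.
    + exact: (bphi [:: i]).
  apply: (@null_integral_line_derive _ n i (fun x => f x * (x 0 j * phi x))).
  - by apply: box_supportedM bz; exact: sf.1.
  - by apply: box_supportedD; apply: box_supportedM => //; [exact: (sD1 i).1|exact: sf.1].
  - exact: line_deriveM.
  - apply: line_deriveD; apply: line_deriveM; [exact: D1D2|exact: lz|exact: fD1|].
    apply: line_deriveD; apply: line_deriveM.
    + exact: line_derive_cst.
    + exact: (dphi [::]).
    + exact: line_derive_coord.
    + exact: (dphi [:: i]).
rewrite (_ : (fun x => _) = fun x => \sum_i \sum_j
    (2^-1 * Q i j * (u i j x + -1 * v i j x) + B i j * z i j x)).
  apply: null_integral_sum => i; apply: null_integral_sum => j.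
  apply: null_integralD; apply: null_integralZ => //.
  by apply: null_integralD => //; apply: null_integralZ.
apply/funext => x; rewrite /FP_transpose.
have -> : \sum_i \sum_j B i j * partial i (fun y => y 0 j * phi y) x =
    \tr B * phi x + \sum_i \sum_j B i j * (x 0 j * partial i phi x).
  transitivity (\sum_i \sum_j (B i j * ((i == j)%:R * phi x) +
      B i j * (x 0 j * partial i phi x))).
    apply: eq_bigr => i _; apply: eq_bigr => j _; rewrite -mulrDr; congr (_ * _).
    apply: (line_derive_partialE (v := fun x => (i == j)%:R * phi x + x 0 j * partial i phi x)).
    by apply: line_deriveM; [exact: line_derive_coord|exact: (dphi [::])].
  under eq_bigr do rewrite big_split.
  rewrite big_split /=; congr (_ + _); rewrite /mxtrace mulr_suml; apply: eq_bigr => i _.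
  rewrite (bigD1 i)//= big1 ?eqxx ?mul1r ?addr0// => j ji.
  by rewrite eq_sym (negPf ji) mul0r mulr0.
have -> : \tr B * f x = \sum_i \sum_j B i j * ((i == j)%:R * f x).
  rewrite /mxtrace mulr_suml; apply: eq_bigr => i _.
  rewrite (bigD1 i)//= big1 ?eqxx ?mul1r ?addr0// => j ji.
  by rewrite eq_sym (negPf ji) mul0r mulr0.
rewrite !pair_big /=.
set S1 := \sum_p _; set S2 := \sum_p _; set S3 := \sum_p _; set S4 := \sum_p _;
  set S5 := \sum_p _.
transitivity (f x * 2^-1 * S1 + f x * S2 + - (2^-1 * phi x) * S3 + phi x * S4 + phi x * S5).
  by ring.
rewrite /S1 /S2 /S3 /S4 /S5 !mulr_sumr -!big_split /=.
by apply: eq_bigr => -[i j] _; rewrite /u /v /z /=; ring.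
Qed.

End line_smooth.

Lemma mx11_tr (R : Type) (M : 'M[R]_1) : M^T 0 0 = M 0 0.
Proof. by rewrite mxE. Qed.

Section plane_waves.
Context (R : realType) (n : nat) (Q B : 'M[R]_n).
Let S := Qinf Q B.
Hypothesis Sp : posdefmx S.
Hypothesis lyap : B *m S + S *m B^T = - Q.
Let P := invmx S.
Notation L := (lebesgue_rV R n).
Notation w := (rho Q B).
Implicit Types (b x : 'rV[R]_n) (th : R).

(** The phase unifies the real part ([th = 0]) and the imaginary part ([th = - (pi / 2)]) of a wave,
    and differentiating the cosine advances it by [pi / 2]. *)
Definition gwave b th x : R := w x * cos (dotv b x + th).

(* P (wave b) = (- qform Q b b / 2 + i <drift_row b, x>) wave b, the derivative of
   t |-> wave (b t) along a solution of b' = drift_row b. *)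
Definition drift_row b : 'rV[R]_n := b *m S *m B^T *m P.

Definition gwaveP b th x : R :=
  - 2^-1 * qform Q b b * gwave b th x + dotv (drift_row b) x * gwave b (th + pi / 2) x.

Lemma cosDpi2 (t : R) : cos (t + pi / 2) = - sin t.
Proof. by rewrite cosD cos_pihalf sin_pihalf mulr0 mulr1 sub0r. Qed.

Lemma cosDpi (t : R) : cos (t + pi) = - cos t.
Proof. by rewrite cosD cospi sinpi mulr0 mulrN1 subr0. Qed.

Lemma rho_le x : `|w x| <= rho_const Q B.
Proof.
rewrite rhoE normrM !ger0_norm ?expR_ge0 ?(ltW (rho_const_gt0 Sp))//.
rewrite ler_piMr ?(ltW (rho_const_gt0 Sp))// -[leRHS]expR0 ler_expR mulNr oppr_le0.
by rewrite mulr_ge0// posdef_qform_ge0//; exact: Qinf_inv_posdef.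
Qed.

Lemma measurable_cos_dotv b th : measurable_fun setT (fun x => cos (dotv b x + th)).
Proof.
have mc : measurable_fun setT (@cos R) by apply: continuous_measurable_fun; exact: continuous_cos.
have mq : measurable_fun setT (fun x : 'rV[R]_n => dotv b x + th).
  by apply: measurable_funD => //; exact: measurable_dotv.
exact: (measurableT_comp mc mq).
Qed.

Lemma measurable_gwave b th : measurable_fun setT (gwave b th).
Proof.
have mr := measurable_rho Q B; have mc := measurable_cos_dotv b th.
exact: (measurable_funM mr mc).
Qed.

Lemma line_derive_gwave b th (i : 'I_n) :
  line_derive i (gwave b th)
    (fun x => - (x *m P) 0 i * gwave b th x + b 0 i * gwave b (th + pi / 2) x).
Proof.
have := line_deriveM (line_derive_rho Sp i) (line_derive_cos_dotv i b th).
rewrite (_ : (fun x => _ + _) = (fun x => - (x *m P) 0 i * gwave b th x +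
  b 0 i * gwave b (th + pi / 2) x))//.
by apply/funext => x; rewrite /gwave addrA cosDpi2; ring.
Qed.

Lemma line_smooth_gwave b th : line_smooth (gwave b th).
Proof.
split; last by move=> i; eexists; exact: line_derive_gwave.
apply: (box_bounded_bounded (C := rho_const Q B)); first exact: measurable_gwave.
move=> x; rewrite normrM -[leRHS]mulr1 ler_pM//; first exact: rho_le.
exact: cos_max.
Qed.

(** The Lyapunov equation does the cancelling: [tr (Q P) = - 2 tr B] removes the zeroth-order term,
    [qform Q y y = - 2 qform B y x] removes the term quadratic in [x], and of the mixed terms one
    survives as the drift. *)
Lemma gwavePE b th x (y := x *m P) :
  gwaveP b th x =
  2^-1 * (\sum_i \sum_j Q i j * (- P j i * gwave b th x
     - y 0 i * (- y 0 j * gwave b th x + b 0 j * gwave b (th + pi / 2) x)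
     + b 0 i * (- y 0 j * gwave b (th + pi / 2) x - b 0 j * gwave b th x)))
  - \sum_i \sum_j B i j * (x 0 j * (- y 0 i * gwave b th x + b 0 i * gwave b (th + pi / 2) x))
  - \tr B * gwave b th x.
Proof.
set G := gwave b th x; set G' := gwave b (th + pi / 2) x.
have Su := Qinf_unit Sp.
have trE : \sum_i \sum_j Q i j * P j i = - (2 * \tr B).
  transitivity (\tr (Q *m P)).
    by apply: eq_bigr => i _; rewrite mxE; apply: eq_bigr.
  rewrite (_ : Q = - (B *m S + S *m B^T)); last by rewrite lyap opprK.
  rewrite mulNmx mulmxDl mulmxK// linearN linearD /=; congr (- _).
  by rewrite [X in _ + X]mxtrace_mulC mulmxA mulVmx// mul1mx mxtrace_tr mulr2n mulrDl mul1r.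
pose q u v := qform (B *m S) u v.
have Qq u v : qform Q u v = - (q u v + q v u).
  rewrite (_ : Q = - (B *m S + S *m B^T)); last by rewrite lyap opprK.
  rewrite /q /qform mulmxN mulNmx mxE; congr (- _).
  rewrite mulmxDr mulmxDl mxE; congr (_ + _).
  by rewrite -mx11_tr !trmx_mul !trmxK Sp.1 !mulmxA.
have xE : x = y *m S by rewrite /y mulmxKV.
have Bq u : qform B u x = q u y.
  by rewrite /q /qform xE trmx_mul Sp.1 !mulmxA.
have dE : dotv (drift_row b) x = q y b.
  rewrite /dotv /drift_row /q /qform.
  by rewrite -mx11_tr !trmx_mul !trmxK (Qinf_inv_sym Sp) Sp.1 !mulmxA.
rewrite /gwaveP -/G -/G' dE.
transitivity (2^-1 * (- (\sum_i \sum_j Q i j * P j i) * G + qform Q y y * G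
   - qform Q y b * G' - qform Q b y * G' - qform Q b b * G)
   + qform B y x * G - qform B b x * G' - \tr B * G).
  by rewrite trE !Qq !Bq; field.
rewrite !qformE !pair_big /= -!addrA; congr (_ + _).
  rewrite !mulNr !mulr_suml -!sumrN -!big_split mulr_sumr mulr_sumr /=.
  by apply: eq_bigr => -[i j] _ /=; ring.
rewrite !addrA; congr (_ - _); rewrite !mulr_suml -!sumrN -!big_split /=.
by apply: eq_bigr => -[i j] _ /=; ring.
Qed.

Lemma gwave_weak b th (phi : 'rV[R]_n -> R) : test_function phi ->
  null_integral (fun x => gwave b th x * FP_transpose Q B phi x - gwaveP b th x * phi x).
Proof.
move=> tphi; pose G := gwave b th; pose G' := gwave b (th + pi / 2).
have sG t : line_smooth (gwave b t) by exact: line_smooth_gwave.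
have sy i : line_smooth (fun x : 'rV[R]_n => - (x *m P) 0 i).
  exact/line_smoothN/line_smooth_mulmx.
have dy i j : line_derive j (fun x : 'rV[R]_n => - (x *m P) 0 i) (fun=> - P j i).
  have := line_deriveM (line_derive_cst j (-1)) (line_derive_mulmx P j i).
  move=> h x t; have := h x t; under eq_fun do rewrite mulN1r.
  by rewrite mul0r add0r mulN1r.
have := @FP_transpose_null _ _ Q B G
  (fun i x => - (x *m P) 0 i * G x + b 0 i * G' x)
  (fun i j x => (- P j i * G x + - (x *m P) 0 i * (- (x *m P) 0 j * G x + b 0 j * G' x)) +
     (0 * G' x + b 0 i * (- (x *m P) 0 j * G' x + b 0 j * gwave b (th + pi / 2 + pi / 2) x)))
  phi.
move=> H; have /H {}H : line_smooth G by exact: sG.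
have /H {}H : forall i, line_smooth (fun x => - (x *m P) 0 i * G x + b 0 i * G' x).
  move=> i; apply: line_smoothD; apply: line_smoothM => //; try exact: sG.
  exact: line_smooth_cst.
have /H {}H : forall i j, line_smooth (fun x => (- P j i * G x + - (x *m P) 0 i * (- (x *m P) 0 j * G x + b 0 j * G' x)) +
     (0 * G' x + b 0 i * (- (x *m P) 0 j * G' x + b 0 j * gwave b (th + pi / 2 + pi / 2) x))).
  move=> i j.
  have sc c : line_smooth (fun _ : 'rV[R]_n => c : R) by exact: line_smooth_cst.
  by repeat first [exact: sc|exact: sy|exact: sG|apply: line_smoothD|apply: line_smoothM].
have /H {}H : forall i, line_derive i G (fun x => - (x *m P) 0 i * G x + b 0 i * G' x).
  by move=> i; exact: line_derive_gwave.
have {}H := H _ tphi.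
rewrite (_ : (fun x => _) = fun x => G x * FP_transpose Q B phi x -
  (2^-1 * (\sum_i \sum_j Q i j * ((- P j i * G x + - (x *m P) 0 i * (- (x *m P) 0 j * G x + b 0 j * G' x)) +
     (0 * G' x + b 0 i * (- (x *m P) 0 j * G' x + b 0 j * gwave b (th + pi / 2 + pi / 2) x))))
    - \sum_i \sum_j B i j * (x 0 j * (- (x *m P) 0 i * G x + b 0 i * G' x)) - \tr B * G x) * phi x).
  apply: H => i j; apply: line_deriveD; apply: line_deriveM.
  - exact: dy.
  - exact: line_derive_gwave.
  - exact: line_derive_cst.
  - exact: line_derive_gwave.
apply/funext => x; congr (_ - _ * _); rewrite gwavePE; congr (2^-1 * _ - _ - _).
apply: eq_bigr => i _; apply: eq_bigr => j _; congr (_ * _).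
have -> : gwave b (th + pi / 2 + pi / 2) x = - gwave b th x.
  by rewrite /gwave -addrA -splitr addrA cosDpi mulrN.
by rewrite -/(G x) -/(G' x); ring.
Qed.

Definition wave_const b : R := expR (2^-1 * qform S b b).

Definition wave b x : R[i] :=
  Complex (wave_const b * gwave b 0 x) (wave_const b * gwave b (- (pi / 2)) x).

Definition waveP b x : R[i] :=
  Complex (wave_const b * gwaveP b 0 x) (wave_const b * gwaveP b (- (pi / 2)) x).

Lemma measurable_gwaveP b th : measurable_fun setT (gwaveP b th).
Proof.
apply: measurable_funD; apply: measurable_funM => //; try exact: measurable_gwave.
exact: measurable_dotv.
Qed.

Lemma cos_dotv_sqD b x th :
  cos (dotv b x + th) ^+ 2 + cos (dotv b x + (th - pi / 2)) ^+ 2 = 1.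
Proof.
have -> : cos (dotv b x + (th - pi / 2)) = sin (dotv b x + th).
  by rewrite addrA cosB cos_pihalf sin_pihalf mulr0 mulr1 add0r.
exact: cos2Dsin2.
Qed.

Lemma normc_wave b x : Normc.normc (wave b x) ^+ 2 / w x = wave_const b ^+ 2 * w x.
Proof.
rewrite normc_sqE /= /gwave.
have := cos_dotv_sqD b x 0; rewrite sub0r.
set c := cos _; set s := cos _ => cs.
have w0 := lt0r_neq0 (rho_gt0 Sp x).
transitivity (wave_const b ^+ 2 * w x * (c ^+ 2 + s ^+ 2)); first by field.
by rewrite cs mulr1.
Qed.

Lemma normc_waveP b x : Normc.normc (waveP b x) ^+ 2 / w x =
  wave_const b ^+ 2 * (w x * (4^-1 * qform Q b b ^+ 2 + dotv (drift_row b) x ^+ 2)).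
Proof.
rewrite normc_sqE /= /gwaveP /gwave add0r addNr addr0.
have := cos_dotv_sqD b x 0; rewrite sub0r addr0.
have := cosB (dotv b x) (pi / 2); rewrite cosDpi2 cos_pihalf sin_pihalf mulr0 mulr1 add0r => ->.
set c := cos _; set s := sin _; set q := qform _ _ _; set d := dotv _ _ => cs.
have w0 := lt0r_neq0 (rho_gt0 Sp x).
transitivity (wave_const b ^+ 2 * (w x * ((4^-1 * q ^+ 2 + d ^+ 2) * (c ^+ 2 + s ^+ 2)))).
  by field.
by rewrite cs mulr1.
Qed.

Lemma inL2_wave b : inL2 w (wave b).
Proof.
split.
  by split; apply: measurable_funM => //; exact: measurable_gwave.
rewrite /sqnormL2; under eq_integral do rewrite normc_wave.
have := integrableZl measurableT (wave_const b ^+ 2) (integrable_rho Sp).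
by move=> /integrable_lty; apply.
Qed.

Lemma inL2_waveP b : inL2 w (waveP b).
Proof.
split.
  by split; apply: measurable_funM => //; exact: measurable_gwaveP.
rewrite /sqnormL2; under eq_integral do rewrite normc_waveP.
have ig := integrable_rho_qform Sp (4^-1 * qform Q b b ^+ 2) (qform S (drift_row b) (drift_row b)).
have := integrableZl measurableT (wave_const b ^+ 2) ig.
move=> /(integrable_lty measurableT); apply: le_lt_trans.
apply: ge0_le_integral => //.
- move=> x _; rewrite lee_fin mulr_ge0 ?sqr_ge0// mulr_ge0 ?(ltW (rho_gt0 Sp x))//.
  by rewrite addr_ge0 ?sqr_ge0// mulr_ge0 ?sqr_ge0.
- apply/measurable_EFinP; apply: measurable_funM => //.
  apply: measurable_funM; first exact: (measurable_rho Q B).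
  apply: measurable_funD => //; apply: measurable_funX; exact: measurable_dotv.
- apply/measurable_EFinP; apply: measurable_funM => //.
  apply: measurable_funM; first exact: (measurable_rho Q B).
  apply: measurable_funD => //; apply: measurable_funM => //; exact: measurable_qform_diag.
- move=> x _; rewrite lee_fin ler_wpM2l ?sqr_ge0// ler_pM2l ?rho_gt0// lerD2l.
  exact: dotv_sq_le.
Qed.

Lemma box_bounded_dotv b : box_bounded (dotv b).
Proof.
rewrite (_ : dotv b = fun x => \sum_i b 0 i * x 0 i); last exact/funext/dotvE.
apply: box_bounded_sum => i; apply: box_boundedM; first exact: box_bounded_cst.
exact: box_bounded_coord.
Qed.

Lemma wave_weak b : FP_weak Q B (wave b) (waveP b).
Proof.
move=> phi tphi.
have key th : \int[L]_x (gwave b th x * FP_transpose Q B phi x) =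
    \int[L]_x (gwaveP b th x * phi x) /\
    L.-integrable setT (EFin \o (fun x => gwave b th x * FP_transpose Q B phi x)) /\
    L.-integrable setT (EFin \o (fun x => gwaveP b th x * phi x)).
  have [ig i0] := gwave_weak b th tphi.
  have ip : L.-integrable setT (EFin \o (fun x => gwaveP b th x * phi x)).
    apply: box_supported_integrable; apply: box_supportedM.
      apply: box_boundedD; apply: box_boundedM.
      - exact: box_bounded_cst.
      - exact: (line_smooth_gwave b th).1.
      - exact: box_bounded_dotv.
      - exact: (line_smooth_gwave b _).1.
    exact: (test_function_box_supported [::] tphi).
  have E x : gwave b th x * FP_transpose Q B phi x =
    (gwave b th x * FP_transpose Q B phi x - gwaveP b th x * phi x) + gwaveP b th x * phi x.
    by rewrite subrK.
  under eq_Rintegral do rewrite E.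
  rewrite RintegralD// i0 add0r; split => //; split => //.
  have := integrableD measurableT ig ip.
  by congr (L.-integrable _ _); apply/funext => x /=; rewrite -EFinD subrK.
have [e0 [i0 j0]] := key 0; have [e1 [i1 j1]] := key (- (pi / 2)).
rewrite /cint /=; congr Complex.
- under eq_Rintegral do rewrite mulr0 subr0 -mulrA.
  under [RHS]eq_Rintegral do rewrite mulr0 subr0 -mulrA.
  by rewrite !RintegralZl// e0.
- under eq_Rintegral do rewrite mulr0 add0r -mulrA.
  under [RHS]eq_Rintegral do rewrite mulr0 add0r -mulrA.
  by rewrite !RintegralZl// e1.
Qed.

Lemma FP_graph_wave b : FP_graph Q B (wave b) (waveP b).
Proof. by split; [exact: inL2_wave|exact: inL2_waveP|exact: wave_weak]. Qed.

End plane_waves.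

(** * The semigroup on plane waves *)

Lemma at_right0_le (R : realType) (F : R -> \bar R) (c : R) :
  F h @[h --> (0 : R)^'+] --> 0%E -> 0 < c ->
  exists2 d : R, 0 < d & forall h, 0 < h < d -> (F h <= c%:E)%E.
Proof.
move=> /fine_cvgP[Ff /cvgrPdist_le Fc] c0.
have : \forall h \near (0 : R)^'+, (F h <= c%:E)%E.
  near=> h.
  have hf : F h \is a fin_num by near: h.
  have hc : `|0 - fine (F h)| <= c by near: h; exact: Fc.
  rewrite -(fineK hf) lee_fin; apply: le_trans (ler_norm _) _.
  by move: hc; rewrite sub0r normrN.
case => d /= d0 Hd; exists d => // h /andP[h0 hd].
by apply: Hd => //=; rewrite sub0r normrN gtr0_norm.
Unshelve. all: by end_near.
Qed.

Section C0_semigroup.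
Context (R : realType) (n : nat) (w : 'rV[R]_n -> R).
Hypothesis w_gt0 : forall x, 0 < w x.
Hypothesis mw : measurable_fun setT w.
Variable T : R -> ('rV[R]_n -> R[i]) -> ('rV[R]_n -> R[i]).
Hypothesis hT : C0_semigroup w T.
Implicit Types f g : 'rV[R]_n -> R[i].

Lemma C0_linear_normL2 t a f g : 0 <= t -> inL2 w f -> inL2 w g ->
  normL2 w (T t (a *: f + g) - (a *: T t f + T t g)) = 0.
Proof.
move=> t0 Hf Hg; apply: (normL2_ae_eq0 w_gt0 mw).
- by apply: (C0_stable hT) => //; apply: (inL2D w_gt0 mw) => //; exact: inL2Z.
- by apply: (inL2D w_gt0 mw); [apply: inL2Z => //|]; exact: (C0_stable hT).
- exact: (C0_linear hT).
Qed.

Lemma C0_bounded_normL2 t : 0 <= t ->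
  exists M, forall f, inL2 w f -> normL2 w (T t f) <= M * normL2 w f.
Proof.
move=> t0; have [M HM] := C0_bounded hT t0; exists (Num.sqrt `|M|) => f Hf.
apply: normL2_le_of_sq => //; first exact: (C0_stable hT).
  by rewrite mulr_ge0// ?normL2_ge0// sqrtr_ge0.
apply: le_trans (HM _ Hf) _; rewrite (sqnormL2E w_gt0 Hf) -EFinM lee_fin exprMn.
have -> : Num.sqrt `|M| ^+ 2 = `|M| by exact: sqr_sqrtr.
by rewrite ler_wpM2r ?sqr_ge0// ler_norm.
Qed.

Lemma C0_cvg_normL2 f : inL2 w f -> forall e : R, 0 < e ->
  exists2 d : R, 0 < d & forall h, 0 < h < d -> normL2 w (T h f - f) <= e.
Proof.
move=> Hf e e0; have [d d0 Hd] := at_right0_le (C0_cvg hT Hf) (exprn_gt0 2 e0).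
exists d => // h hd; apply: normL2_le_of_sq => //; last exact: Hd; last exact: ltW.
by apply: (inL2B w_gt0 mw) => //; apply: (C0_stable hT) => //; have /andP[/ltW] := hd.
Qed.

Lemma generator_normL2 f g : generator_graph w T f g -> forall e : R, 0 < e ->
  exists2 d : R, 0 < d &
    forall h : R, 0 < h < d -> normL2 w (T h f - f - h%:C%C *: g) <= e * h.
Proof.
move=> [Hf Hg cfg] e e0; have [d d0 Hd] := at_right0_le cfg (exprn_gt0 2 e0).
exists d => // h /[dup] hd /andP[h0 _].
have HT : inL2 w (T h f) by apply: (C0_stable hT) => //; exact: ltW.
have H1 : inL2 w (h^-1%:C%C *: (T h f - f) - g).
  by apply: (inL2B w_gt0 mw) => //; apply: inL2Z => //; exact: (inL2B w_gt0 mw).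
have -> : T h f - f - h%:C%C *: g = h%:C%C *: (h^-1%:C%C *: (T h f - f) - g).
  rewrite scalerBr scalerA (_ : h%:C%C * _ = 1) ?scale1r//.
  by rewrite -rmorphM /= divff ?gt_eqF.
rewrite normL2Z// normc_real gtr0_norm// mulrC ler_pM2r//.
apply: normL2_le_of_sq => //; [exact: ltW|exact: Hd].
Qed.

Lemma C0_cauchy_unique (u v : R -> 'rV[R]_n -> R[i]) t : 0 <= t ->
  (forall s, 0 <= s -> generator_graph w T (u s) (v s)) ->
  (forall s e : R, 0 <= s -> 0 < e -> exists2 d : R, 0 < d &
    forall h : R, 0 < h < d -> normL2 w (u (s + h) - u s - h%:C%C *: v s) <= e * h) ->
  (forall s e : R, 0 < s -> 0 < e -> exists2 d : R, 0 < d &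
    forall h : R, 0 < h < d -> h <= s -> normL2 w (u (s - h) - u s) <= e) ->
  normL2 w (T t (u 0) - u t) = 0.
Proof.
move=> t0 uv du lu; apply: (@sg_cauchy_unique _ _ (inL2 w) (normL2 w) _ _ _ _ _ _ _ T _ _ _ _ _ _ u v).
- exact: inL2D.
- exact: inL2Z.
- by exists 0; exact: inL2_0.
- exact: normL2_ge0.
- exact: normL2D.
- exact: normL2Z.
- exact: L2_complete.
- by move=> s f s0 Hf; exact: (C0_stable hT).
- exact: C0_linear_normL2.
- exact: C0_bounded_normL2.
- move=> f Hf; apply: (normL2_ae_eq0 w_gt0 mw) => //; last exact: (C0_0 hT).
  exact: (C0_stable hT).
- move=> s r f s0 r0 Hf; apply: (normL2_ae_eq0 w_gt0 mw); last exact: (C0_D hT).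
    by apply: (C0_stable hT) => //; exact: addr_ge0.
  by do !apply: (C0_stable hT) => //.
- exact: C0_cvg_normL2.
- by [].
- by move=> s /uv[].
- by move=> s /uv[].
- exact: du.
- by move=> s e s0 e0; exact: (generator_normL2 (uv s s0)).
- exact: lu.
Qed.

End C0_semigroup.

Lemma sqrB_sym (R : comPzRingType) (a b : R) : (a - b) ^+ 2 = (b - a) ^+ 2.
Proof. by ring. Qed.

Lemma normcB_sq_weighted (R : realType) (v a b c d : R) (z u : R[i]) : v != 0 ->
  z = Complex (v * a) (v * c) -> u = Complex (v * b) (v * d) ->
  Normc.normc (z - u) ^+ 2 / v = v * ((a - b) ^+ 2 + (c - d) ^+ 2).
Proof. by move=> v0 -> ->; rewrite normc_sqE /=; field. Qed.

Lemma normc_quotient_sq_weighted (R : realType) (v h a b c d p q : R) (z u y : R[i]) :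
  v != 0 -> h != 0 ->
  z = Complex (v * a) (v * c) -> u = Complex (v * b) (v * d) ->
  y = Complex (v * p) (v * q) ->
  Normc.normc (z - u - h%:C%C * y) ^+ 2 / v =
  h ^+ 2 * (v * ((h^-1 * (a - b) - p) ^+ 2 + (h^-1 * (c - d) - q) ^+ 2)).
Proof.
move=> v0 h0 -> -> ->; rewrite normc_sqE /= !mul0r subr0 addr0.
by field; rewrite v0 h0.
Qed.

(** * Time evolution of a wave *)

Section flow.
Context (R : realType) (n : nat) (Q B : 'M[R]_n).
Let S := Qinf Q B.
Hypothesis Sp : posdefmx S.
Hypothesis Qp : psdmx Q.
Hypothesis lyap : B *m S + S *m B^T = - Q.
Let P := invmx S.
Notation L := (lebesgue_rV R n).
Notation w := (rho Q B).
Implicit Types (b x : 'rV[R]_n) (th : R).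

(** Row form of [Q_oo^{-1} e^{tB} Q_oo b]: transposition reverses the product and turns [B] into
    [B^T]. *)
Definition flow b (t : R) : 'rV[R]_n := b *m S *m expmx (t *: B^T) *m P.

Lemma qform_lyapunov b c :
  qform Q b c = - (qform (B *m S) b c + qform (B *m S) c b).
Proof.
have e : qform (B *m S) c b = qform (S *m B^T) b c.
  by rewrite /qform -mx11_tr !trmx_mul !trmxK Sp.1 !mulmxA.
rewrite e (_ : Q = - (B *m S + S *m B^T)); last by rewrite lyap opprK.
by rewrite /qform mulmxN mulNmx mxE mulmxDr mulmxDl mxE.
Qed.

Lemma qform_drift_row b c : qform S (drift_row Q B b) c = qform (B *m S) c b.
Proof.
rewrite /qform /drift_row mulmxKV ?(Qinf_unit Sp)//.
by rewrite -mx11_tr !trmx_mul !trmxK Sp.1 !mulmxA.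
Qed.

Lemma flow0 b : flow b 0 = b.
Proof. by rewrite /flow expmx0 mulmx1 mulmxK// (Qinf_unit Sp). Qed.

(** [drift_row] generates the linear flow and so commutes with it; bounds on the flow thereby apply
    to its velocity as well. *)
Lemma drift_row_flow b t : drift_row Q B (flow b t) = flow (drift_row Q B b) t.
Proof.
have Su := Qinf_unit Sp.
by rewrite /drift_row /flow !mulmxKV// -!mulmxA; congr (_ *m (_ *m _)); rewrite !mulmxA expmx_comm.
Qed.

Lemma is_derive_flow b (t : R) i :
  is_derive t 1 (fun s => flow b s 0 i) (drift_row Q B (flow b t) 0 i).
Proof.
have H : is_derive t 1 (fun s => \sum_l \sum_k P l i * ((b *m S) 0 k * expmx (s *: B^T) k l))
    (\sum_l \sum_k P l i * ((b *m S) 0 k * (B^T *m expmx (t *: B^T)) k l)).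
  apply: is_derive_sum_fun => l; apply: is_derive_sum_fun => k.
  by do 2 apply: is_derive_mulr_cst; exact: is_derive_expmx.
rewrite (_ : (fun s => _) = (fun s => \sum_l \sum_k P l i * ((b *m S) 0 k * expmx (s *: B^T) k l))); last first.
  apply/funext => s; rewrite /flow mxE; apply: eq_bigr => l _.
  by rewrite mxE mulr_suml; apply: eq_bigr => k _; rewrite mulrC.
apply: is_derive_eq H _.
rewrite drift_row_flow /flow /drift_row mulmxKV ?(Qinf_unit Sp)//.
rewrite -(mulmxA (b *m S)) mxE; apply: eq_bigr => l _.
by rewrite mxE mulr_suml; apply: eq_bigr => k _; rewrite mulrC.
Qed.

Lemma is_derive_dotv_flow b x (t : R) :
  is_derive t 1 (fun s => dotv (flow b s) x) (dotv (drift_row Q B (flow b t)) x).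
Proof.
rewrite dotvE (_ : (fun s => _) = fun s => \sum_i x 0 i * flow b s 0 i); last first.
  by apply/funext => s; rewrite dotvE; apply: eq_bigr => i _; rewrite mulrC.
under eq_bigr do rewrite mulrC.
by apply: is_derive_sum_fun => i; apply: is_derive_mulr_cst; exact: is_derive_flow.
Qed.

Lemma is_derive_qform_flow b (t : R) :
  is_derive t 1 (fun s => qform S (flow b s) (flow b s)) (- qform Q (flow b t) (flow b t)).
Proof.
set c := flow b t; set c' := drift_row Q B c.
have H : is_derive t 1 (fun s => \sum_i \sum_j S i j * (flow b s 0 i * flow b s 0 j))
    (\sum_i \sum_j S i j * (c' 0 i * c 0 j + c 0 i * c' 0 j)).
  apply: is_derive_sum_fun => i; apply: is_derive_sum_fun => j; apply: is_derive_mulr_cst.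
  have hi := is_derive_flow b t i; have hj := is_derive_flow b t j.
  by apply: is_derive_eq; rewrite /GRing.scale /= -/c -/c'; ring.
rewrite (_ : (fun s => _) = fun s => \sum_i \sum_j S i j * (flow b s 0 i * flow b s 0 j)); last first.
  by apply/funext => s; rewrite qformE.
apply: is_derive_eq H _.
transitivity (qform S c' c + qform S c c').
  rewrite !qformE -big_split; apply: eq_bigr => i _; rewrite -big_split.
  by apply: eq_bigr => j _; rewrite mulrDr.
by rewrite (qformC c) ?Sp.1// qform_drift_row qform_lyapunov opprK.
Qed.

(** Dissipation: along the flow [qform S] has derivative [- qform Q <= 0]. This is where [G_t <= G]
    comes from, with constant exactly 1, as the higher powers of the Gram matrices require. *)
Lemma qform_flow_le b t : 0 <= t ->
  qform S (flow b t) (flow b t) <= qform S b b.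
Proof.
move=> t0; rewrite -[in leRHS](flow0 b).
apply: (@ge0_derive_le _ (fun s => qform S (flow b s) (flow b s))) => //.
  by move=> s; exact: is_derive_qform_flow.
by move=> s _; rewrite oppr_le0; exact: Qp.2.
Qed.

(** A wave along the flow divided by [rho]: at fixed [x] its time dependence is a scalar function,
    to which the mean value theorem applies. *)
Definition wave_phase b th x t : R :=
  wave_const Q B (flow b t) * cos (dotv (flow b t) x + th).

Definition wave_phase' b th x t : R :=
  wave_const Q B (flow b t) *
  (- 2^-1 * qform Q (flow b t) (flow b t) * cos (dotv (flow b t) x + th) +
   dotv (drift_row Q B (flow b t)) x * cos (dotv (flow b t) x + (th + pi / 2))).

Lemma is_derive_wave_phase b th x (t : R) :
  is_derive t 1 (wave_phase b th x) (wave_phase' b th x t).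
Proof.
have h1 := is_derive1_comp (is_derive_expR _)
  (is_derive_mulr_cst 2^-1 (is_derive_qform_flow b t)).
have h2 : is_derive t 1 (fun s => dotv (flow b s) x + th) (dotv (drift_row Q B (flow b t)) x).
  have := is_deriveD (is_derive_dotv_flow b x t) (is_derive_cst th t (1 : R)).
  by rewrite addr0.
have h3 := is_derive1_comp (is_derive_cos _) h2.
apply: is_derive_eq (is_deriveM h1 h3) _.
rewrite /wave_phase' /GRing.scale /= addrA cosDpi2 /wave_const -/S.
set k := expR _; set c := cos _; set s := sin _; set q := qform _ _ _; set d := dotv _ _.
by ring.
Qed.

(** A majorant, uniform in time, of the squared time derivative: [qform S] of the flow and of its
    velocity only decrease. It is quadratic in [x], hence integrable against [rho]. *)
Definition wave_bound b x : R :=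
  wave_const Q B b ^+ 2 * (2 * qform S b b * qform S (drift_row Q B b) (drift_row Q B b)
    + 2 * qform S (drift_row Q B b) (drift_row Q B b) * qform P x x).

Lemma wave_phase'_bound b th x t : 0 <= t ->
  wave_phase' b th x t ^+ 2 <= wave_bound b x.
Proof.
move=> t0; rewrite /wave_phase' /wave_bound exprMn.
set c := flow b t; set c' := drift_row Q B b.
have qc : qform S c c <= qform S b b by exact: qform_flow_le.
have qc' : qform S (drift_row Q B c) (drift_row Q B c) <= qform S c' c'.
  by rewrite drift_row_flow; exact: qform_flow_le.
have q0 v : 0 <= qform S v v by exact: posdef_qform_ge0.
have P0 : 0 <= qform P x x by exact/posdef_qform_ge0/Qinf_inv_posdef.
have kb : wave_const Q B c ^+ 2 <= wave_const Q B b ^+ 2.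
  by rewrite lerXn2r ?nnegrE ?expR_ge0// ler_expR ler_pM2l.
have qQ : (2^-1 * qform Q c c) ^+ 2 <= qform S b b * qform S c' c'.
  have -> : 2^-1 * qform Q c c = - qform S (drift_row Q B c) c.
    by rewrite qform_drift_row qform_lyapunov; field.
  rewrite sqrrN; apply: le_trans (qform_CS _ _ Sp) _; rewrite mulrC.
  by rewrite ler_pM.
have dc : dotv (drift_row Q B c) x ^+ 2 <= qform S c' c' * qform P x x.
  apply: le_trans (dotv_sq_le Sp _ _) _; rewrite ler_wpM2r//.
rewrite ler_pM ?sqr_ge0//.
set al := _ * _ * cos _; set be := _ * cos _.
apply: (@le_trans _ _ (2 * al ^+ 2 + 2 * be ^+ 2)).
  by have := sqr_ge0 (al - be); nra.
have cos1 y : cos y ^+ 2 <= (1 : R).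
  by rewrite -(cos2Dsin2 y) lerDl sqr_ge0.
have h1 : al ^+ 2 <= qform S b b * qform S c' c'.
  apply: le_trans qQ; rewrite /al exprMn mulNr sqrrN ler_piMr ?sqr_ge0//.
have h2 : be ^+ 2 <= qform S c' c' * qform P x x.
  apply: le_trans dc; rewrite /be exprMn ler_piMr ?sqr_ge0//.
by rewrite -!mulrA lerD// ler_pM2l.
Qed.

Lemma wave_bound_ge0 b x : 0 <= wave_bound b x.
Proof. exact: le_trans (sqr_ge0 _) (wave_phase'_bound b 0 x (lexx 0)). Qed.

Lemma wave_phase_lip b th x s h : 0 <= s -> 0 <= h ->
  (wave_phase b th x (s + h) - wave_phase b th x s) ^+ 2 <= h ^+ 2 * wave_bound b x.
Proof.
move=> s0; rewrite le_eqVlt => /orP[/eqP <-|h0].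
  by rewrite addr0 subrr expr0n mul0r.
have [||| c] := @MVT _ (wave_phase b th x) (wave_phase' b th x) s (s + h).
- by rewrite ltrDl.
- by move=> c _; exact: is_derive_wave_phase.
- apply: continuous_subspaceT; apply: continuous_of_is_derive => y.
  exact: is_derive_wave_phase.
rewrite in_itv /= => /andP[sc _] ->; rewrite exprMn mulrC addrC addKr.
by rewrite ler_pM2l ?exprn_gt0// wave_phase'_bound// (le_trans s0)// ltW.
Qed.

Lemma wave_flowE b t x : wave Q B (flow b t) x =
  Complex (w x * wave_phase b 0 x t) (w x * wave_phase b (- (pi / 2)) x t).
Proof. by rewrite /wave /gwave /wave_phase; congr Complex; rewrite mulrCA. Qed.

Lemma waveP_flowE b t x : waveP Q B (flow b t) x =
  Complex (w x * wave_phase' b 0 x t) (w x * wave_phase' b (- (pi / 2)) x t).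
Proof. by rewrite /waveP /gwaveP /gwave /wave_phase'; congr Complex; ring. Qed.

Lemma integrable_wave_bound b : L.-integrable setT (EFin \o (fun x => w x * wave_bound b x)).
Proof.
have := integrable_rho_qform Sp
  (wave_const Q B b ^+ 2 * (2 * qform S b b * qform S (drift_row Q B b) (drift_row Q B b)))
  (wave_const Q B b ^+ 2 * (2 * qform S (drift_row Q B b) (drift_row Q B b))).
congr (L.-integrable _ _); apply/funext => x /=; congr (_ * _)%:E.
by rewrite /wave_bound mulrDr -!mulrA.
Qed.

Lemma wave_left_continuous b s e : 0 < s -> 0 < e -> exists2 d : R, 0 < d &
  forall h : R, 0 < h < d -> h <= s ->
    normL2 w (wave Q B (flow b (s - h)) - wave Q B (flow b s)) <= e.
Proof.
move=> s0 e0; set K := \int[L]_x (w x * wave_bound b x).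
have wp := rho_gt0 Sp.
have K0 : 0 <= K.
  by apply: Rintegral_ge0 => x _; rewrite mulr_ge0 ?wave_bound_ge0// ltW.
have iK := integrable_wave_bound b.
(* The squared norm is at most [2 h^2 K], one [h^2 K] for each phase; [+ 1] keeps the denominator
   positive when [K = 0]. *)
exists (e / Num.sqrt (2 * K + 1)).
  by rewrite divr_gt0// sqrtr_gt0; lra.
move=> h /andP[h0 hd] hs; apply: normL2_le_of_sq => //.
- by apply: inL2B => //; [exact: measurable_rho|exact: inL2_wave|exact: inL2_wave].
- exact: ltW.
apply: (@le_trans _ _ (\int[L]_x (2 * h ^+ 2 * (w x * wave_bound b x))%:E)%E).
  apply: ge0_le_integral => //.
  - by move=> x _; rewrite lee_fin sqint_ge0.
  - apply: measurable_sqint => //; first exact: measurable_rho.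
    by have [] := inL2B wp (measurable_rho Q B) (inL2_wave Sp (flow b (s - h))) (inL2_wave Sp (flow b s)).
  - by apply/measurable_EFinP; apply: measurable_funM => //; apply/measurable_EFinP; exact: (measurable_int _ iK).
  move=> x _; rewrite lee_fin.
  rewrite (normcB_sq_weighted (lt0r_neq0 (wp x)) (wave_flowE b (s - h) x) (wave_flowE b s x)).
  rewrite mulrCA ler_pM2l// -mulrA mulr_natl mulr2n.
  have sh : 0 <= s - h by rewrite subr_ge0.
  have key th : (wave_phase b th x (s - h) - wave_phase b th x s) ^+ 2 <= h ^+ 2 * wave_bound b x.
    have := wave_phase_lip b th x sh (ltW h0); rewrite subrK.
    by move=> H; rewrite sqrB_sym; exact: H.
  by rewrite lerD.
have -> : (\int[L]_x (2 * h ^+ 2 * (w x * wave_bound b x))%:E)%E = (2 * h ^+ 2 * K)%:E.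
  under eq_integral do rewrite EFinM.
  rewrite integralZl// [RHS]EFinM; congr (_ * _)%E; rewrite /K /Rintegral fineK//.
  exact: integrable_fin_num.
rewrite lee_fin.
have S0 : 0 < Num.sqrt (2 * K + 1) by rewrite sqrtr_gt0; lra.
have : h ^+ 2 * (2 * K + 1) <= e ^+ 2.
  rewrite -[X in _ * X]sqr_sqrtr; last lra.
  rewrite -exprMn lerXn2r ?nnegrE ?mulr_ge0// ?ltW//.
  by rewrite -ltr_pdivlMr.
by have := sqr_ge0 h; lra.
Qed.

Lemma wave_right_derive b s e : 0 <= s -> 0 < e -> exists2 d : R, 0 < d &
  forall h : R, 0 < h < d ->
    normL2 w (wave Q B (flow b (s + h)) - wave Q B (flow b s) -
      h%:C%C *: waveP Q B (flow b s)) <= e * h.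
Proof.
move=> s0 e0; have wp := rho_gt0 Sp.
pose D th x h := h^-1 * (wave_phase b th x (s + h) - wave_phase b th x s) - wave_phase' b th x s.
pose I h x := w x * (D 0 x h ^+ 2 + D (- (pi / 2)) x h ^+ 2).
have HL h : inL2 w (wave Q B (flow b (s + h)) - wave Q B (flow b s) -
      h%:C%C *: waveP Q B (flow b s)).
  do !apply: inL2B => //; try exact: measurable_rho; try exact: inL2_wave.
  by apply: inL2Z => //; [exact: measurable_rho|exact: inL2_waveP].
have IE h : 0 < h -> forall x, Normc.normc ((wave Q B (flow b (s + h)) - wave Q B (flow b s) -
      h%:C%C *: waveP Q B (flow b s)) x) ^+ 2 / w x = h ^+ 2 * I h x.
  move=> h0 x.
  exact: (normc_quotient_sq_weighted (lt0r_neq0 (wp x)) (lt0r_neq0 h0)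
    (wave_flowE b (s + h) x) (wave_flowE b s x) (waveP_flowE b s x)).
have mI h : 0 < h -> measurable_fun setT (I h).
  move=> h0; have [mh _] := HL h.
  have := measurable_funM (measurable_cst (h ^+ 2)^-1) (measurable_sqintR wp (measurable_rho Q B) mh).
  rewrite (_ : _ \* _ = I h)//; apply/funext => x /=.
  by rewrite IE// mulKf// expf_neq0 ?lt0r_neq0.
have cvgI (u : nat -> R) : (forall k, 0 < u k) -> u @ \oo --> 0 ->
    (\int[L]_x (I (u k) x)%:E)%E @[k --> \oo] --> 0%E.
  move=> u0 cu.
  rewrite -[X in _ --> X](_ : (\int[L]_x (0 : R)%:E)%E = 0%E); last exact: integral0.
  (* Difference quotient [y] and derivative [z] have squares below [wave_bound], so
     [(y - z)^2 <= 2 y^2 + 2 z^2] gives a factor 4 for each of the two phases. *)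
  apply: (@cvg_integral_dominated _ _ _ _ _ _ (fun x => 8 * (w x * wave_bound b x))).
  - by move=> k; apply: mI.
  - move=> x; have cD th : D th x (u k) @[k --> \oo] --> 0.
      have [dW EW] := is_derive_wave_phase b th x s.
      have {}dW : h^-1 *: (wave_phase b th x (h *: 1 + s) - wave_phase b th x s) @[h --> (0 : R)^']
          --> wave_phase' b th x s by rewrite -EW.
      have /cvgr_dnbhsP/(_ u) cW := dW.
      rewrite /D -[X in _ --> X](subrr (wave_phase' b th x s)); apply: cvgB; last exact: cvg_cst.
      rewrite (_ : (fun k => _) = fun k => (u k)^-1 *: (wave_phase b th x (u k *: 1 + s) - wave_phase b th x s)).
        by apply: cW; split=> // k; rewrite gt_eqF.
      by apply/funext => k; rewrite [u k *: 1]mulr1 [s + u k]addrC.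
    suff : I (u k) x @[k --> \oo] --> w x * (0 * 0 + 0 * 0) by rewrite !mulr0 addr0 mulr0.
    rewrite /I; under eq_fun do rewrite !expr2.
    apply: cvgM; first exact: cvg_cst.
    by apply: cvgD; apply: cvgM; exact: cD.
  - exact: (integrableZl _ _ (integrable_wave_bound b)).
  - move=> k x; have B0 := wave_bound_ge0 b x.
    rewrite ger0_norm; last by rewrite mulr_ge0 ?(ltW (wp x))// addr_ge0 ?sqr_ge0.
    rewrite [leRHS]mulrCA ler_pM2l//.
    have key th : D th x (u k) ^+ 2 <= 4 * wave_bound b x.
      have h1 := wave_phase_lip b th x s0 (ltW (u0 k)).
      have h2 := wave_phase'_bound b th x s0.
      have h3 : ((u k)^-1 * (wave_phase b th x (s + u k) - wave_phase b th x s)) ^+ 2 <= wave_bound b x.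
        by rewrite exprMn exprVn mulrC ler_pdivrMr ?exprn_gt0// [leRHS]mulrC.
      rewrite /D; move: h2 h3; set y := _ * _; set z := wave_phase' _ _ _ _.
      by have := sqr_ge0 (y + z); nra.
    by have := key 0; have := key (- (pi / 2)); lra.
have ge0F h : 0 < h -> sqnormL2 w (wave Q B (flow b (s + h)) - wave Q B (flow b s) -
      h%:C%C *: waveP Q B (flow b s)) = ((h ^+ 2)%:E * \int[L]_x (I h x)%:E)%E.
  move=> h0; rewrite /sqnormL2 -ge0_integralZl//.
  - by apply: eq_integral => x _; rewrite -EFinM; congr EFin; exact: IE.
  - by apply/measurable_EFinP; exact: mI.
  - by move=> x _; rewrite lee_fin mulr_ge0 ?(ltW (wp x))// addr_ge0 ?sqr_ge0.
  - by rewrite lee_fin sqr_ge0.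
(* Dominated convergence is available along sequences: a failure of the claim would supply
   increments [h_k < 1 / (k + 1)] that violate it. *)
apply: contrapT => H.
have bad (k : nat) : exists h : R, 0 < h < k.+1%:R^-1 /\ ~ (normL2 w (wave Q B (flow b (s + h)) - wave Q B (flow b s) -
      h%:C%C *: waveP Q B (flow b s)) <= e * h).
  apply: contrapT => Hk; apply: H; exists k.+1%:R^-1 => // h hk.
  by apply: contrapT => Hh; apply: Hk; exists h.
have /choice[u Hu] := bad.
have u0 k : 0 < u k by have [/andP[]] := Hu k.
have cu : u @ \oo --> 0.
  apply: (@squeeze_cvgr _ _ _ _ (cst 0) harmonic).
  - by near=> k; have [/andP[/ltW -> /ltW ->]] := Hu k.
  - exact: cvg_cst.
  - exact: cvg_harmonic.
have /fine_cvgP[Ff /cvgrPdist_le /(_ _ (exprn_gt0 2 e0)) Fc] := cvgI u u0 cu.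
have : \forall k \near \oo, False.
  near=> k; have [_] := Hu k; apply; apply: normL2_le_of_sq => //.
    by rewrite mulr_ge0// ltW.
  rewrite ge0F// (_ : ((e * u k) ^+ 2)%:E = ((u k ^+ 2)%:E * (e ^+ 2)%:E)%E); last first.
    by rewrite -EFinM exprMn mulrC.
  rewrite lee_pmul2l// ?lte_fin ?exprn_gt0//.
  have hf : (\int[L]_x (I (u k) x)%:E)%E \is a fin_num by near: k.
  rewrite -(fineK hf) lee_fin.
  have : `|0 - fine (\int[L]_x (I (u k) x)%:E)%E| <= e ^+ 2 by near: k.
  by rewrite sub0r normrN => /(le_trans (ler_norm _)).
by case=> k _ /(_ k); apply => /=.
Unshelve. all: by end_near.
Qed.

End flow.

(** * Gram matrices of plane waves *)

(** Repeated completion of the square: the pivot gives one product, and the Schur complement gives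
    the others by induction. In this form the Schur product theorem becomes elementary. *)
Lemma posdef_sum_products (R : realType) n (P : 'M[R]_n) : posdefmx P ->
  exists g : 'I_n -> 'rV[R]_n -> R, forall x y, qform P x y = \sum_l g l x * g l y.
Proof.
elim: n P => [|n IH] P Pp.
  by exists (fun _ _ => 0) => x y; rewrite qformE !big_ord0.
have [g Hg] := IH _ (schur_compl_posdef Pp).
have a0 := schur_pivot_gt0 Pp.
pose tl (x : 'rV[R]_n.+1) := (rV_uncons x).2.
exists (fun l x => if unlift 0 l is Some k then g k (tl x)
  else Num.sqrt (schur_pivot P) * (x 0 0 + schur_shift P (tl x))) => x y.
rewrite big_ord_recl unlift_none.
under eq_bigr do rewrite liftK.
rewrite -Hg -{1}(rV_unconsK x) -{1}(rV_unconsK y).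
rewrite (schur_qform Pp _ _ _ _ (lt0r_neq0 a0)) /=; congr (_ + _).
rewrite -[in LHS](sqr_sqrtr (ltW a0)); ring.
Qed.

Section positive_kernels.
Context (R : realType) (m : nat).
Implicit Types (M H K : 'I_m -> 'I_m -> R) (u : 'I_m -> R).

Definition psd_kernel M : Prop :=
  forall u, 0 <= \sum_j \sum_k u j * u k * M j k.

Lemma psd_kernelD M H : psd_kernel M -> psd_kernel H ->
  psd_kernel (fun j k => M j k + H j k).
Proof.
move=> pM pH u; under eq_bigr do under eq_bigr do rewrite mulrDr.
under eq_bigr do rewrite big_split; rewrite big_split /=.
by rewrite addr_ge0.
Qed.

Lemma psd_kernelZ a M : 0 <= a -> psd_kernel M -> psd_kernel (fun j k => a * M j k).
Proof.
move=> a0 pM u; under eq_bigr do under eq_bigr do rewrite mulrCA.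
under eq_bigr do rewrite -mulr_sumr; rewrite -mulr_sumr.
by rewrite mulr_ge0.
Qed.

(** Schur product theorem: the l-th product contributes the form of [M] at the rescaled vector
    [u j * g l j]. *)
Lemma psd_kernelM_products n (g : 'I_n -> 'I_m -> R) M : psd_kernel M ->
  psd_kernel (fun j k => M j k * \sum_l g l j * g l k).
Proof.
move=> pM u.
rewrite (_ : \sum_j _ = \sum_l \sum_j \sum_k (u j * g l j) * (u k * g l k) * M j k).
  by apply: sumr_ge0 => l _; exact: (pM (fun j => u j * g l j)).
rewrite [RHS]exchange_big; apply: eq_bigr => j _ /=.
rewrite [RHS]exchange_big; apply: eq_bigr => k _ /=.
by rewrite !mulr_sumr; apply: eq_bigr => l _; ring.
Qed.

Lemma psd_kernel_cvg (M_ : nat -> 'I_m -> 'I_m -> R) M : (forall N, psd_kernel (M_ N)) ->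
  (forall j k, M_ N j k @[N --> \oo] --> M j k) -> psd_kernel M.
Proof.
move=> pM cM u; have cv : \sum_j \sum_k u j * u k * M_ N j k @[N --> \oo] -->
    \sum_j \sum_k u j * u k * M j k.
  apply: cvg_sum_fun => j; apply: cvg_sum_fun => k.
  by apply: cvgM; [exact: cvg_cst|exact: cM].
rewrite -(cvg_lim (@Rhausdorff R) cv); apply: limr_ge; first by apply/cvg_ex; eexists; exact: cv.
by apply: nearW => N; exact: pM.
Qed.

Lemma psd_kernelM_qform_expn n (S : 'M[R]_n) (b : 'I_m -> 'rV[R]_n) M p : posdefmx S ->
  psd_kernel M -> psd_kernel (fun j k => M j k * qform S (b j) (b k) ^+ p).
Proof.
move=> /posdef_sum_products[g Hg]; elim: p M => [|p IH] M pM.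
  by under eq_fun do under eq_fun do rewrite expr0 mulr1.
have := IH _ (psd_kernelM_products (fun l j => g l (b j)) pM).
congr psd_kernel; apply/funext => j; apply/funext => k.
by rewrite -Hg exprS mulrA.
Qed.

(* Each power is compared through
   a H^(p+1) - K^(p+1) = (a H^p - K^p) H + K^p (H - K). *)
Lemma psd_kernel_expR_sub1 n (S : 'M[R]_n) (b c : 'I_m -> 'rV[R]_n) (a : R) :
  posdefmx S ->
  let H j k := qform S (b j) (b k) in let K j k := qform S (c j) (c k) in
  psd_kernel (fun j k => H j k - K j k) -> psd_kernel (fun j k => a * H j k - K j k) ->
  psd_kernel (fun j k => a * (expR (H j k) - 1) - (expR (K j k) - 1)).
Proof.
move=> Sp H K pHK paHK.
have pow p : psd_kernel (fun j k => a * H j k ^+ p.+1 - K j k ^+ p.+1).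
  elim: p => [|p IH]; first by [].
  have h1 := psd_kernelM_qform_expn b 1 Sp IH.
  have h2 := psd_kernelM_qform_expn c p.+1 Sp pHK.
  have := psd_kernelD h1 h2; congr psd_kernel.
  apply/funext => j; apply/funext => k; rewrite -/(H j k) -/(K j k) expr1.
  by rewrite [H j k ^+ p.+2]exprSr [K j k ^+ p.+2]exprS; ring.
(* [series _ N.+1] stops at degree [N]: at [N = 0] it is 1 and the difference vanishes, and each
   further step adds one power with weight [1 / (N + 1)!]. *)
pose s (x : R) N := series (exp_coeff x) N.+1.
apply: (@psd_kernel_cvg (fun N j k => a * (s (H j k) N - 1) - (s (K j k) N - 1))).
  elim=> [|N IH].
    have s0 x : s x 0%N = 1 by rewrite /s /series /= big_nat1 /exp_coeff /= expr0 fact0 divr1.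
    move=> u; under eq_bigr do under eq_bigr do rewrite !s0 subrr mulr0 subrr mulr0.
    by rewrite big1// => j _; rewrite big1.
  have := psd_kernelD IH (psd_kernelZ _ (pow N)).
  move=> /(_ N.+1`!%:R^-1); rewrite invr_ge0 ler0n => /(_ isT).
  congr psd_kernel; apply/funext => j; apply/funext => k.
  by rewrite /s ![series _ N.+2]seriesS /exp_coeff /=; ring.
move=> j k; have cs x : s x N @[N --> \oo] --> expR x.
  rewrite /s (cvg_shiftS (series (exp_coeff x))).
  exact: is_cvg_series_exp_coeff.
apply: cvgB; last by apply: cvgB; [exact: cs|exact: cvg_cst].
by apply: cvgM; [exact: cvg_cst|apply: cvgB; [exact: cs|exact: cvg_cst]].
Qed.

End positive_kernels.

Section has_integral.
Context d (T : measurableType d) (R : realType) (mu : {measure set T -> \bar R}).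

(** Integrability and value in one predicate, so that finite combinations are integrated without
    separate side conditions. *)
Definition has_integral (v : T -> R) (r : R) : Prop :=
  mu.-integrable setT (EFin \o v) /\ (\int[mu]_x (v x)%:E = r%:E)%E.

Lemma has_integralD u v r s : has_integral u r -> has_integral v s ->
  has_integral (fun x => u x + v x) (r + s).
Proof.
move=> [iu eu] [iv ev]; split; first exact: (integrableD measurableT iu iv).
by under eq_integral do rewrite EFinD; rewrite integralD// eu ev.
Qed.

Lemma has_integralZ a u r : has_integral u r -> has_integral (fun x => a * u x) (a * r).
Proof.
move=> [iu eu]; split; first exact: (integrableZl measurableT a iu).
by under eq_integral do rewrite EFinM; rewrite integralZl// eu.
Qed.

Lemma has_integral_sum m (u : 'I_m -> T -> R) (r : 'I_m -> R) :
  (forall k, has_integral (u k) (r k)) ->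
  has_integral (fun x => \sum_k u k x) (\sum_k r k).
Proof.
elim: m u r => [|m IH] u r H.
  under eq_fun do rewrite big_ord0; rewrite big_ord0.
  by split; [exact: integrable0|rewrite integral0].
under eq_fun do rewrite big_ord_recl; rewrite big_ord_recl.
by apply: has_integralD => //; exact: IH.
Qed.

Lemma has_integral_Rintegral v : mu.-integrable setT (EFin \o v) ->
  has_integral v (\int[mu]_x v x).
Proof. by move=> iv; split=> //; rewrite /Rintegral fineK//; exact: integrable_fin_num. Qed.

End has_integral.

Section wave_gram.
Context (R : realType) (n : nat) (Q B : 'M[R]_n).
Let S := Qinf Q B.
Hypothesis Sp : posdefmx S.
Notation L := (lebesgue_rV R n).
Notation w := (rho Q B).
Notation wave := (wave Q B).
Implicit Types (b x : 'rV[R]_n).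

Lemma has_integral_rho_cos b th :
  has_integral L (fun x => w x * cos (dotv b x + th))
    (expR (- 2^-1 * qform S b b) * cos th).
Proof.
rewrite -integral_rho_cos//; apply: has_integral_Rintegral.
apply: (@integrable_rho_mul _ _ _ _ Sp _ 1); first exact: measurable_cos_dotv.
by move=> x; exact: cos_max.
Qed.

(* The real part of z * conj u. *)
Definition re_hprod (z u : R[i]) : R :=
  complex.Re z * complex.Re u + complex.Im z * complex.Im u.

Lemma normc_sum_sq m (z : 'I_m -> R[i]) :
  Normc.normc (\sum_j z j) ^+ 2 = \sum_j \sum_k re_hprod (z j) (z k).
Proof.
rewrite normc_sqE Re_sum Im_sum !expr2 !mulr_suml -big_split /=.
apply: eq_bigr => j _; rewrite !mulr_sumr -big_split /=.
by apply: eq_bigr => k _.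
Qed.

(** One wave times the conjugate of another is a cosine and a sine of frequency [b - c]; the sine
    term integrates to 0 because [cos (- (pi / 2)) = 0]. *)
Lemma re_hprod_wave (z u : R[i]) b c x :
  re_hprod (z * wave b x) (u * wave c x) / w x =
  wave_const Q B b * wave_const Q B c *
  (re_hprod z u * (w x * cos (dotv (b - c) x + 0)) +
   (complex.Re z * complex.Im u - complex.Im z * complex.Re u) *
     (w x * cos (dotv (b - c) x + - (pi / 2)))).
Proof.
have sE t : cos (t - pi / 2) = sin t :> R.
  by rewrite cosB cos_pihalf sin_pihalf mulr0 mulr1 add0r.
rewrite /re_hprod !ReM !ImM /wave /gwave !sE !addr0 dotvBl cosB sinB.
case: z => zr zi; case: u => ur ui; rewrite [complex.Re _]/= [complex.Im _]/=.
have w0 := lt0r_neq0 (rho_gt0 Sp x).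
set k1 := wave_const _ _ _; set k2 := wave_const _ _ _.
set c1 := cos (dotv b x); set c2 := cos (dotv c x).
set s1 := sin (dotv b x); set s2 := sin (dotv c x).
rewrite /=; move: k1 k2 c1 c2 s1 s2 w0; move: (w x) => v k1 k2 c1 c2 s1 s2 w0.
by field.
Qed.

(** Polarisation: half of [q b + q c - q (b - c)] is [qform S b c], where [q b = qform S b b]. *)
Lemma wave_const_gram b c :
  wave_const Q B b * wave_const Q B c * expR (- 2^-1 * qform S (b - c) (b - c)) =
  expR (qform S b c).
Proof.
rewrite /wave_const -/S -!expRD; congr expR.
have -> : qform S (b - c) (b - c) = qform S b b - 2 * qform S b c + qform S c c.
  rewrite -scaleN1r qformDl qformDr qformDr.
  by rewrite !qformZl !qformZr (qformC c b Sp.1); ring.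
by field.
Qed.

Lemma sqnormL2_wave_sum m (c : 'I_m -> R[i]) (b : 'I_m -> 'rV[R]_n) :
  sqnormL2 w (\sum_j c j *: wave (b j)) =
  (\sum_j \sum_k re_hprod (c j) (c k) * expR (qform S (b j) (b k)))%:E.
Proof.
pose v j k x := re_hprod (c j * wave (b j) x) (c k * wave (b k) x) / w x.
have Hv j k : has_integral L (v j k) (re_hprod (c j) (c k) * expR (qform S (b j) (b k))).
  rewrite /v; under eq_fun do rewrite re_hprod_wave.
  have := has_integralZ (wave_const Q B (b j) * wave_const Q B (b k))
   (has_integralD (has_integralZ (re_hprod (c j) (c k)) (has_integral_rho_cos (b j - b k) 0))
    (has_integralZ (complex.Re (c j) * complex.Im (c k) - complex.Im (c j) * complex.Re (c k))
       (has_integral_rho_cos (b j - b k) (- (pi / 2))))).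
  rewrite cos0 cosN cos_pihalf mulr0 mulr0 addr0 mulr1.
  by rewrite mulrCA wave_const_gram.
have [_ <-] := has_integral_sum (fun j => has_integral_sum (fun k => Hv j k)).
apply: eq_integral => x _; congr EFin.
rewrite fct_sumE normc_sum_sq mulr_suml; apply: eq_bigr => j _.
by rewrite mulr_suml; apply: eq_bigr => k _.
Qed.

Lemma cint_wave b : cint (wave b) = 1.
Proof.
have e th : \int[L]_x (wave_const Q B b * gwave Q B b th x) = cos th.
  have [_] := has_integralZ (wave_const Q B b) (has_integral_rho_cos b th).
  rewrite /Rintegral => ->; rewrite /= mulrA -[X in _ * X * _]divr1.
  have := wave_const_gram b 0; rewrite subr0 qform0r {2}/wave_const -/S qform0r mulr0 expR0.
  by rewrite mulr1 divr1 => ->; rewrite mul1r.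
rewrite /cint /= e e cos0 cosN cos_pihalf.
by [].
Qed.

Lemma wave0 x : wave 0 x = (w x)%:C%C.
Proof.
rewrite /wave /gwave !dotv0l !add0r cos0 cosN cos_pihalf !mulr0.
by rewrite /wave_const qform0r mulr0 expR0 mul1r mulr1.
Qed.

Lemma psd_kernel_re_hprod m (M : 'I_m -> 'I_m -> R) (c : 'I_m -> R[i]) : psd_kernel M ->
  0 <= \sum_j \sum_k re_hprod (c j) (c k) * M j k.
Proof.
move=> pM; rewrite (_ : \sum_j _ =
  \sum_j \sum_k complex.Re (c j) * complex.Re (c k) * M j k +
  \sum_j \sum_k complex.Im (c j) * complex.Im (c k) * M j k).
  by rewrite addr_ge0//; exact: pM.
rewrite -big_split; apply: eq_bigr => j _; rewrite -big_split.
by apply: eq_bigr => k _; rewrite /re_hprod mulrDl.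
Qed.

(** The centred sum is again a sum of waves, with the extra frequency 0 of coefficient [- sum c_j],
    whose Gram entries all equal [expR 0 = 1]. *)
Lemma sqnormL2_wave_sum_center m (c : 'I_m -> R[i]) (b : 'I_m -> 'rV[R]_n) :
  sqnormL2 w (\sum_j c j *: (wave (b j) - wave 0)) =
  (\sum_j \sum_k re_hprod (c j) (c k) * (expR (qform S (b j) (b k)) - 1))%:E.
Proof.
pose c' (j : 'I_m.+1) := oapp c (- \sum_k c k) (unlift ord0 j).
pose b' (j : 'I_m.+1) := oapp b 0 (unlift ord0 j).
have c0 : c' ord0 = - \sum_k c k by rewrite /c' unlift_none.
have b0 : b' ord0 = 0 by rewrite /b' unlift_none.
have cl j : c' (lift ord0 j) = c j by rewrite /c' liftK.
have bl j : b' (lift ord0 j) = b j by rewrite /b' liftK.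
have -> : \sum_j c j *: (wave (b j) - wave 0) = \sum_j c' j *: wave (b' j).
  rewrite big_ord_recl c0 b0 [X in _ = _ + X](eq_bigr (fun j => c j *: wave (b j))); last first.
    by move=> j _; rewrite cl bl.
  rewrite [LHS](eq_bigr (fun j => c j *: wave (b j) - c j *: wave 0)); last first.
    by move=> j _; exact: scalerBr.
  by rewrite sumrB scaleNr scaler_suml addrC.
rewrite sqnormL2_wave_sum; congr EFin.
have hsum (F : 'I_m -> R[i]) z : re_hprod (\sum_i F i) z = \sum_i re_hprod (F i) z.
  rewrite /re_hprod Re_sum Im_sum !mulr_suml -big_split; exact: eq_bigr.
have hC z u : re_hprod z u = re_hprod u z by rewrite /re_hprod; ring.
have hN z u : re_hprod (- z) u = - re_hprod z u.
  by case: z => ? ?; rewrite /re_hprod /=; ring.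
pose s := \sum_j \sum_k re_hprod (c j) (c k).
have ss : re_hprod (\sum_k c k) (\sum_k c k) = s.
  rewrite hsum; apply: eq_bigr => j _; rewrite hC hsum.
  by apply: eq_bigr => k _; rewrite hC.
have sj : \sum_j re_hprod (\sum_k c k) (c j) = s.
  rewrite /s exchange_big; apply: eq_bigr => j _; exact: hsum.
have E0 (k : 'I_m.+1) : qform S (b' ord0) (b' k) = 0.
  by rewrite b0 qform0l.
have E0' (k : 'I_m.+1) : qform S (b' k) (b' ord0) = 0.
  by rewrite b0 qform0r.
pose s' := \sum_j \sum_k re_hprod (c j) (c k) * expR (qform S (b j) (b k)).
(* Corner, first row, first column and original block of the enlarged double sum. *)
transitivity (s - s + (- s + s')).
  rewrite big_ord_recl big_ord_recl E0 expR0 mulr1 c0 hN hC hN opprK ss; congr (_ + _ + _).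
    rewrite -sj -[RHS]sumrN; apply: eq_bigr => k _.
    by rewrite E0 expR0 mulr1 cl; exact: hN.
  rewrite -[in RHS]sj -[X in _ = X + _]sumrN -[RHS]big_split; apply: eq_bigr => j _.
  rewrite big_ord_recl E0' expR0 mulr1 c0 cl; congr (_ + _).
    by rewrite hC; exact: hN.
  by apply: eq_bigr => k _; rewrite !cl !bl.
rewrite subrr add0r addrC -sumrB; apply: eq_bigr => j _; rewrite -sumrB.
by apply: eq_bigr => k _; rewrite mulrBr mulr1.
Qed.

(** The centred Gram form and the full square norm on the right differ by [|sum c_j|^2 >= 0], so the
    kernel inequality for [expR - 1] implies the bound by the full norm. *)
Lemma wave_sum_contraction m (c : 'I_m -> R[i]) (b d : 'I_m -> 'rV[R]_n) (a : R) :
  0 <= a ->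
  let H j k := qform S (b j) (b k) in let K j k := qform S (d j) (d k) in
  psd_kernel (fun j k => H j k - K j k) -> psd_kernel (fun j k => a * H j k - K j k) ->
  (sqnormL2 w (\sum_j c j *: (wave (d j) - wave 0))%R <=
   a%:E * sqnormL2 w (\sum_j c j *: wave (b j))%R)%E.
Proof.
move=> a0 H K pHK paHK.
rewrite sqnormL2_wave_sum_center sqnormL2_wave_sum -EFinM lee_fin.
have := psd_kernel_re_hprod c (psd_kernel_expR_sub1 Sp pHK paHK).
have : 0 <= \sum_j \sum_k re_hprod (c j) (c k).
  by rewrite -normc_sum_sq sqr_ge0.
move=> s0; under eq_bigr => j _ do under eq_bigr => k _ do rewrite mulrBr mulrCA.
under eq_bigr => j _ do rewrite sumrB -mulr_sumr.
rewrite sumrB -mulr_sumr subr_ge0 => /le_trans; apply.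
rewrite ler_wpM2l//.
under eq_bigr => j _ do under eq_bigr => k _ do rewrite mulrBr mulr1.
under eq_bigr => j _ do rewrite sumrB.
by rewrite sumrB gerBl.
Qed.

End wave_gram.

(** * Density of plane waves *)

Lemma normcM (R : realType) (z u : R[i]) :
  Normc.normc (z * u) = Normc.normc z * Normc.normc u.
Proof.
apply/eqP; rewrite -(@eqrXn2 _ 2)// ?mulr_ge0 ?normc_ge0//; apply/eqP.
by rewrite exprMn !normc_sqE ReM ImM; ring.
Qed.

Section L2_closure.
Context (R : realType) (n : nat) (w : 'rV[R]_n -> R).
Hypothesis w_gt0 : forall x, 0 < w x.
Hypothesis mw : measurable_fun setT w.
Notation L := (lebesgue_rV R n).
Implicit Types f g h : 'rV[R]_n -> R[i].

Lemma cmeasurableM h f : cmeasurable h -> cmeasurable f -> cmeasurable (fun x => h x * f x).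
Proof.
move=> [h1 h2] [f1 f2]; split.
  under eq_fun do rewrite ReM.
  by apply: measurable_funB; apply: measurable_funM.
under eq_fun do rewrite ImM.
by apply: measurable_funD; apply: measurable_funM.
Qed.

Lemma inL2_mul_bounded h f (M : R) : cmeasurable h -> (forall x, Normc.normc (h x) <= M) ->
  inL2 w f -> inL2 w (fun x => h x * f x) /\ normL2 w (fun x => h x * f x) <= M * normL2 w f.
Proof.
move=> mh hM Hf; have [mf _] := Hf.
have M0 : 0 <= M := le_trans (normc_ge0 _) (hM 0).
have mhf := cmeasurableM mh mf.
have le1 : (sqnormL2 w (fun x => (h x * f x)%R) <= ((M * normL2 w f) ^+ 2)%:E)%E.
  rewrite exprMn EFinM -(sqnormL2E w_gt0 Hf) /sqnormL2 -ge0_integralZl//; last first.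
  - by rewrite lee_fin sqr_ge0.
  - by move=> x _; rewrite lee_fin sqint_ge0.
  - exact: measurable_sqint.
  apply: ge0_le_integral => //.
  - by move=> x _; rewrite lee_fin; exact: (sqint_ge0 w_gt0 (fun x => h x * f x)).
  - exact: measurable_sqint.
  - by apply: emeasurable_funM => //; exact: measurable_sqint.
  - move=> x _; rewrite -EFinM lee_fin mulrA ler_pM2r ?invr_gt0//.
    by rewrite normcM exprMn ler_wpM2r ?sqr_ge0// lerXn2r ?nnegrE ?normc_ge0.
have Hhf : inL2 w (fun x => h x * f x) by split=> //; exact: le_lt_trans le1 (ltry _).
by split=> //; apply: normL2_le_of_sq => //; rewrite mulr_ge0 ?normL2_ge0.
Qed.

Lemma normL2_dominated (F : nat -> 'rV[R]_n -> R[i]) f (g : 'rV[R]_n -> R) :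
  (forall k, inL2 w (F k)) -> inL2 w f ->
  L.-integrable setT (EFin \o g) ->
  (forall k x, Normc.normc (f x - F k x) ^+ 2 / w x <= g x) ->
  (forall x, Normc.normc (f x - F k x) ^+ 2 / w x @[k --> \oo] --> 0) ->
  forall e : R, 0 < e -> exists k, normL2 w (f - F k) <= e.
Proof.
move=> HF Hf ig dom cv e e0.
have HfF k : inL2 w (f - F k) by exact: (inL2B w_gt0 mw).
have := @cvg_integral_dominated _ _ _ L (fun k x => Normc.normc (f x - F k x) ^+ 2 / w x)
  (fun=> 0) g.
move=> /(_ (fun k => measurable_sqintR w_gt0 mw (HfF k).1) cv ig) H.
have {}H : (sqnormL2 w (f - F k)%R @[k --> \oo] --> 0)%E.
  rewrite -(@integral0 _ _ _ L setT); apply: H => k x.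
  by rewrite ger0_norm//; exact: (sqint_ge0 w_gt0 (f - F k)).
move/fine_cvgP : H => [_ /cvgrPdist_le /(_ _ (exprn_gt0 2 e0)) [k _ /(_ k (leqnn k))]].
rewrite sub0r normrN /= => Hk; exists k; apply: normL2_le_of_sq => //; first exact: ltW.
rewrite (sqnormL2E w_gt0 (HfF k)) lee_fin; apply: le_trans (ler_norm _) _.
by move: Hk; rewrite (sqnormL2E w_gt0 (HfF k)).
Qed.

Variable D : set ('rV[R]_n -> R[i]).
Hypothesis DL2 : forall f, D f -> inL2 w f.
Hypothesis D0 : D 0.
Hypothesis DD : forall f g, D f -> D g -> D (f + g).
Hypothesis DZ : forall a f, D f -> D (a *: f).

Definition L2closure f : Prop :=
  inL2 w f /\ forall e : R, 0 < e -> exists2 g, D g & normL2 w (f - g) <= e.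

Lemma sub_L2closure f : D f -> L2closure f.
Proof.
move=> Df; split; first exact: DL2.
by move=> e e0; exists f => //; rewrite subrr (normL2_0 w_gt0 mw) ltW.
Qed.

Lemma L2closure_lim f : inL2 w f ->
  (forall e : R, 0 < e -> exists2 g, L2closure g & normL2 w (f - g) <= e) -> L2closure f.
Proof.
move=> Hf H; split=> // e e0; have e2 : 0 < e / 2 by rewrite divr_gt0.
have [g [Hg cg] fg] := H _ e2; have [k Dk gk] := cg _ e2; exists k => //.
rewrite (_ : f - k = (f - g) + (g - k)); last by rewrite addrA subrK.
apply: le_trans (normL2D w_gt0 mw _ _) _; try exact: (inL2B w_gt0 mw).
  by apply: (inL2B w_gt0 mw) => //; exact: DL2.
by rewrite [leRHS]splitr lerD.
Qed.

Lemma L2closureD f g : L2closure f -> L2closure g -> L2closure (f + g).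
Proof.
move=> [Hf cf] [Hg cg]; split; first exact: (inL2D w_gt0 mw).
move=> e e0; have e2 : 0 < e / 2 by rewrite divr_gt0.
have [f' Df' ff'] := cf _ e2; have [g' Dg' gg'] := cg _ e2.
exists (f' + g'); first exact: DD.
rewrite opprD addrACA; apply: le_trans (normL2D w_gt0 mw _ _) _.
- by apply: (inL2B w_gt0 mw) => //; exact: DL2.
- by apply: (inL2B w_gt0 mw) => //; exact: DL2.
- by rewrite [leRHS]splitr lerD.
Qed.

(** If [g] in [D] is close to [f], the Lipschitz bound puts [A g] close to [A f], and limits of
    elements of the closure stay in it. *)
Lemma L2closure_map (A : ('rV[R]_n -> R[i]) -> 'rV[R]_n -> R[i]) (M : R) :
  (forall f, inL2 w f -> inL2 w (A f)) ->
  (forall f g, inL2 w f -> inL2 w g -> normL2 w (A f - A g) <= M * normL2 w (f - g)) ->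
  (forall g, D g -> L2closure (A g)) -> forall f, L2closure f -> L2closure (A f).
Proof.
move=> AL2 AM AD f [Hf cf]; apply: L2closure_lim; first exact: AL2.
move=> e e0; have M1 : 0 < `|M| + 1 by rewrite ltr_wpDl.
have [g Dg fg] := cf _ (divr_gt0 e0 M1); exists (A g); first exact: AD.
apply: le_trans (AM _ _ Hf (DL2 Dg)) _.
apply: (@le_trans _ _ ((`|M| + 1) * normL2 w (f - g))).
  by rewrite ler_wpM2r ?normL2_ge0// (le_trans (ler_norm _))// lerDl.
by rewrite mulrC -ler_pdivlMr.
Qed.

Lemma L2closureZ a f : L2closure f -> L2closure (a *: f).
Proof.
apply: (@L2closure_map (fun f => a *: f) (Normc.normc a)).
- by move=> g Hg; exact: inL2Z.
- by move=> g h Hg Hh; rewrite -scalerBr normL2Z//; exact: (inL2B w_gt0 mw).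
- by move=> g Dg; apply: sub_L2closure; exact: DZ.
Qed.

Lemma L2closureM h f (M : R) : cmeasurable h -> (forall x, Normc.normc (h x) <= M) ->
  (forall g, D g -> L2closure (fun x => h x * g x)) ->
  L2closure f -> L2closure (fun x => h x * f x).
Proof.
move=> mh hM Dh cf; apply: (L2closure_map (A := fun f x => h x * f x) (M := M)) cf => //.
- by move=> g Hg; have [] := inL2_mul_bounded mh hM Hg.
- move=> g k Hg Hk; have [_] := inL2_mul_bounded mh hM (inL2B w_gt0 mw Hg Hk).
  congr (normL2 w _ <= _); apply/funext => x.
  by rewrite /= -mulrBr.
Qed.

Lemma L2closure_sum (I : Type) (r : seq I) (F : I -> 'rV[R]_n -> R[i]) :
  (forall i, L2closure (F i)) -> L2closure (\sum_(i <- r) F i).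
Proof.
move=> HF; elim: r => [|i r IH]; first by rewrite big_nil; exact: sub_L2closure.
by rewrite big_cons; exact: L2closureD.
Qed.

End L2_closure.

Lemma complex_ext (R : realType) (z u : R[i]) :
  complex.Re z = complex.Re u -> complex.Im z = complex.Im u -> z = u.
Proof. by case: z => a b; case: u => c d /= -> ->. Qed.

Lemma normc_realB (R : realType) (a b : R) : Normc.normc (a%:C%C - b%:C%C) = `|a - b|.
Proof. by rewrite -normc_real rmorphB. Qed.

Import HBNNSimple.

Section sign_iteration.
Context (R : realType).
Implicit Types x : R.

Definition sign_step x : R := 2^-1 * x * (3 - x ^+ 2).

Lemma sign_step_bounds x : 0 <= x <= 1 -> x <= sign_step x <= 1.
Proof.
move=> /andP[x0 x1]; rewrite /sign_step; apply/andP; split.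
  rewrite -subr_ge0 (_ : _ - x = 2^-1 * x * (1 - x) * (1 + x)); last by field.
  by rewrite !mulr_ge0//; lra.
rewrite -subr_ge0 (_ : 1 - _ = 2^-1 * (1 - x) ^+ 2 * (2 + x)); last by field.
by rewrite !mulr_ge0 ?sqr_ge0//; lra.
Qed.

(** One step multiplies the gap [1 - y] by [(1 - y) (2 + y) / 2], which is at most [1 - x / 2] when
    [y >= x]; the iterates increase, so this rate persists. *)
Lemma iter_sign_step_pos k x : 0 < x <= 1 ->
  x <= iter k sign_step x <= 1 /\ 1 - iter k sign_step x <= (1 - 2^-1 * x) ^+ k.
Proof.
move=> /andP[x0 x1]; elim: k => [|k [/andP[h1 h2] h3]].
  by rewrite lexx x1 expr0 /=; split=> //; lra.
rewrite iterS; set y := iter k sign_step x in h1 h2 h3 *.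
have y0 : 0 <= y by lra.
have /andP[s1 s2] := @sign_step_bounds y (introT andP (conj y0 h2)).
split; first by rewrite s2 (le_trans h1).
have -> : 1 - sign_step y = (1 - y) * (2^-1 * (1 - y) * (2 + y)).
  by rewrite /sign_step; field.
rewrite exprSr ler_pM//.
- by lra.
- by rewrite !mulr_ge0//; lra.
have : 0 <= (y - x) + y ^+ 2 by rewrite addr_ge0 ?sqr_ge0//; lra.
rewrite -subr_ge0 => h; rewrite -subr_ge0.
by rewrite (_ : _ - _ = 2^-1 * (y - x + y ^+ 2))//; [lra|field].
Qed.

Lemma sign_stepN x : sign_step (- x) = - sign_step x.
Proof. by rewrite /sign_step; ring. Qed.

Lemma iter_sign_stepN k x : iter k sign_step (- x) = - iter k sign_step x.
Proof. by elim: k => [//|k IH]; rewrite !iterS IH sign_stepN. Qed.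

Lemma cvg_iter_sign_step x : `|x| <= 1 -> iter k sign_step x @[k --> \oo] --> Num.sg x.
Proof.
have pos y : 0 < y <= 1 -> iter k sign_step y @[k --> \oo] --> (1 : R).
  move=> y01; have /andP[y0 y1] := y01.
  apply: (@squeeze_cvgr _ _ _ _ (fun k => 1 - (1 - 2^-1 * y) ^+ k) (cst 1)).
  - apply: nearW => k; have [/andP[_ ->] h] := iter_sign_step_pos k y01.
    by rewrite andbT; lra.
  - rewrite -[X in _ --> X]subr0; apply: cvgB; first exact: cvg_cst.
    by apply: cvg_expr; rewrite ger0_norm; lra.
  - exact: cvg_cst.
rewrite ler_norml => /andP[xN1 x1]; have [x0|x0|->] := ltgtP x 0.
- rewrite ltr0_sg// -(opprK x); under eq_fun do rewrite iter_sign_stepN.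
  by apply: cvgN; apply: pos; apply/andP; split; lra.
- by rewrite gtr0_sg//; apply: pos; rewrite x0.
- rewrite sgr0; apply: cvg_near_cst; apply: nearW => k.
  by elim: k => [//|k IH]; rewrite iterS IH /sign_step mulr0 mul0r.
Qed.

Lemma iter_sign_step_norm k x : `|x| <= 1 -> `|iter k sign_step x| <= 1.
Proof.
wlog x0 : x / 0 <= x.
  move=> H x1; have [/H//|x0] := leP 0 x; first exact.
  by rewrite -normrN -iter_sign_stepN; apply: H; rewrite ?normrN// oppr_ge0 ltW.
rewrite ger0_norm// => x1.
suff /andP[h0 h1] : 0 <= iter k sign_step x <= 1 by rewrite ger0_norm.
elim: k => [|k IH]; first by rewrite x0.
have /andP[IH0 _] := IH; have /andP[h1 h2] := sign_step_bounds IH.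
by rewrite iterS h2 (le_trans IH0).
Qed.

End sign_iteration.

Section wave_density.
Context (R : realType) (n : nat) (Q B : 'M[R]_n).
Let S := Qinf Q B.
Hypothesis Sp : posdefmx S.
Notation L := (lebesgue_rV R n).
Notation w := (rho Q B).
Notation wave := (wave Q B).
Implicit Types (b x : 'rV[R]_n) (G : 'rV[R]_n -> R).

Let wp := rho_gt0 Sp.
Let mw := @measurable_rho R n Q B.

Definition wave_span (f : 'rV[R]_n -> R[i]) : Prop :=
  exists s : seq (R[i] * 'rV[R]_n), f = \sum_(p <- s) p.1 *: wave p.2.

Lemma wave_span_inL2 f : wave_span f -> inL2 w f.
Proof.
move=> [s ->]; apply: (inL2_sum wp mw) => p; apply: (inL2Z wp) => //.
exact: inL2_wave.
Qed.

Lemma wave_span0 : wave_span 0.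
Proof. by exists [::]; rewrite big_nil. Qed.

Lemma wave_spanD f g : wave_span f -> wave_span g -> wave_span (f + g).
Proof. by move=> [s ->] [t ->]; exists (s ++ t); rewrite big_cat. Qed.

Lemma wave_spanZ a f : wave_span f -> wave_span (a *: f).
Proof.
move=> [s ->]; exists [seq (a * p.1, p.2) | p <- s].
by rewrite big_map scaler_sumr; apply: eq_bigr => p _; rewrite scalerA.
Qed.

Definition wave_closure := L2closure w wave_span.

Lemma wave_closureD f g : wave_closure f -> wave_closure g -> wave_closure (f + g).
Proof. exact: (L2closureD wp mw wave_span_inL2 wave_spanD). Qed.

Lemma wave_closureZ a f : wave_closure f -> wave_closure (a *: f).
Proof. exact: (L2closureZ wp mw wave_span_inL2 wave_spanZ). Qed.

Lemma wave_closure_sum (I : Type) (r : seq I) (F : I -> 'rV[R]_n -> R[i]) :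
  (forall i, wave_closure (F i)) -> wave_closure (\sum_(i <- r) F i).
Proof. exact: (L2closure_sum wp mw wave_span_inL2 wave_span0 wave_spanD). Qed.

Lemma wave_closure_wave b : wave_closure (wave b).
Proof.
apply: (sub_L2closure wp mw wave_span_inL2); exists [:: (1, b)].
by rewrite big_seq1 scale1r.
Qed.

(** The imaginary exponentials multiply, and the division removes one of the two factors [rho]. So
    the span is stable under [f |-> wave b * f / rho], the source of the algebra structure. *)
Lemma wave_mul b c x : wave b x * ((w x)^-1)%:C%C * wave c x =
  (wave_const Q B b * wave_const Q B c / wave_const Q B (b + c))%:C%C * wave (b + c) x.
Proof.
have sE t : cos (t - pi / 2) = sin t :> R.
  by rewrite cosB cos_pihalf sin_pihalf mulr0 mulr1 add0r.
rewrite /wave /gwave !sE !addr0 dotvDl cosD sinD.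
have w0 := lt0r_neq0 (wp x).
have k0 : wave_const Q B (b + c) != 0 by rewrite gt_eqF ?expR_gt0.
move: w0 k0; move: (w x) (wave_const _ _ _) (wave_const _ _ _) (wave_const _ _ _)
  (cos _) (cos _) (sin _) (sin _) => v k1 k2 k3 c1 c2 s1 s2 v0 k0.
by apply: complex_ext; rewrite !(ReM, ImM) /=; field; rewrite v0 k0.
Qed.

(* Real functions G such that w G lies in the closed span of the waves; they
   form an algebra closed under bounded pointwise limits. *)
Definition wave_approx G : Prop :=
  [/\ measurable_fun setT G, exists M : R, forall x, `|G x| <= M &
      wave_closure (fun x => (w x * G x)%:C%C)].

(** Multiplication by [wave b / rho] is bounded by [wave_const b] and preserves the span; applied to
    [rho G] it gives [G * wave b]. *)
Lemma wave_approx_wave G b : wave_approx G -> wave_closure (fun x => (G x)%:C%C * wave b x).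
Proof.
move=> [mG [M GM] cG].
have := @L2closureM _ _ _ wp mw _ wave_span_inL2 (fun x => wave b x * ((w x)^-1)%:C%C)
  _ (wave_const Q B b) _ _ _ cG.
rewrite (_ : (fun x => _ * (w x * G x)%:C%C) = fun x => (G x)%:C%C * wave b x); last first.
  apply/funext => x; rewrite rmorphM /= mulrA -[_ * (w x)%:C%C]mulrA -rmorphM /=.
  by rewrite mulVf ?lt0r_neq0// mulr1 mulrC.
apply.
- have [[m1 m2] _] := inL2_wave Sp b.
  apply: cmeasurableM; first by split.
  split => /=; last exact: measurable_cst.
  exact: (measurable_invw wp mw).
- move=> x; rewrite -ler_sqr ?nnegrE ?normc_ge0 ?expR_ge0//.
  rewrite normcM exprMn normc_real ger0_norm ?invr_ge0 ?(ltW (wp x))//.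
  have := normc_wave Sp b x; move/(congr1 (fun t => t / w x)).
  rewrite mulfK ?lt0r_neq0// => <-.
  by rewrite exprVn expr2 invfM mulrA.
- move=> g [s ->]; apply: (sub_L2closure wp mw wave_span_inL2).
  exists [seq (p.1 * (wave_const Q B b * wave_const Q B p.2 / wave_const Q B (b + p.2))%:C%C, b + p.2) | p <- s].
  rewrite big_map; apply/funext => x; rewrite !fct_sumE mulr_sumr; apply: eq_bigr => p _ /=.
  rewrite -[(_ *: _) x]/(p.1 * wave p.2 x) -[(_ *: _) x]/(_ * wave (b + p.2) x).
  by rewrite mulrCA wave_mul mulrA.
Qed.

(** [wave_approx_wave] settles [G] times the span, and boundedness of [G] extends this to the
    closure. *)
Lemma wave_approx_mul G f : wave_approx G -> wave_closure f ->
  wave_closure (fun x => (G x)%:C%C * f x).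
Proof.
move=> HG; have [mG [M GM] cG] := HG.
apply: (L2closureM wp mw wave_span_inL2 (M := M)).
- by split => //=; exact: measurable_cst.
- by move=> x; rewrite normc_real.
- move=> g [s ->]; rewrite (_ : (fun x => _) = \sum_(p <- s) p.1 *: (fun x => (G x)%:C%C * wave p.2 x)).
    by apply: wave_closure_sum => p; apply: wave_closureZ; exact: wave_approx_wave.
  apply/funext => x; rewrite !fct_sumE mulr_sumr; apply: eq_bigr => p _.
  rewrite -[(_ *: _) x]/(p.1 * wave p.2 x) -[(_ *: _) x]/(p.1 * ((G x)%:C%C * wave p.2 x)).
  by rewrite mulrCA.
Qed.

Lemma wave_approxM G1 G2 : wave_approx G1 -> wave_approx G2 ->
  wave_approx (fun x => G1 x * G2 x).
Proof.
move=> H1 H2; have [m1 [M1 b1] c1] := H1; have [m2 [M2 b2] c2] := H2; split.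
- exact: measurable_funM.
- by exists (M1 * M2) => x; rewrite normrM ler_pM.
- have := wave_approx_mul H1 c2; congr wave_closure; apply/funext => x.
  by rewrite -rmorphM /=; congr (_%:C%C); ring.
Qed.

Lemma wave_approxD G1 G2 : wave_approx G1 -> wave_approx G2 ->
  wave_approx (fun x => G1 x + G2 x).
Proof.
move=> [m1 [M1 b1] c1] [m2 [M2 b2] c2]; split.
- exact: measurable_funD.
- by exists (M1 + M2) => x; rewrite (le_trans (ler_normD _ _))// lerD.
- have := wave_closureD c1 c2; congr wave_closure; apply/funext => x.
  by rewrite mulrDr rmorphD.
Qed.

Lemma wave_approxZ a G : wave_approx G -> wave_approx (fun x => a * G x).
Proof.
move=> [m1 [M1 b1] c1]; split.
- exact: measurable_funM.
- by exists (`|a| * M1) => x; rewrite normrM ler_wpM2l.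
- have := wave_closureZ (a%:C%C) c1; congr wave_closure; apply/funext => x.
  by rewrite mulrCA rmorphM.
Qed.

Lemma wave_approx_cos b th : wave_approx (fun x => cos (dotv b x + th)).
Proof.
split; first exact: measurable_cos_dotv.
  by exists 1 => x; exact: cos_max.
(* Euler's formula: weights [e^{i th}] and [e^{- i th}] on the waves of [b] and [- b]; [k] contains
   the factor 1/2 and undoes their common normalisation. *)
pose k := (2 * wave_const Q B b)^-1.
have := wave_closureD
  (wave_closureZ (Complex (k * cos th) (k * sin th)) (wave_closure_wave b))
  (wave_closureZ (Complex (k * cos th) (- (k * sin th))) (wave_closure_wave (- b))).
congr wave_closure; apply/funext => x.
have sE t : cos (t - pi / 2) = sin t :> R.
  by rewrite cosB cos_pihalf sin_pihalf mulr0 mulr1 add0r.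
rewrite -[(_ + _) x]/(_ * wave b x + _ * wave (- b) x).
rewrite /wave /gwave !sE !addr0 cosD.
have -> : dotv (- b) x = - dotv b x by rewrite /dotv mulNmx mxE.
have -> : wave_const Q B (- b) = wave_const Q B b.
  by rewrite /wave_const /qform !mulNmx linearN mulmxN opprK.
rewrite cosN sinN.
have k0 : wave_const Q B b != 0 by rewrite gt_eqF ?expR_gt0.
rewrite /k; move: k0; move: (w x) (wave_const _ _ _) (cos _) (cos _) (sin _) (sin _)
  => v k1 c1 c2 s1 s2 k0.
by apply: complex_ext; rewrite ?(ReD, ImD) !(ReM, ImM) /=; field.
Qed.

Lemma wave_approx_cst c : wave_approx (fun=> c).
Proof.
have := wave_approxZ c (wave_approx_cos 0 0).
congr wave_approx; apply/funext => x; by rewrite dotv0l addr0 cos0 mulr1.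
Qed.

Lemma inL2_rho_bounded G (M : R) : measurable_fun setT G -> (forall x, `|G x| <= M) ->
  inL2 w (fun x => (w x * G x)%:C%C).
Proof.
move=> mG GM; have [] := @inL2_mul_bounded _ _ _ wp mw (fun x => (G x)%:C%C) (wave 0) M.
- by split => //=; exact: measurable_cst.
- by move=> x; rewrite normc_real.
- exact: inL2_wave.
- move=> H _; move: H; congr (inL2 w); apply/funext => x.
  by rewrite wave0// -rmorphM /= mulrC.
Qed.

Lemma wave_approx_lim (G_ : nat -> 'rV[R]_n -> R) G (M : R) :
  (forall k, wave_approx (G_ k)) -> (forall k x, `|G_ k x| <= M) ->
  (forall x, G_ k x @[k --> \oo] --> G x) -> wave_approx G.
Proof.
move=> HG GM cG.
have mG : measurable_fun setT G.
  by apply: (measurable_fun_cvg (h := G_)) => [k|x _]; [have [] := HG k|exact: cG].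
have M0 x : 0 <= M := le_trans (normr_ge0 _) (GM 0 x).
have bG x : `|G x| <= M.
  rewrite -(cvg_lim (@Rhausdorff R) (cvg_norm (cG x))).
  apply: limr_le; first by apply/cvg_ex; eexists; exact: cvg_norm (cG x).
  by apply: nearW => k; exact: GM.
split=> //; first by exists M.
apply: (L2closure_lim wp mw wave_span_inL2); first exact: inL2_rho_bounded bG.
have E k x : Normc.normc ((w x * G x)%:C%C - (w x * G_ k x)%:C%C) ^+ 2 / w x =
    w x * (G x - G_ k x) ^+ 2.
  rewrite normc_realB real_normK ?num_real// -mulrBr exprMn.
  by field; rewrite lt0r_neq0.
move=> e e0; have := @normL2_dominated _ _ _ wp mw (fun k x => (w x * G_ k x)%:C%C)
  (fun x => (w x * G x)%:C%C) (fun x => 4 * M ^+ 2 * w x) _ _ _ _ _ e e0.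
case.
- by move=> k; have [mk _ _] := HG k; exact: inL2_rho_bounded (GM k).
- exact: inL2_rho_bounded bG.
- exact: (integrableZl measurableT _ (integrable_rho Sp)).
- move=> k x; rewrite E mulrC ler_pM2r// -[leLHS]real_normK ?num_real//.
  have : `|G x - G_ k x| <= 2 * M.
    by rewrite (le_trans (ler_normB _ _))// mulr_natl mulr2n lerD.
  rewrite (_ : 4 * M ^+ 2 = (2 * M) ^+ 2); last by ring.
  by move=> h; rewrite lerXn2r ?nnegrE ?mulr_ge0 ?(M0 x).
- move=> x; suff H : w x * ((G x - G_ k x) * (G x - G_ k x)) @[k --> \oo] --> 0.
    by under eq_fun do rewrite E expr2.
  rewrite -[X in _ --> X](mulr0 (w x)); apply: cvgM; first exact: cvg_cst.
  rewrite -[X in _ --> X](mulr0 0).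
  have c0 : G x - G_ k x @[k --> \oo] --> 0.
    by rewrite -[X in _ --> X](subrr (G x)); apply: cvgB; [exact: cvg_cst|exact: cG].
  exact: cvgM.
- by move=> k Hk; exists (fun x => (w x * G_ k x)%:C%C) => //; have [] := HG k.
Qed.

(* x |-> x (3 - x^2) / 2 iterates to the sign on [-1, 1]. *)
Lemma wave_approx_sg G : wave_approx G -> (forall x, `|G x| <= 1) ->
  wave_approx (fun x => Num.sg (G x)).
Proof.
move=> HG G1; apply: (@wave_approx_lim (fun k x => iter k (@sign_step R) (G x)) _ 1).
- elim=> [//|k IH] /=.
  rewrite (_ : (fun x => _) = fun x => 2^-1 * iter k (@sign_step R) (G x) *
    (3 + -1 * (iter k (@sign_step R) (G x) * iter k (@sign_step R) (G x)))).
    apply: wave_approxM; first exact: wave_approxZ.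
    apply: wave_approxD; first exact: wave_approx_cst.
    by apply: wave_approxZ; exact: wave_approxM.
  by apply/funext => x; rewrite /sign_step; ring.
- by move=> k x; exact: iter_sign_step_norm.
- by move=> x; exact: cvg_iter_sign_step.
Qed.

(* sg (x_i - a) is the limit of sg (sin ((x_i - a) / (k + 1))). *)
Lemma wave_approx_ray (i : 'I_n) (a : R) :
  wave_approx (\1_(@rV_coord R n i @^-1` `]a, +oo[)).
Proof.
have Hs : wave_approx (fun x => Num.sg (x 0 i - a)).
  pose y (k : nat) (x : 'rV[R]_n) := (x 0 i - a) / k.+1%:R.
  apply: (@wave_approx_lim (fun k x => Num.sg (sin (y k x))) _ 1).
  - move=> k; apply: wave_approx_sg; last by move=> x; exact: sin_max.
    have := wave_approx_cos (k.+1%:R^-1 *: delta_mx 0 i) (- (a / k.+1%:R) - pi / 2).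
    congr wave_approx; apply/funext => x.
    rewrite addrA cosB cos_pihalf sin_pihalf mulr0 mulr1 add0r /y mulrBl; congr (sin (_ - _)).
    by rewrite /dotv -scalemxAl mxE -rowE !mxE mulrC.
  - by move=> k x; rewrite normr_sg; case: (_ != 0).
  - move=> x; apply: cvg_near_cst.
    (* From this index on [(|x_i - a| + 1) / (k + 1) < pi], so the sine has the sign of its
       argument; [+ 1] covers [x_i = a]. *)
    have [N _ HN] := near_infty_natSinv_lt (PosNum (divr_gt0 (pi_gt0 R) (ltr_wpDl (normr_ge0 (x 0 i - a)) ltr01))).
    exists N => // k /= Nk; have /= hk := HN k Nk.
    have k0 : 0 < k.+1%:R^-1 :> R by rewrite invr_gt0.
    have pos (t : R) : 0 < t -> t <= `|x 0 i - a| -> 0 < sin (t / k.+1%:R).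
      move=> t0 tx; apply: sin_gt0_pi; rewrite divr_gt0//=.
      apply: (@lt_trans _ _ ((`|x 0 i - a| + 1) / k.+1%:R)).
        by rewrite ltr_pM2r//; lra.
      by rewrite mulrC -ltr_pdivlMr// ltr_wpDl.
    rewrite /y; have [h|h|h] := ltgtP (x 0 i - a) 0.
    + rewrite (ltr0_sg h) -[x 0 i - a]opprK mulNr sinN sgrN gtr0_sg//.
      by apply: pos; [rewrite oppr_gt0|rewrite ler0_norm// ltW].
    + rewrite (gtr0_sg h) gtr0_sg//.
      by apply: pos => //; rewrite gtr0_norm.
    + by rewrite h mul0r sin0.
(* [(s + s^2) / 2] maps the signs -1, 0, 1 to 0, 0, 1. *)
have := wave_approxZ 2^-1 (wave_approxD Hs (wave_approxM Hs Hs)).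
congr wave_approx; apply/funext => x; rewrite indicE.
have -> : (x \in @rV_coord R n i @^-1` `]a, +oo[) = (a < x 0 i).
  by apply/idP/idP; rewrite inE /= in_itv /= andbT.
have [h|h] := ltP a (x 0 i).
  by rewrite gtr0_sg ?subr_gt0//=; lra.
have [h2|h2] := eqVneq (x 0 i) a.
  by rewrite h2 subrr sgr0 /= mulr0 addr0 mulr0.
by rewrite ltr0_sg ?subr_lt0 ?lt_neqAle ?h2//=; lra.
Qed.

Definition wave_set (A : set 'rV[R]_n) : Prop := measurable A /\ wave_approx (\1_A).

(** Complements come from the algebra operations; the indicator of a countable union is the bounded
    pointwise limit of [1 - prod (1 - 1_{A_j})]. *)
Lemma wave_set_sigma_algebra : sigma_algebra setT wave_set.
Proof.
have WC A : wave_set A -> wave_set (~` A).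
  move=> [mA HA]; split; first exact: measurableC.
  have := wave_approxD (wave_approx_cst 1) (wave_approxZ (-1) HA).
  congr wave_approx; apply/funext => x; rewrite !indicE in_setC.
  by case: (_ \in _) => /=; lra.
split.
- split => //; rewrite indic0; exact: wave_approx_cst.
- by move=> A; rewrite setTD; exact: WC.
- move=> A HA; split; first by apply: bigcup_measurable => k _; have [] := HA k.
  pose P k x : R := \prod_(j < k) (1 - \1_(A j) x).
  have P01 k x : 0 <= P k x <= 1.
    elim: k => [|k /andP[IH1 IH2]]; first by rewrite /P big_ord0 ler01 lexx.
    rewrite /P big_ord_recr /= -/(P k x) indicE.
    by case: (_ \in _); rewrite /= ?subrr ?mulr0 ?lexx ?ler01// subr0 mulr1 IH1.
  apply: (@wave_approx_lim (fun k x => 1 - P k x) _ 1).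
  - move=> k; have HP : wave_approx (P k).
      elim: k => [|k IH].
        have := wave_approx_cst 1; congr wave_approx; apply/funext => x.
        by rewrite /P big_ord0.
      have := wave_approxM IH (wave_approxD (wave_approx_cst 1) (wave_approxZ (-1) (HA k).2)).
      congr wave_approx; apply/funext => x.
      by rewrite [in RHS]/P big_ord_recr /= -/(P k x) mulN1r.
    have := wave_approxD (wave_approx_cst 1) (wave_approxZ (-1) HP).
    by congr wave_approx; apply/funext => x; rewrite mulN1r.
  - by move=> k x; have /andP[h1 h2] := P01 k x; rewrite ger0_norm; lra.
  - move=> x; apply: cvg_near_cst; rewrite indicE.
    have [|xA] := boolP (x \in _).
      rewrite inE => -[j _ Ajx]; exists j.+1 => // k /= jk.
      rewrite /P (bigD1 (Ordinal jk)) //= indicE mem_set//= subrr mul0r subr0.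
      by [].
    apply: nearW => k; rewrite /P big1 ?subrr// => j _.
    rewrite indicE (_ : _ \in _ = false) ?subr0//.
    apply/negP; rewrite inE => Ajx; move/negP: xA; apply; rewrite inE.
    by exists j.
Qed.

(** Preimages of Borel sets of the line under coordinates generate the sigma-algebra, and rays
    generate the Borel sets of the line, so [wave_approx_ray] suffices. *)
Lemma measurable_wave_set (A : set 'rV[R]_n) : measurable A -> wave_set A.
Proof.
have sW := wave_set_sigma_algebra.
apply: smallest_sub => //; rewrite -bigcup_seq => C [i _ [Y mY <-]]; rewrite setTI.
have {mY} : (@ocitv R).-sigma.-measurable Y by [].
rewrite RGenOInfty.measurableE.
apply: (@smallest_sub _ _ _ [set Y | wave_set (@rV_coord R n i @^-1` Y)]).
  have [s0 sC sU] := sW; split.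
  - by rewrite /= preimage_set0.
  - by move=> Z /= /sC; rewrite !setTD preimage_setC.
  - by move=> Z /= /sU; rewrite preimage_bigcup.
move=> Z [a ->] /=; split; last exact: wave_approx_ray.
by rewrite -[X in measurable X]setTI; apply: measurable_rV_coord.
Qed.

Lemma wave_approx_nnsfun (g : {nnsfun 'rV[R]_n >-> R}) : wave_approx g.
Proof.
rewrite (_ : (g : _ -> R) = fun x => \sum_(y <- finmap.enum_fset (fset_set (range g))) y * \1_(g @^-1` [set y]) x).
  elim: (finmap.enum_fset _) => [|y r IH].
    by under eq_fun do rewrite big_nil; exact: wave_approx_cst.
  under eq_fun do rewrite big_cons.
  apply: wave_approxD => //; apply: wave_approxZ.
  have mg : measurable (g @^-1` [set y]).
    by rewrite -[X in measurable X]setTI; apply: measurable_funP.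
  by have [] := measurable_wave_set mg.
by apply/funext => x; rewrite fimfunE fsbig_finite.
Qed.

(** Simple functions increasing to [u / rho], multiplied by [rho], converge to [u] in norm, the
    squared errors being dominated by [u^2 / rho]. *)
Lemma wave_closure_nonneg (u : 'rV[R]_n -> R) : (forall x, 0 <= u x) ->
  inL2 w (fun x => (u x)%:C%C) -> wave_closure (fun x => (u x)%:C%C).
Proof.
move=> u0 Hu; have [[mu _] _] := Hu; rewrite /= in mu.
have mG : measurable_fun setT (fun x => (u x / w x)%:E).
  apply/measurable_EFinP; apply: measurable_funM => //; exact: (measurable_invw wp mw).
have G0 x : setT x -> (0 <= (u x / w x)%:E)%E.
  by rewrite lee_fin divr_ge0// ltW.
have [g [ndg cg]] := approximation measurableT mG G0.
have cgr x : g k x @[k --> \oo] --> u x / w x.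
  by have := cg x I => /fine_cvg.
have gle k x : g k x <= u x / w x.
  rewrite -(cvg_lim (@Rhausdorff R) (cgr x)).
  apply: (nondecreasing_cvgn_le (u_ := fun k => g k x)).
    by move=> a b /ndg /lefP; exact.
  by apply/cvg_ex; eexists; exact: cgr.
apply: (L2closure_lim wp mw wave_span_inL2) => // e e0.
have E k x : Normc.normc ((u x)%:C%C - (w x * g k x)%:C%C) ^+ 2 / w x =
    w x * (u x / w x - g k x) ^+ 2.
  rewrite normc_realB real_normK ?num_real//.
  by field; rewrite lt0r_neq0.
have iu : L.-integrable setT (EFin \o (fun x => Normc.normc ((u x)%:C%C) ^+ 2 / w x)).
  apply/integrableP; split; first by apply: measurable_sqint => //; have [] := Hu.
  have [_] := Hu; rewrite /sqnormL2; congr (_ < _)%E; apply: eq_integral => x _ /=.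
  by rewrite ger0_norm// divr_ge0 ?sqr_ge0// ltW.
have [] := @normL2_dominated _ _ _ wp mw (fun k x => (w x * g k x)%:C%C)
  (fun x => (u x)%:C%C) _ _ Hu iu _ _ e e0.
- by move=> k; have [_ _ []] := wave_approx_nnsfun (g k).
- move=> k x; rewrite E normc_real real_normK ?num_real//.
  rewrite (_ : u x ^+ 2 / w x = w x * (u x / w x) ^+ 2); last by field; rewrite lt0r_neq0.
  rewrite ler_pM2l// lerXn2r ?nnegrE ?subr_ge0 ?divr_ge0 ?(ltW (wp x))//.
  by rewrite gerBl//; exact: fun_ge0.
- move=> x; suff H : w x * ((u x / w x - g k x) * (u x / w x - g k x)) @[k --> \oo] --> 0.
    by under eq_fun do rewrite E expr2.
  rewrite -[X in _ --> X](mulr0 (w x)); apply: cvgM; first exact: cvg_cst.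
  rewrite -[X in _ --> X](mulr0 0).
  have c0 : u x / w x - g k x @[k --> \oo] --> 0.
    by rewrite -[X in _ --> X](subrr (u x / w x)); apply: cvgB; [exact: cvg_cst|exact: cgr].
  exact: cvgM.
- by move=> k Hk; exists (fun x => (w x * g k x)%:C%C) => //; have [] := wave_approx_nnsfun (g k).
Qed.

Lemma wave_dense f : inL2 w f -> wave_closure f.
Proof.
move=> Hf; have [[mr mi] ff] := Hf.
have part (u : 'rV[R]_n -> R) : measurable_fun setT u ->
    (forall x, `|u x| <= Normc.normc (f x)) -> wave_closure (fun x => (u x)%:C%C).
  move=> mu uf.
  have pos (v : 'rV[R]_n -> R) : measurable_fun setT v -> (forall x, 0 <= v x) ->
    (forall x, v x <= Normc.normc (f x)) -> wave_closure (fun x => (v x)%:C%C).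
    move=> mv v0 vf; apply: wave_closure_nonneg => //; split.
      by split => //=; exact: measurable_cst.
    apply: le_lt_trans ff; apply: ge0_le_integral => //.
    - by move=> x _; rewrite lee_fin (sqint_ge0 wp (fun x => (v x)%:C%C)).
    - by apply: (measurable_sqint wp mw); split => //=; exact: measurable_cst.
    - by apply: (measurable_sqint wp mw).
    - move=> x _; rewrite lee_fin ler_pM2r ?invr_gt0// normc_real ger0_norm//.
      by rewrite lerXn2r ?nnegrE ?normc_ge0.
  have h1 := pos (fun x => Num.max (u x) 0) _ _ _.
  have h2 := pos (fun x => Num.max (- u x) 0) _ _ _.
  have := wave_closureD (h1 _ _ _) (wave_closureZ (-1) (h2 _ _ _)).
  rewrite (_ : _ + _ = fun x => (u x)%:C%C); last first.
    apply/funext => x; rewrite -[(_ + _) x]/((Num.max (u x) 0)%:C%C + -1 * (Num.max (- u x) 0)%:C%C).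
    rewrite mulN1r -rmorphB /=; congr (_%:C%C); have [h|h] := leP 0 (u x).
      by rewrite max_r ?subr0// oppr_le0.
    by rewrite max_l ?sub0r ?opprK// oppr_ge0 ltW.
  apply; do ?[by move=> x; rewrite le_max lexx orbT].
  - exact: measurable_maxr.
  - by move=> x; rewrite ge_max normc_ge0 andbT (le_trans (ler_norm _)).
  - by apply: measurable_maxr => //; exact: measurableT_comp.
  - by move=> x; rewrite ge_max normc_ge0 andbT (le_trans (ler_norm _))// normrN.
have := wave_closureD (part _ mr (fun x => Re_le_normc _))
  (wave_closureZ (Complex 0 1) (part _ mi (fun x => Im_le_normc _))).
congr wave_closure; apply/funext => x.
rewrite -[(_ + _) x]/((complex.Re (f x))%:C%C + Complex 0 1 * (complex.Im (f x))%:C%C).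
by apply: complex_ext; rewrite ?(ReD, ImD) !(ReM, ImM) /=; ring.
Qed.

End wave_density.

(** * Relaxation to equilibrium *)

Section mass.
Context (R : realType) (n : nat) (w : 'rV[R]_n -> R).
Hypothesis w_gt0 : forall x, 0 < w x.
Hypothesis mw : measurable_fun setT w.
Notation L := (lebesgue_rV R n).
Hypothesis iw : L.-integrable setT (EFin \o w).
Hypothesis intw : \int[L]_x w x = 1.
Implicit Types f g : 'rV[R]_n -> R[i].

Lemma normL2_le_add f g : inL2 w f -> inL2 w g -> normL2 w f <= normL2 w g + normL2 w (f - g).
Proof.
move=> Hf Hg; have := normL2D w_gt0 mw Hg (inL2B w_gt0 mw Hf Hg).
by rewrite addrC subrK.
Qed.

Lemma integrable_sqint f : inL2 w f ->
  L.-integrable setT (EFin \o (fun x => Normc.normc (f x) ^+ 2 / w x)).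
Proof.
move=> [mf ff]; apply/integrableP; split; first exact: measurable_sqint.
move: ff; rewrite /sqnormL2; congr (_ < _)%E; apply: eq_integral => x _ /=.
by rewrite ger0_norm// sqint_ge0.
Qed.

(* AM-GM: 2 |u| <= |f|^2 / (d w) + d w. *)
Lemma inL2_integral_le f (u : 'rV[R]_n -> R) (d : R) : inL2 w f -> measurable_fun setT u ->
  (forall x, `|u x| <= Normc.normc (f x)) -> 0 < d -> normL2 w f <= d ->
  L.-integrable setT (EFin \o u) /\ `|\int[L]_x u x| <= d.
Proof.
move=> Hf mu uf d0 fd.
have isf := integrable_sqint Hf.
have ig : L.-integrable setT (EFin \o (fun x => (2 * d)^-1 * (Normc.normc (f x) ^+ 2 / w x) + 2^-1 * d * w x)).
  exact: (integrableD measurableT (integrableZl measurableT _ isf) (integrableZl measurableT _ iw)).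
have ug x : `|u x| <= (2 * d)^-1 * (Normc.normc (f x) ^+ 2 / w x) + 2^-1 * d * w x.
  apply: le_trans (uf x) _; rewrite -subr_ge0.
  rewrite (_ : _ - _ = (2 * d * w x)^-1 * (Normc.normc (f x) - d * w x) ^+ 2).
    by rewrite mulr_ge0 ?sqr_ge0// invr_ge0 !mulr_ge0// ltW.
  by field; rewrite !lt0r_neq0.
have iu : L.-integrable setT (EFin \o u).
  apply: le_integrable ig => //; first exact/measurable_EFinP.
  by move=> x _; rewrite lee_fin (le_trans (ug x))// ler_norm.
split=> //; apply: le_trans (le_normr_Rintegral measurableT iu) _.
apply: le_trans (le_Rintegral measurableT (integrable_norm iu) ig (fun x _ => ug x)) _.
rewrite RintegralD//; [|exact: (integrableZl measurableT _ isf)|exact: (integrableZl measurableT _ iw)].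
rewrite !RintegralZl// intw mulr1.
have -> : \int[L]_x (Normc.normc (f x) ^+ 2 / w x) = normL2 w f ^+ 2.
  by rewrite /Rintegral -/(sqnormL2 w f) (sqnormL2E w_gt0 Hf).
have : normL2 w f ^+ 2 <= d ^+ 2 by rewrite lerXn2r ?nnegrE ?normL2_ge0// ltW.
rewrite -(ler_pM2l (_ : 0 < (2 * d)^-1)) ?invr_gt0 ?mulr_gt0// => h.
apply: le_trans (lerD h (lexx _)) _.
by rewrite (_ : _ + _ = d)//; field; rewrite lt0r_neq0.
Qed.

Lemma inL2_integrable f : inL2 w f ->
  L.-integrable setT (EFin \o (fun x => complex.Re (f x))) /\
  L.-integrable setT (EFin \o (fun x => complex.Im (f x))).
Proof.
move=> Hf; have [[mr mi] _] := Hf.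
have d0 : 0 < normL2 w f + 1 by rewrite ltr_wpDl ?normL2_ge0.
have d1 : normL2 w f <= normL2 w f + 1 by rewrite lerDl.
have [h1 _] := inL2_integral_le Hf mr (fun x => Re_le_normc _) d0 d1.
by have [h2 _] := inL2_integral_le Hf mi (fun x => Im_le_normc _) d0 d1.
Qed.

Lemma cintDZ a f g : inL2 w f -> inL2 w g -> cint (a *: f + g) = a * cint f + cint g.
Proof.
move=> Hf Hg; have [rf jf] := inL2_integrable Hf; have [rg jg] := inL2_integrable Hg.
have iZ c (u : 'rV[R]_n -> R) : L.-integrable setT (EFin \o u) ->
    L.-integrable setT (EFin \o (fun x => c * u x)).
  by move=> iu; exact: (integrableZl measurableT c iu).
have iB (u v : 'rV[R]_n -> R) : L.-integrable setT (EFin \o u) ->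
    L.-integrable setT (EFin \o v) -> L.-integrable setT (EFin \o (fun x => u x - v x)).
  by move=> iu iv; exact: (integrableB measurableT iu iv).
have iD (u v : 'rV[R]_n -> R) : L.-integrable setT (EFin \o u) ->
    L.-integrable setT (EFin \o v) -> L.-integrable setT (EFin \o (fun x => u x + v x)).
  by move=> iu iv; exact: (integrableD measurableT iu iv).
apply: complex_ext; rewrite ?(ReD, ImD, ReM, ImM) /=.
- have E x : complex.Re ((a *: f + g) x) =
      complex.Re a * complex.Re (f x) - complex.Im a * complex.Im (f x) + complex.Re (g x).
    by rewrite -[(_ + _) x]/(a * f x + g x) ReD ReM.
  under eq_Rintegral do rewrite E.
  rewrite RintegralD//; last exact: (iB _ _ (iZ _ _ rf) (iZ _ _ jf)).
  rewrite RintegralB//; [|exact: iZ|exact: iZ].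
  by rewrite !RintegralZl.
- have E x : complex.Im ((a *: f + g) x) =
      complex.Re a * complex.Im (f x) + complex.Im a * complex.Re (f x) + complex.Im (g x).
    by rewrite -[(_ + _) x]/(a * f x + g x) ImD ImM.
  under eq_Rintegral do rewrite E.
  rewrite RintegralD//; last exact: (iD _ _ (iZ _ _ jf) (iZ _ _ rf)).
  rewrite RintegralD//; [|exact: iZ|exact: iZ].
  by rewrite !RintegralZl.
Qed.

Lemma normc_le_ReIm (z : R[i]) (d : R) : `|complex.Re z| <= d -> `|complex.Im z| <= d ->
  Normc.normc z <= 2 * d.
Proof.
move=> h1 h2; have d0 : 0 <= d := le_trans (normr_ge0 _) h1.
rewrite -ler_sqr ?nnegrE ?normc_ge0 ?mulr_ge0// normc_sqE.
have s1 : complex.Re z ^+ 2 <= d ^+ 2 by rewrite -real_normK ?num_real// lerXn2r ?nnegrE.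
have s2 : complex.Im z ^+ 2 <= d ^+ 2 by rewrite -real_normK ?num_real// lerXn2r ?nnegrE.
by have := sqr_ge0 d; rewrite exprMn; lra.
Qed.

Lemma normc_cint_le f (d : R) : inL2 w f -> 0 < d -> normL2 w f <= d ->
  Normc.normc (cint f) <= 2 * d.
Proof.
move=> Hf d0 fd; have [[mr mi] _] := Hf; apply: normc_le_ReIm.
- by have [] := inL2_integral_le Hf mr (fun x => Re_le_normc _) d0 fd.
- by have [] := inL2_integral_le Hf mi (fun x => Im_le_normc _) d0 fd.
Qed.

Lemma entropy2E f : entropy2 w f = sqnormL2 w (f - (fun x => (w x)%:C%C)).
Proof.
apply: eq_integral => x _; congr EFin.
rewrite -[(_ - _) x]/(f x - (w x)%:C%C).
have w0 : (w x)%:C%C != 0 by rewrite fmorph_eq0 lt0r_neq0.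
have -> : f x / (w x)%:C%C - 1 = (f x - (w x)%:C%C) * ((w x)^-1)%:C%C.
  by rewrite mulrBl -rmorphM /= divff ?lt0r_neq0// fmorphV.
rewrite normcM exprMn normc_real real_normK ?num_real//.
by field; rewrite lt0r_neq0.
Qed.

End mass.

(** With [v = b S e^{tB^T}] the left side is [qform P v v], quadratic in [e^{tB}], whence the rate
    [2 * tau]. Cauchy-Schwarz bounds the entries of [b S] through the square root of [qform S b b],
    so the constant is uniform in [b]. *)
Lemma qform_flow_decay (R : realType) n (Q B : 'M[R]_n) (tau C0 : R) :
  posdefmx (Qinf Q B) ->
  (forall t : R, 0 <= t -> forall i j : 'I_n, `|expmx (t *: B) i j| <= C0 * expR (- tau * t)) ->
  exists2 C : R, 0 < C & forall (b : 'rV[R]_n) (t : R), 0 <= t ->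
    qform (Qinf Q B) (flow Q B b t) (flow Q B b t) <=
    C * expR (- 2 * tau * t) * qform (Qinf Q B) b b.
Proof.
move=> Sp dec; set S := Qinf Q B in Sp *; set P := invmx S.
pose K1 : R := \sum_i \sum_j `|P i j|; pose K2 := \sum_(k < n) Num.sqrt (S k k).
have K10 : 0 <= K1 by apply: sumr_ge0 => i _; apply: sumr_ge0.
exists (K1 * K2 ^+ 2 * C0 ^+ 2 + 1).
  by rewrite ltr_wpDl// (mulr_ge0 (mulr_ge0 K10 (sqr_ge0 _)) (sqr_ge0 _)).
move=> b t t0; set q := qform S b b.
have q0 : 0 <= q by exact: posdef_qform_ge0.
have Skk k : qform S (delta_mx 0 k) (delta_mx 0 k) = S k k.
  by rewrite /qform -rowE trmx_delta -colE !mxE.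
have ck k : `|(b *m S) 0 k| <= Num.sqrt q * Num.sqrt (S k k).
  have S0 : 0 <= S k k by rewrite -Skk posdef_qform_ge0.
  rewrite -sqrtrM// -sqrtr_sqr ler_sqrt ?mulr_ge0//.
  have := qform_CS b (delta_mx 0 k) Sp; rewrite Skk.
  by rewrite {1}/qform trmx_delta -colE mxE.
have sc : \sum_k `|(b *m S) 0 k| <= Num.sqrt q * K2.
  by rewrite mulr_sumr; apply: ler_sum => k _.
pose v := b *m S *m expmx (t *: B^T).
set E := expR (- tau * t) in dec *.
have C00 i : 0 <= C0 * E := le_trans (normr_ge0 _) (dec t t0 i i).
have vj j : `|v 0 j| <= Num.sqrt q * K2 * (C0 * E).
  rewrite mxE; apply: le_trans (ler_norm_sum _ _ _) _.
  apply: (@le_trans _ _ ((\sum_k `|(b *m S) 0 k|) * (C0 * E))); last exact: ler_wpM2r (C00 j) _ _ sc.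
  rewrite mulr_suml; apply: ler_sum => k _; rewrite normrM ler_wpM2l//.
  by rewrite -trmx_expmx mxE; exact: dec.
have qE : qform S (flow Q B b t) (flow Q B b t) = qform P v v.
  rewrite /qform /flow -/S -/P -/v trmx_mul (Qinf_inv_sym Sp) !mulmxA mulmxKV ?Qinf_unit//.
rewrite qE qformE.
set z := Num.sqrt q * K2 * (C0 * E) in vj.
apply: (@le_trans _ _ (K1 * z ^+ 2)).
  rewrite mulr_suml; apply: ler_sum => i _; rewrite mulr_suml; apply: ler_sum => j _.
  apply: le_trans (ler_norm _) _; rewrite normrM ler_wpM2l// normrM expr2.
  by rewrite ler_pM.
have E2 : E ^+ 2 = expR (- 2 * tau * t).
  by rewrite expr2 -expRD; congr expR; ring.
rewrite /z -E2 !exprMn sqr_sqrtr// -subr_ge0.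
rewrite (_ : _ - _ = E ^+ 2 * q); first by rewrite mulr_ge0 ?sqr_ge0.
by ring.
Qed.

Section relaxation.
Context (R : realType) (n : nat) (Q B : 'M[R]_n).
Let S := Qinf Q B.
Hypothesis Sp : posdefmx S.
Hypothesis Qp : psdmx Q.
Hypothesis lyap : B *m S + S *m B^T = - Q.
Variable T : R -> ('rV[R]_n -> R[i]) -> ('rV[R]_n -> R[i]).
Hypothesis hT : is_FP_semigroup Q B T.
Notation w := (rho Q B).
Notation wave := (wave Q B).
Notation flow := (flow Q B).
Let wp := rho_gt0 Sp.
Let mw := @measurable_rho R n Q B.

Lemma FP_semigroup_wave b t : 0 <= t -> normL2 w (T t (wave b) - wave (flow b t)) = 0.
Proof.
move=> t0; rewrite -{1}(flow0 Sp b).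
apply: (C0_cauchy_unique wp mw hT.1 (u := fun s => wave (flow b s))
  (v := fun s => waveP Q B (flow b s))) => //.
- by move=> s _; apply/hT.2; exact: FP_graph_wave.
- by move=> s e s0 e0; exact: wave_right_derive.
- by move=> s e s0 e0; exact: wave_left_continuous.
Qed.

(** [T t] is linear only up to null sets, so the identity is one of seminorm 0, carried through the
    list term by term. *)
Lemma FP_semigroup_wave_sum (s : seq (R[i] * 'rV[R]_n)) t : 0 <= t ->
  normL2 w (T t (\sum_(p <- s) p.1 *: wave p.2) - \sum_(p <- s) p.1 *: wave (flow p.2 t)) = 0.
Proof.
move=> t0; have HW b : inL2 w (wave b) by exact: inL2_wave.
have HT f : inL2 w f -> inL2 w (T t f) by move=> Hf; exact: (C0_stable hT.1).
have HS (r : seq (R[i] * 'rV[R]_n)) (F : 'rV[R]_n -> 'rV[R]_n) :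
    inL2 w (\sum_(p <- r) p.1 *: wave (F p.2)).
  by apply: (inL2_sum wp mw) => p; exact: inL2Z.
apply/eqP; rewrite eq_le normL2_ge0 andbT.
elim: s => [|p s IH].
  rewrite !big_nil subr0; have [M HM] := C0_bounded_normL2 wp hT.1 t0.
  by have := HM 0 (inL2_0 w); rewrite (normL2_0 wp mw) mulr0.
rewrite !big_cons.
set f := \sum_(q <- s) _ in IH *; set g := \sum_(q <- s) _ in IH *.
have Hf : inL2 w f := HS s id.
have Hg : inL2 w g := HS s (fun b => flow b t).
have Hp : inL2 w (p.1 *: wave p.2) by exact: inL2Z.
have -> : T t (p.1 *: wave p.2 + f) - (p.1 *: wave (flow p.2 t) + g) =
  (T t (p.1 *: wave p.2 + f) - (p.1 *: T t (wave p.2) + T t f)) +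
  (p.1 *: (T t (wave p.2) - wave (flow p.2 t)) + (T t f - g)).
  by rewrite scalerBr [X in _ = _ + X]addrACA -opprD addrA subrK.
have H1 : inL2 w (T t (wave p.2) - wave (flow p.2 t)).
  by apply: (inL2B wp mw) => //; exact: HT.
have H2 : inL2 w (T t f - g) by apply: (inL2B wp mw) => //; exact: HT.
have H3 : inL2 w (p.1 *: (T t (wave p.2) - wave (flow p.2 t))) by exact: inL2Z.
have H4 : inL2 w (p.1 *: T t (wave p.2) + T t f).
  by apply: (inL2D wp mw); [apply: inL2Z => //|]; exact: HT.
have H5 : inL2 w (T t (p.1 *: wave p.2 + f)) by apply: HT; exact: (inL2D wp mw).
apply: le_trans (normL2D wp mw (inL2B wp mw H5 H4) (inL2D wp mw H3 H2)) _.
rewrite (C0_linear_normL2 wp mw hT.1)// add0r.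
apply: le_trans (normL2D wp mw H3 H2) _.
by rewrite normL2Z// FP_semigroup_wave// mulr0 add0r.
Qed.

(** The flow is linear in [b], so the form at [u] is the hypothesis evaluated at
    [c = sum u_j b_j]. *)
Lemma psd_kernel_flow m (b : 'I_m -> 'rV[R]_n) (a t : R) :
  (forall c, qform S (flow c t) (flow c t) <= a * qform S c c) ->
  psd_kernel (fun j k => a * qform S (b j) (b k) - qform S (flow (b j) t) (flow (b k) t)).
Proof.
move=> H u; pose c := \sum_j u j *: b j.
have qs (d : 'I_m -> 'rV[R]_n) : \sum_j \sum_k u j * u k * qform S (d j) (d k) =
    qform S (\sum_j u j *: d j) (\sum_j u j *: d j).
  have l1 x : qform S (\sum_j u j *: d j) x = \sum_j u j * qform S (d j) x.
    by elim/big_rec2: _ => [|j y z _ <-]; rewrite ?qform0l// qformDl qformZl.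
  have l2 x : qform S x (\sum_j u j *: d j) = \sum_j u j * qform S x (d j).
    by elim/big_rec2: _ => [|j y z _ <-]; rewrite ?qform0r// qformDr qformZr.
  rewrite l1; apply: eq_bigr => j _; rewrite l2 mulr_sumr.
  by apply: eq_bigr => k _; rewrite mulrA.
under eq_bigr => j _ do under eq_bigr => k _ do rewrite mulrBr mulrCA.
under eq_bigr => j _ do rewrite sumrB -mulr_sumr.
rewrite sumrB -mulr_sumr !qs subr_ge0.
rewrite (_ : \sum_j u j *: flow (b j) t = flow c t); first exact: H.
rewrite /flow /c !mulmx_suml; apply: eq_bigr => j _.
by rewrite -!scalemxAl.
Qed.

(** The mass [cint g] is left free because the approximants supplied by density need not have mass
    1. On the span it is the sum of the coefficients, so subtracting [cint g *: wave 0] centres each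
    wave. *)
Lemma FP_semigroup_span_decay g (a t : R) : 0 <= t -> 0 <= a ->
  (forall c, qform S (flow c t) (flow c t) <= a * qform S c c) -> wave_span Q B g ->
  normL2 w (T t g - cint g *: wave 0) <= Num.sqrt a * normL2 w g.
Proof.
move=> t0 a0 Ha [s gE].
have HW b : inL2 w (wave b) by exact: inL2_wave.
have HS (r : seq (R[i] * 'rV[R]_n)) (F : 'rV[R]_n -> 'rV[R]_n) :
    inL2 w (\sum_(p <- r) p.1 *: wave (F p.2)).
  by apply: (inL2_sum wp mw) => p; exact: inL2Z.
have cg : cint g = \sum_(p <- s) p.1.
  rewrite gE; elim: s {gE} => [|p s IH].
    rewrite !big_nil /cint; have -> : \int[lebesgue_rV R n]_x (0 : R) = 0.
      by rewrite /Rintegral integral0.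
    by [].
  rewrite !big_cons (cintDZ wp mw (integrable_rho Sp) (integral_rho Sp))//; last exact: (HS s id).
  by rewrite cint_wave// mulr1 IH.
pose g' := \sum_(p <- s) p.1 *: wave (flow p.2 t).
have Hg : inL2 w g by rewrite gE; exact: (HS s id).
have Hg' : inL2 w g' := HS s (fun b => flow b t).
have HT : inL2 w (T t g) by exact: (C0_stable hT.1).
have H0 : inL2 w (cint g *: wave 0) by exact: inL2Z.
apply: le_trans (normL2_le_add wp mw (inL2B wp mw HT H0) (inL2B wp mw Hg' H0)) _.
rewrite (_ : T t g - _ - _ = T t g - g'); last by rewrite opprB addrA subrK.
rewrite [in X in _ + X]gE FP_semigroup_wave_sum// addr0.
apply: normL2_le_of_sq => //; first exact: (inL2B wp mw).
  by rewrite mulr_ge0 ?normL2_ge0// sqrtr_ge0.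
rewrite exprMn EFinM -(sqnormL2E wp Hg).
have -> : Num.sqrt a ^+ 2 = a by exact: sqr_sqrtr.
have := @wave_sum_contraction _ _ _ _ Sp _ (fun j => (tnth (in_tuple s) j).1)
  (fun j => (tnth (in_tuple s) j).2) (fun j => flow (tnth (in_tuple s) j).2 t) a a0.
have E1 : g = \sum_(j < size s) (tnth (in_tuple s) j).1 *: wave (tnth (in_tuple s) j).2.
  by rewrite gE big_tnth.
rewrite -E1.
rewrite (_ : g' - _ = \sum_(j < size s) (tnth (in_tuple s) j).1 *:
   (wave (flow (tnth (in_tuple s) j).2 t) - wave 0)).
  apply; last exact: psd_kernel_flow.
  have := @psd_kernel_flow _ (fun j => (tnth (in_tuple s) j).2) 1 t.
  move=> H u; have := H _ u; under eq_bigr do under eq_bigr do rewrite mul1r.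
  by apply => c; rewrite mul1r; exact: qform_flow_le.
rewrite cg /g' scaler_suml -sumrB [LHS]big_tnth; apply: eq_bigr => j _.
by rewrite scalerBr.
Qed.

Lemma FP_semigroup_decay f (a t : R) : 0 <= t -> 0 <= a -> inL2 w f -> cint f = 1 ->
  (forall c, qform S (flow c t) (flow c t) <= a * qform S c c) ->
  normL2 w (T t f - wave 0) <= Num.sqrt a * normL2 w f.
Proof.
move=> t0 a0 Hf f1 Ha; have [M HM] := C0_bounded_normL2 wp hT.1 t0.
have iw := integrable_rho Sp; have intw := integral_rho Sp.
set N0 := normL2 w (wave 0).
pose K := `|M| + Num.sqrt a + 2 * N0 + 1.
have sa0 : 0 <= Num.sqrt a by exact: sqrtr_ge0.
have N00 : 0 <= N0 by exact: normL2_ge0.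
have K0 : 0 < K by rewrite ltr_wpDl// !addr_ge0// mulr_ge0.
apply/ler_addgt0Pr => e e0; pose d := e / K; have d0 : 0 < d by rewrite divr_gt0.
have [_ /(_ d d0)[g [s gE] fg]] := wave_dense Sp Hf.
have Hg : inL2 w g by apply: wave_span_inL2 => //; exists s.
have H0 : inL2 w (wave 0) by exact: inL2_wave.
have HTf : inL2 w (T t f) by exact: (C0_stable hT.1).
have HTg : inL2 w (T t g) by exact: (C0_stable hT.1).
have Hfg : inL2 w (f - g) by exact: (inL2B wp mw).
have HTfg : inL2 w (T t (f - g)) by exact: (C0_stable hT.1).
have h1 : normL2 w (T t f - T t g) <= `|M| * d.
  have E : f = 1 *: (f - g) + g by rewrite scale1r subrK.
  have lin := C0_linear_normL2 wp mw hT.1 1 t0 Hfg Hg.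
  rewrite -E scale1r in lin.
  have := normL2_le_add wp mw (inL2B wp mw HTf HTg) HTfg.
  rewrite (_ : T t f - T t g - _ = T t f - (T t (f - g) + T t g)); last first.
    by rewrite opprD addrA addrAC.
  rewrite lin addr0 => /le_trans; apply; apply: le_trans (HM _ Hfg) _.
  apply: (@le_trans _ _ (`|M| * normL2 w (f - g))); first by rewrite ler_wpM2r ?normL2_ge0 ?ler_norm.
  by rewrite ler_wpM2l.
have h2 : normL2 w (T t g - cint g *: wave 0) <= Num.sqrt a * (normL2 w f + d).
  have sg : wave_span Q B g by exists s.
  apply: le_trans (FP_semigroup_span_decay t0 a0 Ha sg) _.
  rewrite ler_wpM2l//; apply: le_trans (normL2_le_add wp mw Hg Hf) _.
  rewrite lerD2l (_ : g - f = (-1) *: (f - g)); last by rewrite scaleN1r opprB.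
  rewrite normL2Z//; have -> : Normc.normc (-1 : R[i]) = 1.
    have := @normc_real R (-1); rewrite normrN1 => <-; congr Normc.normc.
    by rewrite rmorphN rmorph1.
  by rewrite mul1r.
have h3 : normL2 w ((cint g - 1) *: wave 0) <= 2 * d * N0.
  rewrite normL2Z// ler_wpM2r//.
  have -> : cint g - 1 = - cint (f - g).
    have E : f = 1 *: (f - g) + g by rewrite scale1r subrK.
    have := cintDZ wp mw iw intw 1 Hfg Hg; rewrite -E f1 mul1r => ->.
    by rewrite opprD addrCA subrr addr0.
  have -> : Normc.normc (- cint (f - g)) = Normc.normc (cint (f - g)).
    by case: (cint _) => p q /=; rewrite !sqrrN.
  exact: normc_cint_le.
have H1 : inL2 w (cint g *: wave 0) by exact: inL2Z.
have H2 : inL2 w ((cint g - 1) *: wave 0) by exact: inL2Z.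
rewrite (_ : T t f - wave 0 = (T t f - T t g) +
  ((T t g - cint g *: wave 0) + (cint g - 1) *: wave 0)); last first.
  by rewrite scalerBl scale1r [X in _ = _ + X]addrA subrK [RHS]addrA subrK.
have B1 := inL2B wp mw HTf HTg; have B2 := inL2B wp mw HTg H1.
apply: le_trans (normL2D wp mw B1 (inL2D wp mw B2 H2)) _.
apply: le_trans (lerD h1 (normL2D wp mw B2 H2)) _.
apply: le_trans (lerD (lexx _) (lerD h2 h3)) _.
have dK : d * K = e by rewrite /d divfK// gt_eqF.
rewrite -dK /K; have := d0; set y := normL2 w f; lra.
Qed.

End relaxation.

Theorem corollary2p10 (R : realType) (n : nat) (Q B sqrtQ : 'M[R]_n)
    (T : R -> ('rV[R]_n -> R[i]) -> ('rV[R]_n -> R[i]))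
    (hn : (1 <= n)%N)
    (hQ : psdmx Q)
    (hsqrtQ : is_sqrtmx sqrtQ Q)
    (hrank : \rank (kalman_mx sqrtQ B) = n)
    (hB : forall z : R[i], spectrum B z -> complex.Re z < 0)
    (hT : is_FP_semigroup Q B T) :
  let tau0 := inf [set complex.Re (- z) | z in spectrum B] in
  [/\ tau0 = - sup [set complex.Re z | z in spectrum B],
      0 < tau0 &
      forall tau : R, 0 <= tau -> tau < tau0 ->
      exists C : R, 0 < C /\
        forall (t : R) (f : 'rV[R]_n -> R[i]),
          0 <= t -> inL2 (rho Q B) f -> cint f = 1 ->
          (entropy2 (rho Q B) (T t f) <=
           (C * expR (- 2 * tau * t))%:E * sqnormL2 (rho Q B) f)%E].
Proof.
move=> tau0; have [tauE tau0_gt0 spB] := spectral_abscissaP hn hB.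
split=> // tau tau_ge0 tau_lt.
(* The integral defining [Qinf] needs a positive rate of decay, while [tau] may be 0: [tau0 / 2]
   serves for [Qinf], and [tau] for the final estimate. *)
have h2 : tau0 / 2 < tau0 by rewrite ltr_pdivrMr// ltr_pMr// ltr1n.
have [C1 [C10 dec1]] := expmx_decay spB h2.
have t2 : 0 < tau0 / 2 by rewrite divr_gt0.
have lyap := Qinf_lyapunov Q t2 C10 dec1.
have Spsd := Qinf_psd t2 C10 dec1 hQ.
have Sp : posdefmx (Qinf Q B).
  by split; [exact: Spsd.1|exact: lyapunov_posdef hQ hsqrtQ hrank Spsd lyap].
have [C0 [_ dec]] := expmx_decay spB tau_lt.
have [C C_gt0 decC] := qform_flow_decay Sp dec.
exists C; split=> // t f t0 Hf f1.
have wp := rho_gt0 Sp; have mw := measurable_rho Q B.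
rewrite entropy2E//; have -> : (fun x => (rho Q B x)%:C%C) = wave Q B 0.
  by apply/funext => x; rewrite wave0.
have a0 : 0 <= C * expR (- 2 * tau * t) by rewrite mulr_ge0 ?expR_ge0// ltW.
have := FP_semigroup_decay Sp hQ lyap hT t0 a0 Hf f1 (fun c => decC c t t0).
have HT : inL2 (rho Q B) (T t f - wave Q B 0).
  by apply: inL2B => //; [exact: (C0_stable hT.1)|exact: inL2_wave].
rewrite (sqnormL2E wp HT) (sqnormL2E wp Hf) -EFinM lee_fin => h.
have s0 := sqrtr_ge0 (C * expR (- 2 * tau * t)).
rewrite -[X in _ <= X * _](sqr_sqrtr a0) -exprMn lerXn2r ?nnegrE ?mulr_ge0 ?normL2_ge0//.
Qed.
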